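(* ${\rm NEXP}\not\subseteq {\rm NP}_{\rm T}({\rm NP}\cap \mathrm{NEXPD})$.
   Context: ${\rm NEXP}=\bigcup_{c\ge 1}\mathrm{NTIME}(2^{n^c})$. All languages are over $\Sigma=\{0,1\}$; for a language $A$, $A^{\le n}$ is the set of strings in $A$ of length at most $n$. A function $d:\mathbb{N}\to\mathbb{N}$ is nonexponential if for every constant $c>0$, $d(n)<2^{n^c}$ for infinitely many integers $n$. $\mathrm{NEXPD}$ is the class of languages $A$ whose density function $d_A(n)=|A^{\le n}|$ is nonexponential. For a class $C$ of languages, ${\rm NP}_{\rm T}(C)$ is the class of languages reducible to some language in $C$ via polynomial-time nondeterministic Turing reductions (i.e., accepted by a nondeterministic polynomial-time oracle Turing machine with an oracle from $C$). *)

(* Defs.v *)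
From HB Require Import structures.
From mathcomp Require Import all_boot all_order all_algebra.
From mathcomp Require Import boolp classical_sets reals exp.

Set Implicit Arguments.
Unset Strict Implicit.
Unset Printing Implicit Defensive.

Import Order.TTheory GRing.Theory Num.Theory.

Local Open Scope classical_set_scope.

Definition language := pred (seq bool).

(* [None] is the blank, [Some (inl b)] the bit [b], and the elements of [G]
   are the remaining symbols of the tape alphabet. *)
Definition cell (G : finType) : Type := option (bool + G).

Inductive move := MoveL | Stay | MoveR.

(* A two-way infinite tape: the cells to the left of the head (nearest first),
   the scanned cell and the cells to its right; all other cells are blank. *)
Definition tape (G : finType) : Type := seq (cell G) * cell G * seq (cell G).

Section Tape.
Variable G : finType.
Implicit Type t : tape G.

Definition scanned t : cell G := t.1.2.

Definition act (a : cell G * move) t : tape G :=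
  let: (l, _, r) := t in
  let: (c, m) := a in
  match m with
  | MoveL => (behead l, head None l, c :: r)
  | Stay => (l, c, r)
  | MoveR => (c :: l, head None r, behead r)
  end.

Definition blank_tape : tape G := ([::], None, [::]).

Definition input_tape (x : seq bool) : tape G :=
  let s := [seq Some (inl b) | b <- x] in ([::], head None s, behead s).

(* The bits on the tape, from left to right and independently of the position
   of the head; blanks and auxiliary symbols are skipped. *)
Definition tape_word t : seq bool :=
  let: (l, c, r) := t in
  pmap (fun d : cell G => if d is Some (inl b) then Some b else None)
       (rev l ++ c :: r).

End Tape.

(* There are [extra_tapes.+1] tapes. The instructions that may be applied are
   listed by [trans]; a configuration without any halts. *)
Record ntm := NTM {
  state : finType;
  aux : finType;
  extra_tapes : nat;
  start : state;
  accepting : pred state;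
  trans : state -> {ffun 'I_extra_tapes.+1 -> cell aux} ->
          seq (state * {ffun 'I_extra_tapes.+1 -> cell aux * move})
}.

Definition config (M : ntm) : Type :=
  state M * {ffun 'I_(extra_tapes M).+1 -> tape (aux M)}.

Definition init (M : ntm) (x : seq bool) : config M :=
  (start M,
   [ffun i => if i == ord0 then input_tape (aux M) x else blank_tape (aux M)]).

Definition successors (M : ntm) (C : config M) : seq (config M) :=
  let instr : Type :=
    (state M * {ffun 'I_(extra_tapes M).+1 -> cell (aux M) * move})%type in
  [seq (a.1, [ffun i => act (a.2 i) (C.2 i)])
     | a : instr <- trans C.1 [ffun i => scanned (C.2 i)]].

Definition step (M : ntm) : rel (config M) :=
  fun C C' => C' \in successors C.

Record ontm := ONTM {
  base :> ntm;
  query_tape : 'I_(extra_tapes base).+1;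
  query_state : state base;
  yes_state : state base;
  no_state : state base
}.

(* In the query state the only possible step, whatever [trans] says, is to
   receive the answer of the oracle, with all tapes left unchanged. *)
Definition oracle_step (A : language) (M : ontm) : rel (config M) :=
  fun C C' =>
    if C.1 == query_state M then
      C' == (if A (tape_word (C.2 (query_tape M)))
             then yes_state M else no_state M, C.2)
    else step C C'.

Section Computations.
Variables (M : ntm) (R : rel (config M)).

Definition accepts (x : seq bool) : Prop :=
  exists2 p, path R (init M x) p & accepting (last (init M x) p).1.

Definition halts_within (t : nat) (x : seq bool) : Prop :=
  forall p, path R (init M x) p -> size p <= t.

(* The running time O(t) bounds all computations, accepting or not; the additive
   constant takes care of zeros of [t]. An oracle machine has to meet the bound
   with the oracle it is used with; adding a clock to the machine makes it meet
   the bound with every oracle. *)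
Definition decides_in (t : nat -> nat) (L : language) : Prop :=
  (exists c, forall x, halts_within (c * t (size x) + c) x) /\
  (forall x, L x <-> accepts x).

End Computations.

Definition NTIME (t : nat -> nat) : set language :=
  [set L | exists M : ntm, decides_in (@step M) t L].

Definition NP : set language :=
  \bigcup_(k in [set k | 1 <= k]) NTIME (fun n => n ^ k).

Definition NEXP : set language :=
  \bigcup_(c in [set c | 1 <= c]) NTIME (fun n => 2 ^ (n ^ c)).

Definition NP_T (C : set language) : set language :=
  [set L | exists2 A, C A &
     exists (M : ontm) (k : nat),
       decides_in (oracle_step A (M := M)) (fun n => n ^ k) L].

Definition density (A : language) (n : nat) : nat :=
  \sum_(i < n.+1) #|[pred x : i.-tuple bool | A x]|.

Definition nonexponential (R : realType) (d : nat -> nat) : Prop :=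
  forall c : R, (0 < c)%R ->
    forall N, exists2 n, N <= n & ((d n)%:R < 2 `^ (n%:R `^ c) :> R)%R.

Definition NEXPD (R : realType) : set language :=
  [set A | nonexponential R (density A)].

(* Main.v *)
(* A word can code a finite set of clauses over facts whose arguments are words;
   let [satisfiable] be the set of the codes that have a model of exponential
   size in which a distinguished fact states the code itself. It is in NEXP:
   guess the model. Suppose that an oracle machine M decides it in polynomial
   time with an oracle A in NP of nonexponential density.

   First, clauses can describe that M with oracle A rejects a given x: all runs
   are followed, a positive answer of the oracle is certified by one accepting
   run of the NP machine for A, and a negative one by all its runs. This yields a
   polynomial-time map f such that f(x) is satisfiable iff x is not.

   Second, let a be the number of the words of A whose length is at most p(n) for
   a large polynomial p. For infinitely many n, a is less than 2^r for some r with
   r^2 much smaller than n, so that a can be written into a set of clauses of size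
   n. Listing a different accepted words of length at most p(n) then decides A up
   to this length, and clauses can state that M with oracle A accepts f(x), where
   x is read from the distinguished fact. For the code x of this set of clauses,
   x is satisfiable iff M accepts f(x) iff f(x) is satisfiable iff x is not. *)

Require Import Defs.
From HB Require Import structures.
From mathcomp Require Import all_boot all_order all_algebra.
From mathcomp Require Import boolp classical_sets reals exp zify.

Set Implicit Arguments.
Unset Strict Implicit.
Unset Printing Implicit Defensive.

Local Open Scope classical_set_scope.

(** * Programs for nondeterministic machines *)

(** The two descriptions differ because a code of length n has models of about 2^n symbols only. The
    code f(x) may be padded to any polynomial length, so its models can afford all runs of M and,
    for negative answers, all runs of the machine for A. The diagonal code x has no such freedom: M
    runs on f(x), which is longer than x, and refuting a query by all runs could take exponentially
    many facts in p(n), beyond 2^n. One accepting run of M takes polynomially many facts, and a list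
    of A with one accepting run for each word takes 2^r times a polynomial, which fits. The list
    replaces negative certificates: a different accepted words leave no word of A out.

    The length n also limits what can be written down. The length bound for queries and the padding
    of f(x) are therefore produced by repeated doubling from logarithms in unary, and a is given by
    its binary digits, digit i through a unary word of length i, whence the order r^2 of the
    length. *)

Section Programs.
Variables (G : finType) (K : nat).

Definition scan : Type := {ffun 'I_K.+1 -> cell G}.
Definition acts : Type := {ffun 'I_K.+1 -> cell G * move}.

Inductive prog :=
| Op of (scan -> seq acts)
| Seq of prog & prog
| If of (scan -> bool) & prog & prog
| While of (scan -> bool) & prog.

(** Programs contain functions, so their equality is taken classically. It is needed to turn a
    finite list of stacks of programs into a state type. *)
HB.instance Definition _ := gen_eqMixin prog.
HB.instance Definition _ := gen_choiceMixin prog.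

(* Two streams: the cells left of the head, and those from the head on. Unlike
   [tape], this representation does not see how many blanks are stored. *)
Definition stape : Type := ((nat -> cell G) * (nat -> cell G))%type.
Definition store : Type := 'I_K.+1 -> stape.

Definition scons (T : Type) (x : T) (f : nat -> T) : nat -> T :=
  fun k => if k is k'.+1 then f k' else x.

Definition sact (a : cell G * move) (t : stape) : stape :=
  let r := fun k => t.2 k.+1 in
  match a.2 with
  | MoveL => (fun k => t.1 k.+1, scons (t.1 0) (scons a.1 r))
  | Stay => (t.1, scons a.1 r)
  | MoveR => (scons a.1 t.1, r)
  end.

Definition stape_of (t : tape G) : stape :=
  let: (l, c, r) := t in (nth None l, nth None (c :: r)).

Lemma stape_of_act a t : stape_of (act a t) = sact a (stape_of t).
Proof.
case: t => [[l c] r]; case: a => b [] /=; congr (_, _); apply: funext => k //=.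
- by rewrite nth_behead.
- case: k => [|[|k]] //=; by case: l.
- by case: k.
- by case: k.
- by case: k => [|k] /=; case: r => //=; rewrite ?nth_nil.
Qed.

Definition scan_of (s : store) : scan := [ffun i => (s i).2 0].
Definition sacts (a : acts) (s : store) : store := fun i => sact (a i) (s i).

(* [spec p s n S]: started in [s], every run of [p] ends after at most [n] steps
   and [S] is the set of the possible final stores. *)
Inductive spec : prog -> store -> nat -> (store -> Prop) -> Prop :=
| SpecOp f s : spec (Op f) s 1
    (fun s' => exists2 a, List.In a (f (scan_of s)) & s' = sacts a s)
| SpecSeq p q s n m S S' : spec p s n S ->
    (forall s1, S s1 -> spec q s1 m (S' s1)) ->
    spec (Seq p q) s (n + m).+1 (fun s' => exists2 s1, S s1 & S' s1 s')
| SpecIf (b : scan -> bool) p q s n S : spec (if b (scan_of s) then p else q) s n S ->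
    spec (If b p q) s n.+1 S
| SpecWhileF (b : scan -> bool) p s : ~~ b (scan_of s) -> spec (While b p) s 1 (eq s)
| SpecWhileT (b : scan -> bool) p s n m S S' : b (scan_of s) -> spec p s n S ->
    (forall s1, S s1 -> spec (While b p) s1 m (S' s1)) ->
    spec (While b p) s (n + m).+1 (fun s' => exists2 s1, S s1 & S' s1 s')
| SpecW p s n S n' S' : spec p s n S -> n <= n' -> (forall s', S s' <-> S' s') ->
    spec p s n' S'.

(** The stacks of pending programs that can arise from [p :: k] before control returns to [k]. There
    are finitely many, because the body of a loop returns to the loop itself; they become the states
    of the compiled machine. *)
Fixpoint conts (p : prog) (k : seq prog) : seq (seq prog) :=
  (p :: k) :: match p with
              | Op _ => [::]
              | Seq p1 p2 => conts p1 (p2 :: k) ++ conts p2 k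
              | If _ p1 p2 => conts p1 k ++ conts p2 k
              | While _ p1 => conts p1 (p :: k)
              end.

Definition noop (s : scan) : acts := [ffun i => (s i, Stay)].

Definition nexts (k : seq prog) (s : scan) : seq (seq prog * acts) :=
  match k with
  | [::] => [::]
  | Op f :: k => [seq (k, a) | a <- f s]
  | Seq p q :: k => [:: (p :: q :: k, noop s)]
  | If b p q :: k => [:: ((if b s then p else q) :: k, noop s)]
  | While b p :: k => [:: (if b s then p :: While b p :: k else k, noop s)]
  end.

Lemma In_map (T : Type) (U : eqType) (f : T -> U) (s : seq T) y :
  (y \in [seq f x | x <- s]) <-> exists2 x, List.In x s & y = f x.
Proof.
elim: s => [|x s IH] /=; first by split=> // -[].
rewrite inE; split.
- case/orP=> [/eqP->|h]; first by exists x; [left|].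
  by have [z zs ->] := proj1 IH h; exists z; [right|].
- case=> z [<- ->|zs yE]; first by rewrite eqxx.
  by apply/orP; right; apply: (proj2 IH); exists z.
Qed.

Lemma mem_head_conts p k : p :: k \in conts p k.
Proof. by case: p => *; rewrite /= inE eqxx. Qed.

(** Stated for an arbitrary superset [D], since a subprogram returns to a continuation that lies
    outside its own [conts]. *)
Lemma conts_closed (D : seq (seq prog)) p k :
    k \in D -> {subset conts p k <= D} ->
  forall k1 s ka, k1 \in conts p k -> List.In ka (nexts k1 s) -> ka.1 \in D.
Proof.
elim: p k => [f|p IHp q IHq|b p IHp q IHq|b p IHp] k kD sub k1 s ka.
- rewrite /= inE => /eqP-> /=.
  elim: (f s) => [|a l IH] //= [<-|/IH] //.
- have sp : {subset conts p (q :: k) <= D}.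
    by move=> z zin; apply: sub; rewrite /= inE mem_cat zin orbT.
  have sq : {subset conts q k <= D}.
    by move=> z zin; apply: sub; rewrite /= inE mem_cat zin !orbT.
  rewrite /= inE mem_cat => /or3P[/eqP->|k1in|k1in].
  + by case=> // <-; apply/sp/mem_head_conts.
  + by apply: IHp k1in => //; apply/sq/mem_head_conts.
  + exact: IHq k1in.
- have sp : {subset conts p k <= D}.
    by move=> z zin; apply: sub; rewrite /= inE mem_cat zin orbT.
  have sq : {subset conts q k <= D}.
    by move=> z zin; apply: sub; rewrite /= inE mem_cat zin !orbT.
  rewrite /= inE mem_cat => /or3P[/eqP->|k1in|k1in].
  + by case=> // <- /=; case: ifP => _; [apply/sp|apply/sq]; apply: mem_head_conts.
  + exact: IHp k1in.
  + exact: IHq k1in.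
- have sp : {subset conts p (While b p :: k) <= D}.
    by move=> z zin; apply: sub; rewrite /= inE zin orbT.
  rewrite /= inE => /orP[/eqP->|k1in].
  + by case=> // <- /=; case: ifP => _ //; apply/sp/mem_head_conts.
  + by apply: IHp k1in => //; apply: sub; rewrite mem_head_conts.
Qed.

(** * Compilation of a program into a machine *)

Section Compile.
Variable main : prog.

Definition stacks : seq (seq prog) := [::] :: conts main [::].

Lemma mem_main : [:: main] \in stacks.
Proof. by rewrite inE mem_head_conts orbT. Qed.

Lemma nexts_stacks k s ka : k \in stacks -> List.In ka (nexts k s) ->
  ka.1 \in stacks.
Proof.
rewrite {1}inE => /orP[/eqP->//|]; apply: conts_closed => //.
by move=> z zin; rewrite inE zin orbT.
Qed.

(** By [nexts_stacks] every next stack is in [stacks], so [insub] succeeds on all of them and no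
    instruction is lost. *)
Definition ctrans (q : seq_sub stacks) (s : scan) : seq (seq_sub stacks * acts) :=
  pmap (fun ka => omap (fun k => (k, ka.2)) (insub ka.1)) (nexts (val q) s).

Definition compiled : ntm :=
  @NTM (seq_sub stacks) G K (SeqSub mem_main) (fun q => val q == [::]) ctrans.

Lemma In_ctrans q s (q' : seq_sub stacks) a :
  List.In (q', a) (ctrans q s) <-> List.In (val q', a) (nexts (val q) s).
Proof.
rewrite /ctrans; have : forall ka, List.In ka (nexts (val q) s) -> ka.1 \in stacks.
  by move=> ka; apply: nexts_stacks; apply: valP.
elim: nexts => [|[k b] l IH] //= sub.
have kS : k \in stacks by apply: (sub (k, b)); left.
rewrite /oapp insubT /= -/(pmap _ _) IH; last by move=> ka kain; apply: sub; right.
split; case=> [E|]; [left|by right|left|by right].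
  by case: E => <- <-.
case: E => kE ->; congr (_, _); apply: val_inj; exact: kE.
Qed.

Local Notation conf := (config compiled).
Implicit Type C : conf.

Definition store_of C : store := fun i => stape_of (C.2 i).

Lemma scan_of_store C : [ffun i => scanned (C.2 i)] = scan_of (store_of C).
Proof.
by apply/ffunP => i; rewrite !ffunE /store_of; case: (C.2 i) => [[l c] r].
Qed.

Lemma step_compiled C C' : @step compiled C C' <->
  exists2 a, List.In (val C'.1, a) (nexts (val C.1) (scan_of (store_of C))) &
    forall i, C'.2 i = act (a i) (C.2 i).
Proof.
rewrite /step /successors In_map scan_of_store; split.
- case=> -[q a] qa ->; exists a; first by apply/In_ctrans.
  by move=> i; rewrite ffunE.
- case=> a /In_ctrans qa E; exists (C'.1, a) => //.
  case: C' qa E => q t /= qa E; congr (_, _); apply/ffunP => i.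
  by rewrite E ffunE.
Qed.

(** Both demands of [decides_in], for computations that start in an arbitrary configuration. This
    form composes backwards, from a continuation to the program in front of it. *)
Definition tot C n (P : Prop) :=
  (forall p, path (@step compiled) C p -> size p <= n) /\
  ((exists2 p, path (@step compiled) C p & val (last C p).1 == [::]) <-> P).

Lemma tot_step C n (P : conf -> Prop) : val C.1 != [::] ->
    (forall C', @step compiled C C' -> tot C' n (P C')) ->
  tot C n.+1 (exists2 C', @step compiled C C' & P C').
Proof.
move=> nz H; split.
- case=> [|C' p] //= /andP[CC' pp]; by have [/(_ _ pp)] := H _ CC'.
- split.
  + case=> -[|C' p] /=; first by rewrite (negbTE nz).
    case/andP=> CC' pp ac; exists C' => //.
    by have [_ [+ _]] := H _ CC'; apply; exists p.
  + case=> C' CC' PC'; have [_ [_ /(_ PC')]] := H _ CC'.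
    by case=> p pp ac; exists (C' :: p) => //=; rewrite CC'.
Qed.

Lemma tot_weaken C n n' (P P' : Prop) : tot C n P -> n <= n' -> (P <-> P') ->
  tot C n' P'.
Proof.
case=> H1 H2 nn' PP'; split=> [p /H1 H|]; first exact: leq_trans nn'.
by rewrite H2.
Qed.

Lemma act_noop (t : tape G) : act (scanned t, Stay) t = t.
Proof. by case: t => [[l c] r]. Qed.

Lemma tot_silent C n k (P : Prop) : 
    nexts (val C.1) (scan_of (store_of C)) = [:: (k, noop (scan_of (store_of C)))] ->
    (forall C', val C'.1 = k -> store_of C' = store_of C -> tot C' n P) ->
  tot C n.+1 P.
Proof.
move=> E H; have nz : val C.1 != [::] by apply/eqP => E'; rewrite E' in E.
have hs : forall C', @step compiled C C' -> val C'.1 = k /\ store_of C' = store_of C.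
  move=> C' /step_compiled[a]; rewrite E => -[] // -[kE aE] E'; split=> //.
  apply: funext => i; rewrite /store_of E' -aE -scan_of_store !ffunE.
  by rewrite act_noop.
apply: tot_weaken (leqnn _) _; first apply: (@tot_step _ n (fun=> P)) => //.
  by move=> C' /hs[kE sE]; apply: H.
split=> [[]//|HP].
have kS : k \in stacks.
  by apply: (@nexts_stacks _ (scan_of (store_of C)) (k, noop _) (valP C.1)); rewrite E; left.
exists (SeqSub kS, C.2) => //; apply/step_compiled.
exists (noop (scan_of (store_of C))); first by rewrite E; left.
by move=> i /=; rewrite -scan_of_store !ffunE act_noop.
Qed.

(** The continuation [k] enters only through its own [tot], so the induction over [spec] never has
    to cut a run of the machine into pieces. *)
Lemma spec_tot p s n S : spec p s n S ->
  forall C k m (P : store -> Prop), val C.1 = p :: k -> store_of C = s ->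
    (forall s' C', S s' -> val C'.1 = k -> store_of C' = s' -> tot C' m (P s')) ->
  tot C (n + m) (exists2 s', S s' & P s').
Proof.
elim=> {p s n S} [f s|p q s n m S S' _ IHp _ IHq|b p q s n S _ IH|b p s bF
  |b p s n m S S' bT _ IHp _ IHw|p s n S n' S' _ IH nn' SS'] C k m1 P CE sE H.
- have nE : nexts (val C.1) (scan_of (store_of C)) = [seq (k, a) | a <- f (scan_of s)].
    by rewrite CE sE.
  have inE : forall k' a, List.In (k', a) (nexts (val C.1) (scan_of (store_of C))) <->
      k' = k /\ List.In a (f (scan_of s)).
    move=> k' a; rewrite nE; elim: (f _) => [|a' l IH] /=; first by split=> // -[].
    rewrite IH; split; first by case=> [[-> ->]|[-> ?]]; split; auto.
    by case=> -> [->|?]; auto.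
  have stE : forall C' (a : acts), (forall i, C'.2 i = act (a i) (C.2 i)) ->
      store_of C' = sacts a s.
    move=> C' a E; apply: funext => i; rewrite /store_of E stape_of_act.
    by rewrite -sE.
  have nz : val C.1 != [::] by rewrite CE.
  rewrite addnC addn1.
  apply: tot_weaken (leqnn _) _.
    apply: (@tot_step _ m1 (fun C' => P (store_of C'))) => //.
    move=> C' /step_compiled[a /inE[kE ain] E].
    by apply: H => //; exists a => //; apply: stE.
  split.
  + case=> C' /step_compiled[a /inE[kE ain] E] PC'.
    by exists (store_of C') => //; exists a => //; apply: stE.
  + case=> s' [a ain s'E] Ps'.
    have kS : k \in stacks.
      by apply: (@nexts_stacks _ (scan_of (store_of C)) (k, a) (valP C.1)); apply/inE.
    have E : forall i, (SeqSub kS, [ffun i => act (a i) (C.2 i)]).2 i = act (a i) (C.2 i).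
      by move=> i; rewrite ffunE.
    exists (SeqSub kS, [ffun i => act (a i) (C.2 i)]).
      by apply/step_compiled; exists a => //; apply/inE.
    by rewrite (stE _ a) // -s'E.
- rewrite addSn; apply: (@tot_silent _ _ (p :: q :: k)); first by rewrite CE.
  move=> C1 C1E s1E; rewrite -addnA.
  apply: tot_weaken (leqnn _) _.
    apply: (IHp C1 (q :: k) _ (fun s' => exists2 s'', S' s' s'' & P s'')) => //.
      by rewrite s1E.
    move=> s' C' Ss' C'E s'E; apply: (IHq s' Ss' C' k m1 P) => //.
    by move=> s'' C'' Ss'' C''E s''E; apply: H => //; exists s'.
  split; first by case=> s1 Ss1 [s2 Ss2 Ps2]; exists s2 => //; exists s1.
  by case=> s2 [s1 Ss1 Ss2] Ps2; exists s1 => //; exists s2.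
- rewrite addSn; apply: (@tot_silent _ _ ((if b (scan_of s) then p else q) :: k)).
    by rewrite CE /= sE.
  by move=> C1 C1E s1E; apply: (IH C1 k) => //; rewrite s1E.
- rewrite addnC addn1; apply: (@tot_silent _ _ k).
    by rewrite CE /= sE (negbTE bF).
  move=> C1 C1E s1E; apply: (tot_weaken _ (leqnn _) (P := P s)).
    by apply: (H s C1 erefl) => //; rewrite s1E.
  by split=> [Ps|[s' <- //]]; exists s.
- rewrite addSn; apply: (@tot_silent _ _ (p :: While b p :: k)).
    by rewrite CE /= sE bT.
  move=> C1 C1E s1E; rewrite -addnA.
  apply: tot_weaken (leqnn _) _.
    apply: (IHp C1 (While b p :: k) _ (fun s' => exists2 s'', S' s' s'' & P s'')) => //.
      by rewrite s1E.
    move=> s' C' Ss' C'E s'E; apply: (IHw s' Ss' C' k m1 P) => //.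
    by move=> s'' C'' Ss'' C''E s''E; apply: H => //; exists s'.
  split; first by case=> s1 Ss1 [s2 Ss2 Ps2]; exists s2 => //; exists s1.
  by case=> s2 [s1 Ss1 Ss2] Ps2; exists s1 => //; exists s2.
- apply: tot_weaken; first apply: (IH C k m1 P) => //.
  + by move=> s' C' /SS'; apply: H.
  + by rewrite leq_add2r.
  + by split; case=> s' /SS' Ss' Ps'; exists s'.
Qed.

End Compile.

Definition init_store (x : seq bool) : store :=
  fun i => (fun=> None, nth None (if i == ord0 then [seq Some (inl b) | b <- x] else [::])).

(** The accepting state is the empty stack: a program accepts by having a final store, and it
    rejects by blocking in an [Op] without instructions. *)
Lemma spec_NTIME main (T : seq bool -> nat) (S : seq bool -> store -> Prop)
    (L : language) (t : nat -> nat) c :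
    (forall x, spec main (init_store x) (T x) (S x)) ->
    (forall x, T x <= c * t (size x) + c) ->
    (forall x, L x <-> exists s, S x s) -> NTIME t L.
Proof.
move=> H Tle LS; exists (compiled main).
have tt x : tot (init (compiled main) x) (T x) (L x).
  apply: tot_weaken.
  - apply: (@spec_tot main _ _ _ _ (H x) _ [::] 0 (fun=> True)) => //.
    + apply: funext => i; rewrite /store_of /init_store /= ffunE.
      case: eqP => _ /=; last by congr pair; apply: funext => k; case: k => [|[|k]].
      by congr pair; apply: funext => k; case: x => [|b x]; case: k => [|[|k]].
    + move=> s' C' _ CE _; split.
        case=> [|C'' p] //= /andP[/step_compiled[a]].
        by rewrite CE.
      by split=> // _; exists [::] => //=; rewrite CE.
  - by rewrite addn0.
  - by split=> [[s' Ss' _]|/LS[s' Ss']]; [apply/LS; exists s' | exists s'].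
split.
- exists c => x p pp; apply: leq_trans (Tle x); by have [+ _] := tt x; apply.
- move=> x; have [_ <-] := tt x; split; case=> p pp ac; exists p => //.
Qed.

End Programs.

(** * Time bounds for deterministic fragments *)

Section Run.
Variables (G : finType) (K : nat).
Local Notation scan := (scan G K).
Local Notation store := (store G K).
Local Notation prog := (prog G K).
Implicit Types (p q : prog) (s : store) (i j : 'I_K.+1).

Variable N : nat.
Hypothesis N_gt2 : 2 < N.

(* Time bounds are powers of one number [N] that exceeds all tape contents, so
   that each construct merely increases the exponent. *)
Definition run k p s (Q : store -> Prop) :=
  exists2 s', Q s' & spec p s (N ^ k) (eq s').

Lemma expN_gt0 k : 0 < N ^ k. Proof. by rewrite expn_gt0; lia. Qed.

Lemma run_conseq k k' p s (Q Q' : store -> Prop) : run k p s Q -> k <= k' ->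
  (forall s', Q s' -> Q' s') -> run k' p s Q'.
Proof.
case=> s' Qs' H kk' QQ'; exists s'; first exact: QQ'.
by apply: SpecW H _ _ => //; rewrite leq_exp2l //; lia.
Qed.

Lemma run_seq k p q s Q Q' : run k p s Q ->
  (forall s1, Q s1 -> run k q s1 Q') -> run k.+1 (Seq p q) s Q'.
Proof.
case=> s1 Qs1 Hp /(_ _ Qs1)[s2 Qs2 Hq]; exists s2 => //.
apply: (SpecW (SpecSeq (S' := fun=> eq s2) Hp _)).
- by move=> s' <-; exact: Hq.
- by rewrite expnS; have := expN_gt0 k; nia.
- by move=> s'; split=> [[s'' _]//|<-]; exists s1.
Qed.

Lemma run_if k (b : scan -> bool) p q s Q :
  run k (if b (scan_of s) then p else q) s Q -> run k.+1 (If b p q) s Q.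
Proof.
case=> s' Qs' H; exists s' => //; apply: SpecW (SpecIf H) _ _ => //.
by rewrite expnS; have := expN_gt0 k; nia.
Qed.

(** The measure starts at most at [N] and decreases, so there are at most [N] rounds of [N ^ k + 1]
    steps each. One power of [N] pays for the rounds and one for the overhead. *)
Lemma run_while k (b : scan -> bool) p (I : nat -> store -> Prop) m s :
    (forall m s, I m s -> b (scan_of s) ->
       run k p s (fun s' => exists2 m', m' < m & I m' s')) ->
    I m s -> m <= N ->
  run k.+2 (While b p) s (fun s' => (exists m', I m' s') /\ ~~ b (scan_of s')).
Proof.
move=> H; have : forall m s, I m s -> exists2 s',
    (exists m', I m' s') /\ ~~ b (scan_of s') &
    spec (While b p) s (m * (N ^ k).+1).+1 (eq s').
  move=> {}m; elim/ltn_ind: m => m IH {}s Is.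
  have [bT|bF] := boolP (b (scan_of s)); last first.
    exists s; first by split=> //; exists m.
    by apply: (SpecW (SpecWhileF p bF)) => //; lia.
  have [s1 [m1 m1m Is1] H1] := H _ _ Is bT.
  have [s2 Qs2 H2] := IH _ m1m _ Is1.
  exists s2 => //; apply: SpecW (SpecWhileT (S' := fun=> eq s2) bT H1 _) _ _.
  - by move=> s' <-; exact: H2.
  - by nia.
  - by move=> s'; split=> [[s'' _]//|<-]; exists s1.
move=> {}H Is mN; have [s' Qs' H'] := H _ _ Is; exists s' => //.
apply: SpecW H' _ _ => //; rewrite !expnS.
have := expN_gt0 k; move: (N ^ k) => M M0.
have h1 : m * M.+1 <= N * M.+1 by rewrite leq_mul2r mN orbT.
have h2 : 3 * (N * M) <= N * (N * M) by rewrite leq_mul2r N_gt2 orbT.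
have h3 : N <= N * M by rewrite leq_pmulr.
lia.
Qed.

(** Blanks at the far ends of the lists do not matter, so a tape whose cells have been erased is
    literally equal to an empty one. *)
Definition mk (l r : seq (cell G)) : stape G := (nth None l, nth None r).

Lemma mk_moveR c l x r : sact (c, MoveR) (mk l (x :: r)) = mk (c :: l) r.
Proof. by congr pair; apply: funext => -[]. Qed.

Lemma mk_moveR_nil c l : sact (c, MoveR) (mk l [::]) = mk (c :: l) [::].
Proof. by congr pair; apply: funext => -[|k] //=; rewrite !nth_nil. Qed.

Lemma mk_moveL c y l x r : sact (c, MoveL) (mk (y :: l) (x :: r)) = mk l (y :: c :: r).
Proof. by congr pair; apply: funext => -[|[]]. Qed.

Lemma mk_moveL_nil c x r : sact (c, MoveL) (mk [::] (x :: r)) = mk [::] (None :: c :: r).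
Proof. by congr pair; apply: funext => -[|[]] //= k; rewrite nth_nil. Qed.

Lemma mk_stay c l x r : sact (c, Stay) (mk l (x :: r)) = mk l (c :: r).
Proof. by congr pair; apply: funext => -[|k]. Qed.

Lemma mk_stay_nil c l : sact (c, Stay) (mk l [::]) = mk l [:: c].
Proof. by congr pair; apply: funext => -[|k] //=; rewrite !nth_nil. Qed.

Lemma mk_nilr l : mk l [:: None] = mk l [::].
Proof. by congr pair; apply: funext => -[|[]]. Qed.

Lemma mk_nill r : mk [:: None] r = mk [::] r.
Proof. by congr pair; apply: funext => -[|[]]. Qed.

Lemma mk_rcons l r : mk l (rcons r None) = mk l r.
Proof.
congr pair; apply: funext => k; rewrite nth_rcons.
by case: ltngtP => // [h|->]; rewrite nth_default // ltnW.
Qed.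

Definition upd s i t : store := fun j => if j == i then t else s j.

Lemma upd_eq s i t : upd s i t i = t. Proof. by rewrite /upd eqxx. Qed.

Lemma upd_neq s i t j : j != i -> upd s i t j = s j.
Proof. by rewrite /upd => /negbTE->. Qed.

Lemma upd_upd s i t t' : upd (upd s i t) i t' = upd s i t'.
Proof. by apply: funext => j; rewrite /upd; case: eqP. Qed.

Lemma upd_id s i t : s i = t -> upd s i t = s.
Proof. by move=> <-; apply: funext => j; rewrite /upd; case: eqP => [->|]. Qed.

Lemma updC s i j t t' : i != j -> upd (upd s i t) j t' = upd (upd s j t') i t.
Proof.
move=> ij; apply: funext => k; rewrite /upd.
by case: (k =P j) => // ->; rewrite eq_sym (negbTE ij).
Qed.

Definition act1 i (f : scan -> cell G * move) : prog :=
  Op (fun c => [:: [ffun j => if j == i then f c else (c j, Stay)]]).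

Definition act2 i f i' f' : prog :=
  Op (fun c => [:: [ffun j => if j == i then f c else
                              if j == i' then f' c else (c j, Stay)]]).

Lemma sact_scan s i : sact (scan_of s i, Stay) (s i) = s i.
Proof.
rewrite /scan_of ffunE /sact /=; case: (s i) => l r /=.
by congr pair; apply: funext => -[].
Qed.

Lemma run_op (f : scan -> acts G K) s (Q : store -> Prop) :
  Q (sacts (f (scan_of s)) s) -> run 0 (Op (fun c => [:: f c])) s Q.
Proof.
move=> Qs; exists (sacts (f (scan_of s)) s) => //.
apply: SpecW (SpecOp _ _) _ _ => // s' /=.
split=> [[a [<-|[]] ->]//|<-].
by exists (f (scan_of s)) => //; left.
Qed.

Lemma run_act1 i f s (Q : store -> Prop) :
  Q (upd s i (sact (f (scan_of s)) (s i))) -> run 0 (act1 i f) s Q.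
Proof.
move=> H; apply: run_op; congr Q: H; apply: funext => j.
by rewrite /sacts /upd ffunE; case: eqP => [->//|_]; rewrite sact_scan.
Qed.

Lemma run_act2 i f i' f' s (Q : store -> Prop) : i != i' ->
  Q (upd (upd s i (sact (f (scan_of s)) (s i))) i' (sact (f' (scan_of s)) (s i'))) ->
  run 0 (act2 i f i' f') s Q.
Proof.
move=> ii' H; apply: run_op; congr Q: H; apply: funext => j.
rewrite /sacts /upd ffunE; case: (j =P i) => [->|_].
  by rewrite (negbTE ii').
by case: eqP => [->//|_]; rewrite sact_scan.
Qed.

Definition mvL i := act1 i (fun c => (c i, MoveL)).
Definition mvR i := act1 i (fun c => (c i, MoveR)).
Definition write i x := act1 i (fun c => (x, Stay)).
Definition skip : prog := Op (fun c => [:: noop c]).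
Definition nonblank i : scan -> bool := fun c => c i != None.

Lemma run_skip s (Q : store -> Prop) : Q s -> run 0 skip s Q.
Proof.
move=> H; apply: run_op; congr Q: H; apply: funext => j.
by rewrite /sacts /noop !ffunE /= -[LHS]sact_scan ffunE.
Qed.

Lemma scan_mk s i l r : s i = mk l r -> scan_of s i = head None r.
Proof. by rewrite /scan_of ffunE => -> /=; case: r. Qed.

Definition somes (T : Type) (w : seq T) : seq (option T) := map Some w.
Local Notation sym := (bool + G)%type.
Definition home (w : seq sym) : stape G := mk [::] (somes w).

(** The first move is unconditional, since the head usually stands on the blank behind the word. The
    loop ends on the blank in front of the word. *)
Definition rewind i := Seq (mvL i) (Seq (While (nonblank i) (mvL i)) (mvR i)).

Lemma run_rewind i s a r : s i = mk (somes (rev a)) r -> size a <= N ->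
  run 4 (rewind i) s (eq (upd s i (mk [::] (somes a ++ r)))).
Proof.
move=> si aN.
(* The lemmas about moves to the left need a stored scanned cell; an empty right part is written as
   one blank. *)
have {si} [x [r1 [si Er]]] : exists x r1, s i = mk (somes (rev a)) (x :: r1) /\
    mk [::] (somes a ++ r) = mk [::] (somes a ++ x :: r1).
  case: r si => [|x r1] si; last by exists x, r1.
  by exists None, [::]; rewrite si mk_nilr cats0 cats1 mk_rcons.
pose I m s' := exists a' r', [/\ size a' = m,
  s' = upd s i (if rev a' is x :: l then mk (somes l) (Some x :: r')
                else mk [::] (None :: r'))
  & somes a' ++ r' = somes a ++ x :: r1].
apply: (run_seq (k := 3) (Q := I (size a))).
  apply: run_conseq (run_act1 _) _ (fun=> id) => //.
  rewrite (scan_mk si) si.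
  exists a, (x :: r1); split=> //.
  by case: (rev a) => [|y l]; rewrite ?mk_moveL ?mk_moveL_nil.
move=> s1 I1; apply: (run_seq (k := 2)).
  apply: (run_while (k := 0) (I := I)) I1 _ => //.
  move=> m s2 [a' [r' [am s2E E]]]; rewrite /nonblank.
  have Ea := revK a'; case: (rev a') s2E Ea => [|y l] s2E Ea.
    by rewrite (scan_mk (l := [::]) (r := None :: r')) // s2E upd_eq.
  have si2 : s2 i = mk (somes l) (Some y :: r') by rewrite s2E upd_eq.
  rewrite (scan_mk si2) => _; apply: run_conseq (run_act1 _) _ (fun=> id) => //.
  rewrite (scan_mk si2) si2 s2E upd_upd.
  exists (size l); first by rewrite -am -Ea size_rev.
  exists (rev l), (Some y :: r'); split; first by rewrite size_rev.
    by rewrite revK; case: l {si2 Ea s2E} => [|z l]; rewrite ?mk_moveL ?mk_moveL_nil.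
  by rewrite -E -Ea rev_cons /somes map_rcons cat_rcons.
move=> s2 [[m [a' [r' [am s2E E]]]]]; rewrite /nonblank.
have Ea := revK a'; case: (rev a') s2E Ea => [|y l] s2E Ea; last first.
  by rewrite (scan_mk (l := somes l) (r := Some y :: r')) // s2E upd_eq.
move=> _; apply: run_conseq (run_act1 _) _ (fun=> id) => //.
rewrite s2E upd_upd Er -E upd_eq mk_moveR -Ea /=; congr upd.
by rewrite -(mk_nill r') /scan_of ffunE upd_eq.
Qed.

End Run.

Arguments nonblank {G K} i.
Arguments rewind {G K} i.
Arguments mvL {G K} i.
Arguments mvR {G K} i.
Arguments skip {G K}.
Arguments run_op {G K N}.
Arguments run_act1 {G K N i f s Q}.
Arguments run_act2 {G K N i f i' f' s Q}.
Arguments run_skip {G K N s Q}.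

(** * Evaluation of clause sets *)

Definition extra : finType := (bool + bool + option 'I_5)%type.
Definition sym : Type := (bool + extra)%type.
Definition Bit (b : bool) : sym := inl b.
Definition Hash : sym := inr (inl (inl true)).
Definition Dollar : sym := inr (inl (inl false)).
Definition Lit (b : bool) : sym := inr (inl (inr b)).
Definition Var (i : 'I_5) : sym := inr (inr (Some i)).
Definition End : sym := inr (inr None).

Definition is_bit (c : sym) : bool := if c is inl _ then true else false.
Definition is_lit (c : sym) : bool := if c is inr (inl (inr _)) then true else false.
Definition is_wsym (c : sym) : bool :=
  match c with inl _ | inr (inl (inl _)) => true | _ => false end.
Definition is_pat (c : sym) : bool :=
  match c with inl _ | inr (inl (inl _)) | inr (inr (Some _)) => true | _ => false end.

Fixpoint takew (T : Type) (a : pred T) (s : seq T) : seq T :=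
  if s is x :: s' then if a x then x :: takew a s' else [::] else [::].

Definition valuation := 'I_5 -> seq sym.

Definition subst_sym (v : valuation) (c : sym) : seq sym :=
  if c is inr (inr (Some i)) then takew is_bit (v i) else [:: c].

Definition subst (v : valuation) (p : seq sym) : seq sym := flatten (map (subst_sym v) p).

(** Here [p] is all that follows a literal mark; the fact itself ends at the first symbol that is
    not a pattern symbol, which is the next literal mark or [End]. *)
Definition found (w : seq sym) (v : valuation) (p : seq sym) : bool :=
  has (prefix (subst v (takew is_pat p))) [seq drop k w | k <- iota 0 (size w)].

(** Clauses are read as disjunctions of literals, and [sat] tells whether the current one already
    has a true literal. What follows the last [End] has no effect, so codes can be padded. *)
Fixpoint eval (w : seq sym) (v : valuation) (sat : bool) (ts : seq sym) : bool :=
  if ts is t :: ts' then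
    match t with
    | inr (inr None) => sat && eval w v false ts'
    | inr (inl (inr b)) => eval w v (sat || (found w v ts' == b)) ts'
    | _ => eval w v sat ts'
    end
  else true.

Definition updv (v : valuation) i x : valuation := fun j => if j == i then x else v j.

(** A fixed number of variables leaves [size w ^ 5] valuations, so the exhaustive search is
    polynomial in the length of the guessed word. *)
Fixpoint refuted (w ts : seq sym) (vs : seq 'I_5) (v : valuation) : bool :=
  if vs is i :: vs' then
    has (fun s => refuted w ts vs' (updv v i s)) [seq drop k w | k <- iota 0 (size w)]
  else ~~ eval w v false ts.

Section TheoryEvaluation.
Local Notation K := 12.
Local Notation scan := (scan extra K).
Local Notation store := (store extra K).
Local Notation prog := (prog extra K).

(* The input, the decoded clauses, the guessed word, a suffix of it, the counter
   that limits the guess, flags for a match, for a satisfied clause and for a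
   violated clause, and the values of the five variables. *)
Definition tX : 'I_K.+1 := @Ordinal 13 0 isT.
Definition tP : 'I_K.+1 := @Ordinal 13 1 isT.
Definition tW : 'I_K.+1 := @Ordinal 13 2 isT.
Definition tZ : 'I_K.+1 := @Ordinal 13 3 isT.
Definition tC : 'I_K.+1 := @Ordinal 13 4 isT.
Definition tG : 'I_K.+1 := @Ordinal 13 5 isT.
Definition tF : 'I_K.+1 := @Ordinal 13 6 isT.
Definition tB : 'I_K.+1 := @Ordinal 13 7 isT.
Definition tV (i : 'I_5) : 'I_K.+1 := @rshift 8 5 i.

Lemma tV_inj : injective tV. Proof. exact: (@rshift_inj 8 5). Qed.

Lemma tV_neq (i : 'I_5) (j : 'I_K.+1) : j < 8 -> (tV i == j) = false.
Proof. by move=> j8; apply/eqP => E; move: j8; rewrite -E /= ltnNge leq_addr. Qed.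

Lemma neq_tV (i : 'I_5) (j : 'I_K.+1) : j < 8 -> (j == tV i) = false.
Proof. by move=> j8; rewrite eq_sym tV_neq. Qed.

Definition flag (b : bool) : stape extra :=
  mk [::] (if b then [:: Some (Bit true)] else [::]).

Definition set_flag i : prog := write i (Some (Bit true)).
Definition clear i : prog := write i None.

Definition copy i : prog :=
  Seq (While (nonblank tW) (act2 i (fun c => (c tW, MoveR)) tW (fun c => (c tW, MoveR))))
      (Seq (rewind tW) (rewind i)).

(* The scanned tape is consumed from the left: the cells already dealt with are
   erased, so that [rewind] comes back to the start of the remaining suffix. *)
Definition each i body : prog :=
  Seq (copy i) (While (nonblank i) (Seq body (act1 i (fun=> (None, MoveR))))).

Fixpoint rewinds (vs : seq 'I_5) : prog :=
  if vs is i :: vs' then Seq (rewind (tV i)) (rewinds vs') else skip.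

Definition bit_cell (c : cell extra) : bool := if c is Some x then is_bit x else false.

Definition mcond (c : scan) : bool :=
  match c tP with
  | Some (inl _) | Some (inr (inl (inl _))) => c tZ == c tP
  | Some (inr (inr (Some i))) => ~~ bit_cell (c (tV i)) || (c tZ == c (tV i))
  | _ => false
  end.

Definition mvar_end (c : scan) : bool :=
  if c tP is Some (inr (inr (Some i))) then ~~ bit_cell (c (tV i)) else false.

Definition msrc (c : scan) : 'I_K.+1 :=
  if c tP is Some (inr (inr (Some i))) then tV i else tP.

Definition madvance : prog :=
  Op (fun c => [:: [ffun j => if (j == tZ) || (j == msrc c) then (c j, MoveR)
                              else (c j, Stay)]]).

(** Matching a variable advances the head on the tape of its value. At the end of the value all
    these heads are rewound, because the variable may occur again in the fact. *)
Definition mbody : prog :=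
  If mvar_end (Seq (rewinds (enum 'I_5)) (mvR tP)) madvance.

Definition pat_cell (c : cell extra) : bool := if c is Some x then is_pat x else false.
Definition lit_cell (c : cell extra) : bool := if c is Some x then is_lit x else false.

(** The loop stops at a mismatch or behind the fact. It was a match iff [tP] then scans no pattern
    symbol. The way back on [tP] ends at the literal mark, which no fact contains. *)
Definition attempt : prog :=
  Seq (mvR tP) (Seq (While mcond mbody)
  (Seq (If (fun c => pat_cell (c tP)) skip (set_flag tG))
  (Seq (Seq (mvL tP) (While (fun c => ~~ lit_cell (c tP)) (mvL tP)))
  (Seq (rewind tZ) (rewinds (enum 'I_5)))))).

Definition check_lit : prog :=
  Seq (each tZ attempt)
  (Seq (If (fun c => nonblank tG c == (c tP == Some (Lit true))) (set_flag tF) skip)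
       (clear tG)).

Definition check_tok : prog :=
  Seq (If (fun c => lit_cell (c tP)) check_lit
      (If (fun c => c tP == Some End)
          (Seq (If (nonblank tF) skip (set_flag tB)) (clear tF)) skip))
      (mvR tP).

Definition check : prog :=
  Seq (While (nonblank tP) check_tok) (Seq (rewind tP) (clear tF)).

Fixpoint nest (vs : seq 'I_5) : prog :=
  if vs is i :: vs' then each (tV i) (nest vs') else check.

Ltac case_tape j :=
  repeat match goal with |- context [j == ?k] =>
    let e := fresh in case: (j =P k) => [e|_]; [rewrite ?e //|] => // end.

Ltac store_eq := let j := fresh in apply: funext => j; rewrite /upd; case_tape j.

Section Spec.
Variable N : nat.
Hypothesis N_gt2 : 2 < N.
Local Notation run := (run N).

Lemma run_copy i s w : i != tW -> s tW = home w -> s i = home [::] -> size w <= N ->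
  run 6 (copy i) s (eq (upd s i (home w))).
Proof.
move=> iW sW si wN.
pose I m s' := exists w1 w2, [/\ w = w1 ++ w2, m = size w2 &
   s' = upd (upd s i (mk (somes (rev w1)) [::])) tW (mk (somes (rev w1)) (somes w2))].
have I0 : I (size w) s.
  by exists [::], w; split=> //; rewrite upd_id // (upd_id (s := s)) // .
apply: (run_seq N_gt2 (k := 5)).
  apply: (run_conseq N_gt2 (run_while N_gt2 (k := 0) _ I0 wN)) (fun=> id) => //.
  move=> m s1 [w1 [w2 [wE mE s1E]]]; rewrite /nonblank.
  have s1W : s1 tW = mk (somes (rev w1)) (somes w2) by rewrite s1E upd_eq.
  have s1i : s1 i = mk (somes (rev w1)) [::] by rewrite s1E upd_neq // upd_eq.
  rewrite (scan_mk s1W); case: w2 mE wE s1E s1W => [|x w2] // mE wE s1E s1W _.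
  apply: (run_act2 iW).
  exists (size w2); first by rewrite mE.
  exists (rcons w1 x), w2; split=> //; first by rewrite wE cat_rcons.
  rewrite (scan_mk s1W) s1W s1i mk_moveR mk_moveR_nil rev_rcons /=.
  by rewrite s1E; apply: funext => j; rewrite /upd; repeat (case: eqP => // _).
move=> s1 [[m [w1 [w2 [wE mE s1E]]]]]; rewrite /nonblank.
have s1W : s1 tW = mk (somes (rev w1)) (somes w2) by rewrite s1E upd_eq.
have s1i : s1 i = mk (somes (rev w1)) [::] by rewrite s1E upd_neq // upd_eq.
rewrite (scan_mk s1W); case: w2 mE wE s1E s1W => [|x w2] // mE wE s1E s1W _.
rewrite cats0 in wE; subst w1.
apply: (run_seq N_gt2 (k := 4)); first exact: (run_rewind N_gt2 s1W wN).
move=> s2 <-; apply: (run_conseq N_gt2 (run_rewind N_gt2 (a := w) (r := [::]) _ wN) (leqnn _)).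
  by rewrite upd_neq.
move=> s3 <-; rewrite s1E !cats0; apply: funext => j; rewrite /upd.
by case: (j =P i) => // _; case: (j =P tW) => // ->.
Qed.

Lemma run_write i x (s : store) t (Q : store -> Prop) : s i = t ->
  Q (upd s i (sact (x, Stay) t)) -> run 0 (write i x) s Q.
Proof. by move=> <- H; apply: run_act1. Qed.

Lemma flag_set b : sact (Some (Bit true), Stay) (flag b) = flag true.
Proof. by case: b; rewrite /flag ?mk_stay ?mk_stay_nil. Qed.

Lemma flag_clear b : sact (None, Stay) (flag b) = flag false.
Proof. by case: b; rewrite /flag ?mk_stay ?mk_stay_nil mk_nilr. Qed.

Lemma run_set_flag i b (s : store) : s i = flag b -> run 0 (set_flag i) s (eq (upd s i (flag true))).
Proof. by move=> si; apply: run_write si _; rewrite flag_set. Qed.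

Lemma run_clear i b (s : store) : s i = flag b -> run 0 (clear i) s (eq (upd s i (flag false))).
Proof. by move=> si; apply: run_write si _; rewrite flag_clear. Qed.

Lemma scan_flag i b (s : store) : s i = flag b -> nonblank i (scan_of s) = b.
Proof. by move=> si; rewrite /nonblank (scan_mk si); case: b si. Qed.

(** The flag accumulates a disjunction over all suffixes. Since tape [i] ends up blank, the store
    changes in the flag only and the search can be nested. *)
Lemma run_each k i j body (s : store) w (P : seq sym -> bool) f :
    i != tW -> i != j -> j != tW -> s tW = home w -> s i = home [::] ->
    s j = flag f -> size w <= N ->
    (forall x f, x \in [seq drop k w | k <- iota 0 (size w)] ->
       run k body (upd (upd s i (home x)) j (flag f))
         (eq (upd (upd s i (home x)) j (flag (f || P x))))) ->
  run (k + 7) (each i body) s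
    (eq (upd s j (flag (f || has P [seq drop k w | k <- iota 0 (size w)])))).
Proof.
move=> iW ij jW sW si sj wN H; rewrite addnS.
apply: (run_seq N_gt2).
  by apply: (run_conseq N_gt2 (run_copy iW sW si wN)) (fun=> id); rewrite leq_addl.
move=> s1 <-.
pose I m s' := m <= size w /\ s' = upd (upd s i (home (drop (size w - m) w))) j
   (flag (f || has P [seq drop k w | k <- iota 0 (size w - m)])).
apply: (run_conseq N_gt2 (k := k.+3)).
- apply: (run_while N_gt2 (k := k.+1) (I := I)) wN.
  + move=> m s2 [mw s2E]; rewrite /nonblank.
    have s2i : s2 i = home (drop (size w - m) w) by rewrite s2E upd_neq // upd_eq.
    rewrite (scan_mk s2i) => nb.
    have m0 : 0 < m.
      by case: m nb {s2E s2i mw} => //; rewrite subn0 drop_size.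
    have lt : size w - m < size w by lia.
    apply: (run_seq N_gt2).
      rewrite s2E; apply: H; apply/mapP; exists (size w - m) => //.
      by rewrite mem_iota.
    move=> s3 <-; apply: (run_conseq N_gt2 (run_act1 _) _ (fun _ => id)) => //.
    exists m.-1; first by lia.
    split; first by lia.
    have -> : size w - m.-1 = (size w - m).+1 by lia.
    have -> : iota 0 (size w - m).+1 = rcons (iota 0 (size w - m)) (size w - m).
      by rewrite -cats1 -addn1 iotaD.
    rewrite upd_neq // upd_eq (drop_nth Hash lt) /home /= mk_moveR mk_nill.
    rewrite map_rcons has_rcons (updC _ _ _ ij) upd_upd (updC _ _ _ ij).
    by rewrite (drop_nth Hash lt) -orbA [P _ || _]orbC.
  + split=> //; rewrite subnn /= orbF drop0 (upd_id (i := j)) //.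
    by rewrite upd_neq // eq_sym.
- by lia.
move=> s2 [[m [mw s2E]]]; rewrite /nonblank.
have s2i : s2 i = home (drop (size w - m) w) by rewrite s2E upd_neq // upd_eq.
rewrite (scan_mk s2i); case: m mw s2E s2i => [|m] mw s2E s2i.
  by move=> _; rewrite s2E subn0 drop_size (upd_id (i := i)).
have lt : size w - m.+1 < size w by lia.
by rewrite (drop_nth Hash lt).
Qed.

End Spec.

Section Spec.
Variable N : nat.
Hypothesis N_gt2 : 2 < N.
Local Notation run := (run N).
Local Notation stape := (stape extra).

Definition setV (s : store) (f : 'I_5 -> stape) : store :=
  fun j => if @split 8 5 j is inr i then f i else s j.

Lemma setV_tV s f i : setV s f (tV i) = f i.
Proof. by rewrite /setV (unsplitK (inr i)). Qed.

Lemma setV_lt s f (j : 'I_13) : j < 8 -> setV s f j = s j.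
Proof. by rewrite /setV /split; case: ltnP. Qed.

Lemma tapeP (P : 'I_13 -> Prop) :
  (forall i, P (tV i)) -> (forall j : 'I_13, j < 8 -> P j) -> forall j, P j.
Proof.
move=> H1 H2 j; case: (@split_ordP 8 5 j) => i jE; last by rewrite jE; apply: H1.
by apply: H2; rewrite jE /=.
Qed.

Lemma upd_setV s f i t :
  upd (setV s f) (tV i) t = setV s (fun k => if k == i then t else f k).
Proof.
apply: funext; apply: tapeP => [k|j j8].
- by rewrite setV_tV /upd (inj_eq tV_inj) setV_tV.
- by rewrite /upd neq_tV // !setV_lt.
Qed.

Lemma setV_upd s f (j : 'I_13) t : j < 8 -> upd (setV s f) j t = setV (upd s j t) f.
Proof.
move=> j8; apply: funext; apply: tapeP => [k|j' j8'].
- by rewrite setV_tV /upd tV_neq // setV_tV.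
- by rewrite /upd !setV_lt.
Qed.

Lemma run_rewinds vs s (a b : 'I_5 -> seq sym) :
    (forall i, size (a i) <= N) ->
  run (4 + size vs) (rewinds vs)
    (setV s (fun i => mk (somes (rev (a i))) (somes (b i))))
    (eq (setV s (fun i => if i \in vs then home (a i ++ b i)
                          else mk (somes (rev (a i))) (somes (b i))))).
Proof.
elim: vs a b => [|i vs IH] a b aN /=.
  by apply: (run_conseq N_gt2 (run_skip erefl)).
rewrite addnS; apply: (run_seq N_gt2).
  have := run_rewind N_gt2
    (setV_tV s (fun i => mk (somes (rev (a i))) (somes (b i))) i) (aN i).
  by move=> H; apply: (run_conseq N_gt2 H) (fun=> id); rewrite leq_addr.
move=> s1 <-; rewrite upd_setV.
pose a' k := if k == i then [::] else a k.
pose b' k := if k == i then a k ++ b k else b k.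
have -> : (fun k => if k == i then mk [::] (somes (a i) ++ somes (b i))
      else mk (somes (rev (a k))) (somes (b k))) =
    (fun k => mk (somes (rev (a' k))) (somes (b' k))).
  apply: funext => k; rewrite /a' /b'; case: eqP => // ->.
  by rewrite /somes map_cat.
apply: (run_conseq N_gt2 (IH a' b' _)) => // [k|s2 <-].
  by rewrite /a'; case: eqP.
congr setV; apply: funext => k; rewrite inE /a' /b'.
by case: eqP => [->|_] //=; rewrite if_same.
Qed.

Definition stp (s : store) (p z : stape) (f : 'I_5 -> stape) : store :=
  setV (upd (upd s tP p) tZ z) f.

Lemma stp_P s p z f : stp s p z f tP = p.
Proof. by rewrite /stp setV_lt. Qed.

Lemma stp_Z s p z f : stp s p z f tZ = z.
Proof. by rewrite /stp setV_lt. Qed.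

Lemma stp_V s p z f i : stp s p z f (tV i) = f i.
Proof. exact: setV_tV. Qed.

Lemma upd_stp_P s p z f t : upd (stp s p z f) tP t = stp s t z f.
Proof. by rewrite /stp setV_upd //; congr setV; store_eq. Qed.

Lemma upd_stp_Z s p z f t : upd (stp s p z f) tZ t = stp s p t f.
Proof. by rewrite /stp setV_upd //; congr setV; store_eq. Qed.

Lemma run_madvance s (Q : store -> Prop) : 
  (let i := msrc (scan_of s) in 
   Q (upd (upd s tZ (sact ((s tZ).2 0, MoveR) (s tZ)))
          i (sact ((s i).2 0, MoveR) (s i)))) ->
  run 0 madvance s Q.
Proof.
move=> H; apply: run_op; congr Q: H; apply: funext => j.
rewrite /sacts /upd ffunE [scan_of s j]ffunE orbC.
case: eqP => [->//|_] /=; case: eqP => [->//|_].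
by have := sact_scan s j; rewrite /scan_of ffunE.
Qed.

(** What is still to be matched when the head on the value of the current variable may already stand
    in the middle, in front of [b i]. *)
Definition remaining (v b : valuation) (ts : seq sym) : seq sym :=
  match ts with
  | inr (inr (Some i)) :: ts' => takew is_bit (b i) ++ subst v (takew is_pat ts')
  | _ => subst v (takew is_pat ts)
  end.

Lemma remaining_start v ts : remaining v v ts = subst v (takew is_pat ts).
Proof. by case: ts => [|[[]|[[]|[]]] ts]. Qed.

Lemma run_match s lp ts z (v : valuation) :
    (forall i, size (v i) <= N) -> size ts + size z <= N ->
  run 13 (While mcond mbody) (stp s (mk lp (somes ts)) (home z) (fun i => home (v i)))
   (fun s' => exists ts1 ts2 z1 z2 a b,
     [/\ ts = ts1 ++ ts2 /\ all is_pat ts1, z = z1 ++ z2, (forall i, v i = a i ++ b i),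
       s' = stp s (mk (somes (rev ts1) ++ lp) (somes ts2))
                  (mk (somes (rev z1)) (somes z2))
                  (fun i => mk (somes (rev (a i))) (somes (b i)))
     & prefix (subst v (takew is_pat ts)) z = ~~ pat_cell (head None (somes ts2))]).
Proof.
move=> vN tsN.
(* A match of the whole amounts to a match of what remains. Only the variable that is scanned on
   [tP] can have a displaced head on its value. The measure drops because each round advances [tP]
   or [tZ]. *)
pose I m s' := exists ts1 ts2 z1 z2 (a b : valuation),
     [/\ [/\ ts = ts1 ++ ts2, all is_pat ts1, z = z1 ++ z2 & m = size ts2 + size z2],
       (forall i, v i = a i ++ b i),
       s' = stp s (mk (somes (rev ts1) ++ lp) (somes ts2))
                  (mk (somes (rev z1)) (somes z2))
                  (fun i => mk (somes (rev (a i))) (somes (b i))),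
       prefix (subst v (takew is_pat ts)) z = prefix (remaining v b ts2) z2
     & forall i, ohead ts2 != Some (Var i) -> a i = [::]].
have aN (a b : valuation) : (forall i, v i = a i ++ b i) -> forall i, size (a i) <= N.
  by move=> vE i; apply: leq_trans (vN i); rewrite vE size_cat leq_addr.
apply: (run_conseq N_gt2 (run_while N_gt2 (k := 11) (I := I) (m := size ts + size z) _ _ _)) => //.
- move=> m s1 [ts1 [ts2 [z1 [z2 [a [b [[tsE pts zE mE] vE s1E ansE aE]]]]]]].
  have s1P : scan_of s1 tP = head None (somes ts2).
    by apply: (scan_mk (l := somes (rev ts1) ++ lp)); rewrite s1E stp_P.
  have s1Z : scan_of s1 tZ = head None (somes z2).
    by apply: (scan_mk (l := somes (rev z1))); rewrite s1E stp_Z.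
  have s1V i : scan_of s1 (tV i) = head None (somes (b i)).
    by apply: (scan_mk (l := somes (rev (a i)))); rewrite s1E stp_V.
  have advP c ts2' z2' : ts2 = c :: ts2' -> z2 = c :: z2' -> is_wsym c ->
      run 11 mbody s1 (fun s' => exists2 m', m' < m & I m' s').
    move=> ts2E z2E cw; apply: (run_conseq N_gt2 (k := 1)); last by move=> ?; exact: id.
    2: by [].
    apply: (run_if N_gt2).
    have -> : mvar_end (scan_of s1) = false.
      by rewrite /mvar_end s1P ts2E /=; case: c cw {ts2E z2E} => [?|[[?|?]|[?|]]].
    apply: run_madvance; have -> /= : msrc (scan_of s1) = tP.
      by rewrite /msrc s1P ts2E /=; case: c cw {ts2E z2E} => [?|[[?|?]|[?|]]].
    exists (size ts2' + size z2'); first by rewrite mE ts2E z2E /=; lia.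
    have a0 : forall i, a i = [::].
      by move=> i; apply: aE; rewrite ts2E; case: (c) cw => [?|[[?|?]|[?|]]].
    have bE : b = v by apply: funext => i; rewrite vE a0.
    exists (rcons ts1 c), ts2', (rcons z1 c), z2', a, b; split => //.
    + split; rewrite ?cat_rcons -?ts2E -?z2E //.
      by rewrite all_rcons pts andbT; case: (c) cw => [?|[[?|?]|[?|]]].
    + rewrite s1E stp_P stp_Z upd_stp_Z upd_stp_P ts2E z2E /= !mk_moveR.
      by rewrite !rev_rcons.
    + rewrite ansE bE !remaining_start ts2E z2E.
      by case: (c) cw => [?|[[?|?]|[?|]]] //= _; rewrite eqxx.
  rewrite /mcond s1P s1Z; case: ts2 tsE mE s1E ansE aE s1P advP => [|c ts2] //.
  move=> tsE mE s1E ansE aE s1P advP /=.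
  have [cw|] := boolP (is_wsym c).
    have -> : match c with
      | inl _ | inr (inl (inl _)) => head None (somes z2) == Some c
      | inr (inr (Some i)) => ~~ bit_cell (scan_of s1 (tV i)) ||
          (head None (somes z2) == scan_of s1 (tV i))
      | _ => false end = (head None (somes z2) == Some c).
      by case: (c) cw => [?|[[?|?]|[?|]]].
    case: (z2) advP => [|d z2'] advP // /eqP[dE]; apply: (advP c ts2 z2') => //.
    by rewrite dE.
  case: c tsE mE s1E ansE aE s1P advP => [?|[[?|?]|[i|]]] // tsE mE s1E ansE aE s1P _ _.
  rewrite s1V => cond.
  have aE' k : k != i -> a k = [::].
    by move=> ki; apply: aE; apply: contra ki => /eqP[->].
  have [nb|bt] := boolP (bit_cell (head None (somes (b i)))); last first.
    apply: (run_if N_gt2).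
    have -> : mvar_end (scan_of s1) by rewrite /mvar_end s1P /= s1V.
    apply: (run_seq N_gt2 (k := 9)).
      rewrite s1E; have := run_rewinds (enum 'I_5)
         (upd (upd s tP (mk (somes (rev ts1) ++ lp) (somes (Var i :: ts2))))
            tZ (mk (somes (rev z1)) (somes z2))) b (aN _ _ vE).
      by rewrite size_enum_ord => H; exact: H.
    move=> s2 <-; apply: (run_conseq N_gt2 (run_act1 _) _ (fun=> id)) => //.
    have -> : (fun k => if k \in enum 'I_5 then home (a k ++ b k)
        else mk (somes (rev (a k))) (somes (b k))) = (fun k => home (v k)).
      by apply: funext => k; rewrite mem_enum inE vE.
    rewrite -/(stp _ _ _ _) stp_P upd_stp_P.
    rewrite [scan_of _ tP]ffunE stp_P mk_moveR.
    exists (size ts2 + size z2); first by rewrite mE /=; lia.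
    exists (rcons ts1 (Var i)), ts2, z1, z2, (fun=> [::]), v; split=> //.
    + by split=> //; rewrite ?cat_rcons // all_rcons pts.
    + by rewrite rev_rcons.
    + rewrite ansE remaining_start /=.
      by case: (b i) bt => [|[]].
  case bE : (b i) nb cond => [|x b'] //= xbit; rewrite xbit /=.
  case: z2 zE mE s1E ansE s1Z => [|d z2] zE mE s1E ansE s1Z // /eqP[dE].
  subst d.
  apply: (run_conseq N_gt2 (k := 1)); last by move=> ?; exact: id.
  2: by [].
  apply: (run_if N_gt2).
  have -> : mvar_end (scan_of s1) = false by rewrite /mvar_end s1P /= s1V bE /= xbit.
  apply: run_madvance; have -> /= : msrc (scan_of s1) = tV i by rewrite /msrc s1P.
  exists (size (Var i :: ts2) + size z2); first by rewrite mE /= addnS ltnS leqnn.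
  exists ts1, (Var i :: ts2), (rcons z1 x), z2,
    (fun k => if k == i then rcons (a k) x else a k),
    (fun k => if k == i then b' else b k); split=> //.
  + by split=> //; rewrite cat_rcons.
  + by move=> k; rewrite vE; case: eqP => [->|//]; rewrite bE cat_rcons.
  + rewrite s1E stp_V stp_Z upd_stp_Z bE /= !mk_moveR /stp upd_setV.
    rewrite -/(stp _ _ _ _) rev_rcons; congr setV; apply: funext => k.
    by case: eqP => [->|//]; rewrite rev_rcons.
  + by rewrite ansE /= bE /= xbit /= eqxx eqxx.
  + move=> k; rewrite /= => ki; case: eqP => [kE|_]; last exact: aE.
    by rewrite kE eqxx in ki.
- exists [::], ts, [::], z, (fun=> [::]), v; split=> //.
  by rewrite remaining_start.
move=> s1 [[m [ts1 [ts2 [z1 [z2 [a [b [[tsE pts zE mE] vE s1E ansE aE]]]]]]]]].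
exists ts1, ts2, z1, z2, a, b; split => //; rewrite ansE.
have s1P : scan_of s1 tP = head None (somes ts2).
  by apply: (scan_mk (l := somes (rev ts1) ++ lp)); rewrite s1E stp_P.
have s1Z : scan_of s1 tZ = head None (somes z2).
  by apply: (scan_mk (l := somes (rev z1))); rewrite s1E stp_Z.
have s1V i : scan_of s1 (tV i) = head None (somes (b i)).
  by apply: (scan_mk (l := somes (rev (a i)))); rewrite s1E stp_V.
move: b0; rewrite /mcond s1P s1Z.
case: (ts2) => [|[x|[[x|x]|[i|]]] ts3] //=; rewrite ?prefix0s //.
- by case: (z2) => [|d z3] //= h; apply/negbTE; apply: contra h => /andP[/eqP<-].
- by case: (z2) => [|d z3] //= h; apply/negbTE; apply: contra h => /andP[/eqP<-].
- rewrite s1V negb_or negbK; case: (b i) => [|x b'] //= /andP[-> /=].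
  by case: (z2) => [|d z3] //= h; apply/negbTE; apply: contra h => /andP[/eqP<-].
Qed.

End Spec.

Section Spec.
Variable N : nat.
Hypothesis N_gt2 : 2 < N.
Local Notation run := (run N).
Local Notation stape := (stape extra).

Lemma run_to_lit s l lp b (r : seq (cell extra)) :
    s tP = mk (somes (rev l) ++ Some (Lit b) :: lp) r -> ~~ has is_lit l ->
    size l <= N ->
  run 3 (Seq (mvL tP) (While (fun c => ~~ lit_cell (c tP)) (mvL tP))) s
    (eq (upd s tP (mk lp (Some (Lit b) :: somes l ++ r)))).
Proof.
move=> sP nl lN.
have [x [r0 [E Er]]] : exists x r0,
    mk (somes (rev l) ++ Some (Lit b) :: lp) r =
        mk (somes (rev l) ++ Some (Lit b) :: lp) (x :: r0) /\
        mk lp (Some (Lit b) :: somes l ++ r) = mk lp (Some (Lit b) :: somes l ++ x :: r0).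
  case: r {sP} => [|x r]; last by exists x, r.
  exists None, [::]; rewrite mk_nilr cats0; split=> //.
  by rewrite cats1 -rcons_cons mk_rcons.
rewrite Er; rewrite {}E in sP.
pose I m s' := 
  exists l1 l2 r', [/\ l = l1 ++ l2, m = size l1, somes l1 ++ r' = somes l ++ x :: r0 &
     s' = upd s tP (if rev l1 is z :: l3
                    then mk (somes l3 ++ Some (Lit b) :: lp) (Some z :: r')
                    else mk lp (Some (Lit b) :: r'))].
apply: (run_seq N_gt2 (k := 2) (Q := I (size l))).
  apply: (run_conseq N_gt2 (run_act1 _) _ (fun=> id)) => //.
  exists l, [::], (x :: r0); rewrite cats0; split=> //.
  by rewrite (scan_mk sP) sP; case: (rev l) => [|z l3]; rewrite /= mk_moveL.
move=> s0 I0.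
apply: (run_conseq N_gt2 (run_while N_gt2 (k := 0) (I := I) _ I0 lN)) => //.
  move=> m s1 [l1 [l2 [r' [lE mE rE s1E]]]].
  have Ea := revK l1; case: (rev l1) s1E Ea => [|z l3] s1E Ea.
    by rewrite (scan_mk (l := lp) (r := Some (Lit b) :: r')) // s1E upd_eq.
  have s1P : s1 tP = mk (somes l3 ++ Some (Lit b) :: lp) (Some z :: r').
    by rewrite s1E upd_eq.
  move=> _; apply: run_act1; rewrite (scan_mk s1P) s1P s1E upd_upd.
  exists (size l3); first by rewrite mE -Ea size_rev.
  exists (rev l3), (z :: l2), (Some z :: r'); split.
  - by rewrite lE -Ea rev_cons cat_rcons.
  - by rewrite size_rev.
  - by rewrite -rE -Ea rev_cons /somes map_rcons cat_rcons.
  - by rewrite revK; case: (l3) => [|y l4]; rewrite /= mk_moveL.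
move=> s1 [[m [l1 [l2 [r' [lE mE rE s1E]]]]]].
have Ea := revK l1; case: (rev l1) s1E Ea => [|z l3] s1E Ea.
  by rewrite s1E -rE -Ea.
rewrite (scan_mk (l := somes l3 ++ Some (Lit b) :: lp) (r := Some z :: r')).
  rewrite negbK /= => zl; case/negP: nl; apply/hasP; exists z => //.
  by rewrite lE mem_cat -Ea mem_rev inE eqxx.
by rewrite s1E upd_eq.
Qed.

Lemma upd_stp s p z f (j : 'I_13) t : j < 8 -> j != tP -> j != tZ ->
  upd (stp s p z f) j t = stp (upd s j t) p z f.
Proof.
move=> j8 jP jZ; rewrite /stp setV_upd //; congr setV; apply: funext => k.
rewrite /upd; case: (k =P j) => // ->.
by rewrite (negbTE jZ) (negbTE jP).
Qed.

Lemma pat_not_lit l : all is_pat l -> ~~ has is_lit l.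
Proof.
elim: l => //= c l IH /andP[pc /IH]; rewrite negb_or => ->.
by case: c pc => [?|[[?|?]|[?|]]].
Qed.

Lemma run_attempt s lp b ts z (v : valuation) f :
    (forall i, s (tV i) = home (v i)) -> (forall i, size (v i) <= N) ->
    s tP = mk lp (Some (Lit b) :: somes ts) -> size ts + size z < N ->
  run 19 attempt (upd (upd s tZ (home z)) tG (flag f))
    (eq (upd (upd s tZ (home z)) tG
       (flag (f || prefix (subst v (takew is_pat ts)) z)))).
Proof.
move=> sV vN sP tsN.
have zN : size z < N by apply: leq_ltn_trans tsN; rewrite leq_addl.
have stE p g : upd (upd (upd s tZ (home z)) tG (flag g)) tP p =
    stp (upd s tG (flag g)) p (home z) (fun i => home (v i)).
  apply: funext; apply: tapeP => [i|j j8].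
    by rewrite stp_V /upd !tV_neq.
  by rewrite /stp setV_lt // /upd; case_tape j.
have stE' g : upd (upd s tZ (home z)) tG (flag g) =
    stp (upd s tG (flag g)) (mk lp (Some (Lit b) :: somes ts)) (home z) (fun i => home (v i)).
  by rewrite -stE; apply/esym/upd_id; rewrite /upd /=; exact: sP.
apply: (run_seq N_gt2 (k := 18)).
  by apply: (run_conseq N_gt2 (run_act1 (Q := eq _) erefl) _ (fun=> id)).
move=> s1 <-; rewrite [scan_of _ tP]ffunE !upd_neq // sP /= mk_moveR stE.
apply: (run_seq N_gt2 (k := 17)).
  apply: (run_conseq N_gt2 (run_match N_gt2 (upd s tG (flag f)) (Some (Lit b) :: lp) vN (ltnW tsN)) _ (fun=> id)) => //.
move=> s2 [ts1 [ts2 [z1 [z2 [a [c [[tsE pts] zE vE s2E ansE]]]]]]].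
rewrite {}ansE; set ans := ~~ pat_cell _.
pose st g := stp (upd s tG (flag g)) (mk (somes (rev ts1) ++ Some (Lit b) :: lp) (somes ts2))
            (mk (somes (rev z1)) (somes z2))
            (fun i => mk (somes (rev (a i))) (somes (c i))).
apply: (run_seq N_gt2 (k := 16) (Q := eq (st (f || ans)))).
  apply: (run_conseq N_gt2 (k := 1)) (fun=> id); last by [].
  apply: (run_if N_gt2).
  have -> : scan_of s2 tP = head None (somes ts2).
    by apply: (scan_mk (l := somes (rev ts1) ++ Some (Lit b) :: lp)); rewrite s2E stp_P.
  rewrite -[pat_cell _]negbK -/ans; case: ans => /=.
    rewrite orbT; apply: (run_conseq N_gt2 (run_set_flag N (b := f) _)) => //.
      by rewrite s2E /stp setV_lt.
    by move=> s3 <-; rewrite s2E upd_stp // upd_upd.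
  by apply: run_skip; rewrite orbF s2E.
move=> s3 <-; apply: (run_seq N_gt2 (k := 15)).
  apply: (run_conseq N_gt2 (run_to_lit (l := ts1) (b := b) (lp := lp) (r := somes ts2) _ _ _)) (fun=> id) => //.
  - by rewrite /st stp_P.
  - exact: pat_not_lit.
  - by apply: leq_trans (ltnW tsN); rewrite tsE size_cat; lia.
move=> s4 <-; rewrite upd_stp_P -[somes ts1 ++ _]map_cat -tsE.
apply: (run_seq N_gt2 (k := 14)).
  apply: (run_conseq N_gt2 (run_rewind N_gt2 (a := z1) (r := somes z2) _ _)) (fun=> id) => //.
  - by rewrite stp_Z.
  - by apply: leq_trans (ltnW zN); rewrite zE size_cat leq_addr.
move=> s5 <-; rewrite upd_stp_Z -[somes z1 ++ _]map_cat -zE -/(home z).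
have aN i : size (a i) <= N.
  by apply: leq_trans (vN i); rewrite vE size_cat leq_addr.
have H := run_rewinds N_gt2 (enum 'I_5) (upd (upd (upd s tG (flag (f || ans))) tP (mk lp (Some (Lit b) :: somes ts))) tZ (home z)) c aN.
rewrite size_enum_ord in H.
apply: (run_conseq N_gt2 H) => // s6 <-.
rewrite stE' /stp; congr setV; apply: funext => i.
by rewrite mem_enum inE vE.
Qed.

End Spec.

Section Spec.
Variable N : nat.
Hypothesis N_gt2 : 2 < N.
Local Notation run := (run N).
Local Notation stape := (stape extra).

Lemma size_drops (w x : seq sym) : x \in [seq drop k w | k <- iota 0 (size w)] ->
  size x <= size w.
Proof. by case/mapP=> k _ ->; rewrite size_drop leq_subr. Qed.

Lemma run_check_lit s lp b ts w (v : valuation) f :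
    (forall i, s (tV i) = home (v i)) -> (forall i, size (v i) <= N) ->
    s tP = mk lp (Some (Lit b) :: somes ts) -> size ts + size w < N ->
    s tZ = home [::] -> s tW = home w -> s tG = flag false -> s tF = flag f ->
  run 28 check_lit s (eq (upd s tF (flag (f || (found w v ts == b))))).
Proof.
move=> sV vN sP tsN sZ sW sR sF.
apply: (run_seq N_gt2 (k := 27)).
  apply: (run_conseq N_gt2 (run_each N_gt2 (k := 19) (w := w) (j := tG) (f := false)
      (P := prefix (subst v (takew is_pat ts))) _ _ _ _ _ _ _ _)) (fun=> id) => //.
    by lia.
  move=> x f' /size_drops xw; apply: (run_attempt N_gt2 f' sV vN sP).
  by apply: leq_ltn_trans tsN; rewrite leq_add2l.
move=> s1 <-; rewrite orFb -/(found w v ts); set fnd := found w v ts.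
have s1P : scan_of (upd s tG (flag fnd)) tP = Some (Lit b).
  by rewrite (scan_mk (l := lp) (r := Some (Lit b) :: somes ts)) // upd_neq.
apply: (run_seq N_gt2 (k := 26)
         (Q := eq (upd (upd s tG (flag fnd)) tF (flag (f || (fnd == b)))))).
  apply: (run_if N_gt2 (k := 25)).
  rewrite s1P (scan_flag (b := fnd)) ?upd_eq //.
  have -> : (Some (Lit b) == Some (Lit true)) = b by case: (b).
  case: (fnd == b).
    rewrite orbT; apply: (run_conseq N_gt2 (run_set_flag N (b := f) _)) => //.
  rewrite orbF; apply: (run_conseq N_gt2 (run_skip _)) (fun=> id) => //.
  by apply/upd_id; rewrite upd_neq.
move=> s2 <-; apply: (run_conseq N_gt2 (run_clear N (b := fnd) _)) => //.
move=> s3 <-; apply: funext => j; rewrite /upd.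
case: (j =P tG) => [->|_] //.
Qed.

Definition stc (s : store) p f b : store := upd (upd (upd s tP p) tF (flag f)) tB (flag b).

Lemma stc_P s p f b : stc s p f b tP = p. Proof. by []. Qed.
Lemma stc_F s p f b : stc s p f b tF = flag f. Proof. by []. Qed.

Lemma upd_stc_P s p f b t : upd (stc s p f b) tP t = stc s t f b.
Proof. by rewrite /stc; store_eq. Qed.
Lemma upd_stc_F s p f b f' : upd (stc s p f b) tF (flag f') = stc s p f' b.
Proof. by rewrite /stc; store_eq. Qed.
Lemma upd_stc_B s p f b b' : upd (stc s p f b) tB (flag b') = stc s p f b'.
Proof. by rewrite /stc; store_eq. Qed.

(** The disjunction of the recorded violation and the violation found in the remaining tokens is the
    final verdict; that it does not change is the loop invariant of [check]. *)
Lemma run_check_tok s lp t ts w (v : valuation) f bad :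
    (forall i, s (tV i) = home (v i)) -> (forall i, size (v i) <= N) ->
    size ts + size w < N -> s tZ = home [::] -> s tW = home w -> s tG = flag false ->
  run 31 check_tok (stc s (mk lp (somes (t :: ts))) f bad)
    (fun s' => exists f' bad', s' = stc s (mk (Some t :: lp) (somes ts)) f' bad' /\
       bad' || ~~ eval w v f' ts = bad || ~~ eval w v f (t :: ts)).
Proof.
move=> sV vN tsN sZ sW sR; set s0 := stc _ _ _ _.
have s0P : scan_of s0 tP = Some t.
  by rewrite (scan_mk (l := lp) (r := somes (t :: ts))) // stc_P.
apply: (run_seq N_gt2 (k := 30) (Q := fun s' => exists f' bad',
    s' = stc s (mk lp (somes (t :: ts))) f' bad' /\
    bad' || ~~ eval w v f' ts = bad || ~~ eval w v f (t :: ts))); last first.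
  move=> s1 [f' [bad' [-> E]]]; apply: (run_conseq N_gt2 (run_act1 _) _ (fun=> id)) => //.
  exists f', bad'; split=> //.
  rewrite (scan_mk (l := lp) (r := somes (t :: ts))) ?stc_P // upd_stc_P.
  by rewrite mk_moveR.
apply: (run_if N_gt2 (k := 29)); rewrite s0P /=.
case: ifP => [|notlit].
  case: t @s0 s0P => [?|[[?|b]|[?|]]] // s0 s0P _.
  apply: (run_conseq N_gt2 (run_check_lit (b := b) (v := v) (ts := ts) (w := w) (f := f) (lp := lp) _ _ _ _ _ _ _ _)) => //.
  move=> s1 <-; exists (f || (found w v ts == b)), bad; split=> //.
  by rewrite upd_stc_F.
apply: (run_if N_gt2 (k := 28)); rewrite s0P.
case: (Some t =P Some End) => [[tE]|notend].
  apply: (run_seq N_gt2 (k := 27) (Q := eq (stc s (mk lp (somes (t :: ts))) f (bad || ~~ f)))).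
    apply: (run_if N_gt2 (k := 26)).
    rewrite (scan_flag (b := f)) ?stc_F //; case: (f) @s0 s0P => s0 s0P.
      by apply: (run_conseq N_gt2 (run_skip _)) (fun=> id) => //; rewrite orbF.
    apply: (run_conseq N_gt2 (run_set_flag N (b := bad) _)) => //.
    by move=> s1 <-; rewrite upd_stc_B orbT.
  move=> s1 <-; apply: (run_conseq N_gt2 (run_clear N (b := f) _)) => //.
  move=> s2 <-; rewrite upd_stc_F; exists false, (bad || ~~ f); split=> //.
  by rewrite tE /= -orbA negb_and.
apply: (run_conseq N_gt2 (run_skip _)) (fun=> id) => //.
exists f, bad; split=> //=.
by case: t notlit notend {s0P} @s0 => [?|[[?|b]|[?|]]].
Qed.

Lemma run_check s ts w (v : valuation) bad :
    (forall i, s (tV i) = home (v i)) -> (forall i, size (v i) <= N) ->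
    size ts + size w < N -> s tZ = home [::] -> s tW = home w -> s tG = flag false ->
    s tP = home ts -> s tF = flag false -> s tB = flag bad ->
  run 35 check s (eq (upd s tB (flag (bad || ~~ eval w v false ts)))).
Proof.
move=> sV vN tsN sZ sW sR sP sF sB.
have E p f b : s tP = p -> s tF = flag f -> stc s p f b = upd s tB (flag b).
  by move=> <- sF'; rewrite /stc (upd_id (i := tP)) // (upd_id (i := tF)).
pose I m s' := exists ts1 ts2 f b, [/\ ts = ts1 ++ ts2, m = size ts2,
   s' = stc s (mk (somes (rev ts1)) (somes ts2)) f b &
   b || ~~ eval w v f ts2 = bad || ~~ eval w v false ts].
have I0 : I (size ts) s.
  by exists [::], ts, false, bad; split=> //; rewrite E // upd_id.
have tN : size ts <= N by apply: leq_trans (ltnW tsN); rewrite leq_addr.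
apply: (run_seq N_gt2 (k := 34)).
  apply: (run_conseq N_gt2 (run_while N_gt2 (k := 31) _ I0 tN)) (fun=> id) => //.
  move=> m s1 [ts1 [ts2 [f [b [tsE mE s1E bE]]]]].
  rewrite /nonblank (scan_mk (l := somes (rev ts1)) (r := somes ts2)) ?s1E ?stc_P //.
  case: ts2 tsE mE s1E bE => [|t ts2] // tsE mE s1E bE _.
  apply: (run_conseq N_gt2 (run_check_tok _ t f b sV vN _ sZ sW sR)) => //.
    by apply: leq_ltn_trans tsN; rewrite tsE size_cat leq_add2r /=; rewrite addnS leqW // leq_addl.
  move=> s2 [f' [b' [s2E b'E]]]; exists (size ts2); first by rewrite mE.
  exists (rcons ts1 t), ts2, f', b'; split=> //; first by rewrite cat_rcons.
    by rewrite rev_rcons.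
  by rewrite b'E.
move=> s1 [[m [ts1 [ts2 [f [b [tsE mE s1E bE]]]]]]].
rewrite /nonblank (scan_mk (l := somes (rev ts1)) (r := somes ts2)) ?s1E ?stc_P //.
case: ts2 tsE mE s1E bE => [|t ts2] //; rewrite cats0 => tsE mE s1E bE _.
rewrite orbF in bE; subst ts1.
apply: (run_seq N_gt2 (k := 33)).
  by apply: (run_conseq N_gt2 (run_rewind N_gt2 (a := ts) (r := [::]) _ tN)) (fun=> id).
move=> s2 <-; apply: (run_conseq N_gt2 (run_clear N (b := f) _)) => //.
by move=> s3 <-; rewrite upd_stc_P upd_stc_F cats0 -bE E.
Qed.

Lemma run_nest vs s ts w (v : valuation) bad : uniq vs ->
    (forall i, s (tV i) = if i \in vs then home [::] else home (v i)) ->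
    (forall i, size (v i) <= N) ->
    size ts + size w < N -> s tZ = home [::] -> s tW = home w -> s tG = flag false ->
    s tP = home ts -> s tF = flag false -> s tB = flag bad ->
  run (35 + 7 * size vs) (nest vs) s (eq (upd s tB (flag (bad || refuted w ts vs v)))).
Proof.
elim: vs s v bad => [|i vs IH] s v bad uvs sV vN tsN sZ sW sR sP sF sB /=.
  exact: (run_check sV vN tsN sZ sW sR sP sF sB).
case/andP: uvs => ivs uvs; rewrite mulnS [7 + _]addnC addnA.
apply: (run_conseq N_gt2 (run_each N_gt2 (w := w) (j := tB) (k := 35 + 7 * size vs) (f := bad)
   (P := fun x => refuted w ts vs (updv v i x)) _ _ _ _ _ _ _ _)) => //.
- by rewrite sV inE eqxx.
- by apply: leq_trans (ltnW tsN); rewrite leq_addl.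
move=> x f /size_drops xw.
apply: (run_conseq N_gt2 (IH _ (updv v i x) f uvs _ _ _ _ _ _ _ _ _)) => //.
- move=> k; rewrite upd_neq ?tV_neq // /upd (inj_eq tV_inj) /updv sV inE.
  by case: (k =P i) => [->|_] //=; rewrite (negbTE ivs).
- move=> k; rewrite /updv; case: eqP => // _; apply: leq_trans xw _.
  by apply: leq_trans (ltnW tsN); rewrite leq_addl.
- by move=> s1 <-; rewrite upd_upd.
Qed.

End Spec.

(** * Satisfiability is in NEXP *)

(** Total, since [satisfiable] has to make sense for every word; blocks that are no code get some
    symbol. *)
Definition decode_sym (b : seq bool) : sym :=
  match b with
  | [:: false; false; false; x] => Bit x
  | [:: false; false; true; x] => if x then Hash else Dollar
  | [:: false; true; false; x] => Lit x
  | [:: false; true; true; _] => End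
  | [:: true; x; y; z] => Var (inord (4 * x + 2 * y + z))
  | _ => End
  end.

Fixpoint decode_rec (n : nat) (x : seq bool) : seq sym :=
  if n is n'.+1 then
    if x is [::] then [::]
    else decode_sym (take 4 (x ++ nseq 4 false)) :: decode_rec n' (drop 4 x)
  else [::].

Definition decode (x : seq bool) : seq sym := decode_rec (size x) x.

(** The entry of the distinguished fact, as [input_entryE] shows. The word is reversed because
    [prepare] reads [x] to the right while it writes [tW] to the left. *)
Definition input_entry (x : seq bool) : seq sym :=
  [:: Dollar; Hash] ++ map Bit (rev x) ++ [:: Hash; Dollar].

(* The facts of a model are concatenated to the word [g]. The variables range
   over the suffixes of the whole word, cut at the first non-bit. *)
Definition satisfiable : language := fun x =>
  `[< exists g, [/\ size g <= 2 ^ (size x).+1, all is_wsym g &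
        ~~ refuted (g ++ input_entry x) (decode x) (enum 'I_5) (fun=> [::])] >].

Definition writeL i (x : sym) : prog := act1 i (fun=> (Some x, MoveL)).

Definition prepare_body : prog :=
  Seq (act2 tW (fun c => (c tX, MoveL)) tC (fun=> (Some (Bit false), MoveR))) (mvR tX).

Definition prepare : prog :=
  Seq (act2 tW (fun=> (Some Dollar, MoveL)) tC (fun=> (Some (Bit false), MoveR)))
  (Seq (writeL tW Hash) (Seq (While (nonblank tX) prepare_body)
  (Seq (writeL tW Hash) (Seq (writeL tW Dollar) (Seq (rewind tX) (rewind tC)))))).

Fixpoint decode_tok (j : nat) (acc : seq bool) : prog :=
  if j is j'.+1 then
    If (fun c => c tX == Some (Bit true))
       (Seq (mvR tX) (decode_tok j' (rcons acc true)))
       (Seq (mvR tX) (decode_tok j' (rcons acc false)))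
  else act1 tP (fun=> (Some (decode_sym acc), MoveR)).

Definition decode_input : prog :=
  Seq (While (nonblank tX) (decode_tok 4 [::])) (rewind tP).

Definition guess_sym : prog :=
  Op (fun c => noop c :: [seq [ffun j => if j == tW then (Some a, MoveL) else (c j, Stay)]
                        | a <- [:: Bit false; Bit true; Hash; Dollar]]).

(** After an overflow the head of [tC] stays on the blank behind the counter, and this ends the loop
    of [guess]. *)
Definition increment : prog :=
  Seq (While (fun c => c tC == Some (Bit true)) (act1 tC (fun=> (Some (Bit false), MoveR))))
      (If (nonblank tC) (Seq (write tC (Some (Bit true))) (rewind tC)) skip).

(** Each round of the binary counter adds at most one symbol. The counter has [size x + 1] bits,
    which is the origin of the bound [2 ^ (size x).+1] in [satisfiable]. *)
Definition guess : prog := While (nonblank tC) (Seq guess_sym increment).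

Definition fail : prog := Op (fun=> [::]).

Definition verify : prog :=
  Seq (mvR tW) (nest (enum 'I_5)).

Definition solver : prog :=
  Seq (Seq prepare decode_input) (Seq guess (Seq verify (If (nonblank tB) fail skip))).

Section Spec.
Variable N : nat.
Hypothesis N_gt2 : 2 < N.
Local Notation run := (run N).

Lemma run_writeL i x (s : store) r : s i = mk [::] (None :: r) ->
  run 0 (writeL i x) s (eq (upd s i (mk [::] (None :: Some x :: r)))).
Proof. by move=> si; apply: run_act1; rewrite si mk_moveL_nil. Qed.

Lemma run_prepare (s : store) x : s tX = home (map Bit x) -> s tW = mk [::] [:: None] ->
    s tC = home [::] -> size x < N ->
  run 10 prepare s (eq (upd (upd s tW (mk [::] (None :: somes (input_entry x))))
                        tC (home (nseq (size x).+1 (Bit false))))).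
Proof.
move=> sX sW sC xN.
apply: (run_seq N_gt2 (k := 9)).
  by apply: (run_conseq N_gt2 (run_act2 (i := tW) (i' := tC) (Q := eq _) _ erefl)) (fun=> id).
move=> s1 <-; rewrite sW sC mk_moveL_nil mk_moveR_nil; apply: (run_seq N_gt2 (k := 8)).
  by apply: (run_conseq N_gt2 (run_writeL (r := [:: Some Dollar]) Hash _)) (fun=> id).
move=> s2 <-.
pose I m s' := exists x1 x2, [/\ x = x1 ++ x2, m = size x2 &
   s' = upd (upd (upd s tW (mk [::] (None :: somes (map Bit (rev x1) ++ [:: Hash; Dollar]))))
                tC (mk (somes (nseq (size x1).+1 (Bit false))) [::]))
        tX (mk (somes (rev (map Bit x1))) (somes (map Bit x2)))].
set s3 := upd _ _ _.
have I0 : I (size x) s3.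
  exists [::], x; split=> //; rewrite /s3; apply: funext => j; rewrite /upd.
  by case: (j =P tX) => [->|_] //; case: (j =P tC) => [->|_] //; case: (j =P tW).
apply: (run_seq N_gt2 (k := 7)).
  apply: (run_conseq N_gt2 (run_while N_gt2 (k := 1) _ I0 (ltnW xN))) (fun=> id) => //.
  move=> m s4 [x1 [x2 [xE mE s4E]]].
  rewrite /nonblank (scan_mk (l := somes (rev (map Bit x1))) (r := somes (map Bit x2)));
    last by rewrite s4E.
  case: x2 xE mE s4E => [|b x2] // xE mE s4E _.
  apply: (run_seq N_gt2).
    by apply: (run_act2 (i := tW) (i' := tC) (Q := eq _)).
  move=> s5 <-; apply: run_act1.
  rewrite [X in (X, MoveL)](scan_mk (l := somes (rev (map Bit x1))) (r := somes (map Bit (b :: x2))));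
    last by rewrite s4E.
  set s6 := upd (upd s4 tW _) tC _.
  rewrite (scan_mk (s := s6) (l := somes (rev (map Bit x1))) (r := somes (map Bit (b :: x2))));
    last by rewrite /s6 s4E.
  have s4X : s6 tX = mk (somes (rev (map Bit x1))) (somes (map Bit (b :: x2))).
    by rewrite /s6 s4E.
  exists (size x2); first by rewrite mE.
  exists (rcons x1 b), x2; split; rewrite ?cat_rcons // s4X mk_moveR.
  rewrite /s6 s4E /= [X in sact _ X]/upd /= mk_moveL_nil.
  rewrite [X in sact _ X]/upd /= mk_moveR_nil.
  rewrite size_rcons rev_rcons map_rcons rev_rcons /=.
  by store_eq.
move=> s4 [[m [x1 [x2 [xE mE s4E]]]]].
rewrite /nonblank (scan_mk (l := somes (rev (map Bit x1))) (r := somes (map Bit x2)));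
    last by rewrite s4E.
case: x2 xE mE s4E => [|b x2] //; rewrite cats0 => <- {x1} mE s4E _.
apply: (run_seq N_gt2 (k := 6)).
  apply: (run_conseq N_gt2 (run_writeL Hash (r := somes (map Bit (rev x) ++ [:: Hash; Dollar])) _)) (fun=> id) => //.
  by rewrite s4E.
move=> s5 <-; apply: (run_seq N_gt2 (k := 5)).
  by apply: (run_conseq N_gt2 (run_writeL Dollar (upd_eq _ _ _))) (fun=> id).
move=> s6 <-; apply: (run_seq N_gt2 (k := 4)).
  apply: (run_rewind N_gt2 (a := map Bit x) (r := [::])); last by rewrite size_map ltnW.
  by rewrite s4E.
move=> s7 <-.
apply: (run_conseq N_gt2 (run_rewind N_gt2 (a := nseq (size x).+1 (Bit false)) (r := [::]) _ _)) => //.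
- by rewrite rev_nseq s4E.
- by rewrite size_nseq.
move=> s8 <-; rewrite s4E !cats0; apply: funext => j; rewrite /upd.
case: (j =P tC) => // _; case: (j =P tX) => [->|_] //.
by case: (j =P tW).
Qed.

Lemma run_decode_tok j acc (s : store) l p y :
    s tX = mk l (somes (map Bit y)) -> s tP = mk p [::] ->
  run (j + j) (decode_tok j acc) s (fun s' => exists l',
     s' = upd (upd s tX (mk l' (somes (map Bit (drop j y)))))
          tP (mk (Some (decode_sym (acc ++ take j (y ++ nseq j false))) :: p) [::])).
Proof.
elim: j acc s l y => [|j IH] acc s l y sX sP.
  apply: run_act1; exists l; rewrite sP mk_moveR_nil take0 cats0 drop0.
  by rewrite (upd_id (i := tX)).
rewrite addSn addnS; apply: (run_if N_gt2).
rewrite (scan_mk sX).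
have E b : run (j + j).+1 (Seq (mvR tX) (decode_tok j (rcons acc b))) s
   (fun s' => exists l', s' = upd (upd s tX (mk l' (somes (map Bit (behead (drop j y))))))
          tP (mk (Some (decode_sym (rcons acc b ++ take j (behead y ++ nseq j false))) :: p) [::])).
  apply: (run_seq N_gt2).
    by apply: (run_conseq N_gt2 (run_act1 (Q := eq _) erefl) _ (fun=> id)).
  move=> s1 <-.
  have sX1 : exists l1, sact (scan_of s tX, MoveR) (s tX) = mk l1 (somes (map Bit (behead y))).
    by rewrite sX; case: (y) => [|c y']; eexists; rewrite ?mk_moveR ?mk_moveR_nil.
  have [l1 sX1E] := sX1.
  apply: (run_conseq N_gt2 (IH (rcons acc b) _ l1 (behead y) _ _)) => //.
  - move=> s2 [l' ->]; exists l'; rewrite upd_upd; congr upd; congr upd; congr (mk _ (somes (map _ _))).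
    by rewrite -drop1 drop_drop -[behead (drop j y)]drop1 drop_drop addnC.
have Ed : drop j.+1 y = behead (drop j y) by rewrite -drop1 drop_drop.
rewrite Ed; case: y sX E {Ed} => [|b y] sX E /=.
  by have := E false; rewrite /= cat_rcons.
have := E b; rewrite cat_rcons /=.
have -> : take j (y ++ nseq j false) = take j (y ++ nseq j.+1 false).
  rewrite !take_cat; case: ltnP => // h; congr cat.
  by rewrite !take_nseq; [|lia|lia].
by case: b {sX E}.
Qed.

End Spec.

Lemma decode_rec_fuel n m x : size x <= n -> size x <= m ->
  decode_rec n x = decode_rec m x.
Proof.
elim: n m x => [|n IH] [|m] [|b x] //= h1 h2; congr cons.
have h : size (drop 3 x) <= size x by rewrite size_drop leq_subr.
by apply: IH; apply: leq_trans h _.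
Qed.

Lemma decode_cons b x : decode (b :: x) =
  decode_sym (take 4 (b :: x ++ nseq 4 false)) :: decode (drop 4 (b :: x)).
Proof.
by congr cons; apply: decode_rec_fuel => //; rewrite /= size_drop leq_subr.
Qed.

Lemma size_decode x : size (decode x) <= size x.
Proof.
rewrite /decode; move: (size x) => n; elim: n x => // n IH [|b x] //=.
by rewrite ltnS; apply: IH.
Qed.

Definition counter (b : seq bool) : nat := foldr (fun (c : bool) n => c + n.*2) 0 b.

Lemma counter_lt b : counter b < 2 ^ size b.
Proof. by elim: b => //= c b IH; rewrite expnS; case: c; lia. Qed.

Lemma counter_nseq_false n : counter (nseq n false) = 0.
Proof. by elim: n => //= n ->. Qed.

Lemma counter_all b : all id b = ((counter b).+1 == 2 ^ size b).
Proof.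
elim: b => //= c b IH; rewrite IH expnS; case: c => /=; apply/idP/idP => /eqP; lia.
Qed.

Lemma contents_inj (c c' : seq sym) :
  mk [::] (None :: somes c) = mk [::] (None :: somes c') -> c = c'.
Proof.
move=> [E]; have {}E k : nth None (somes c) k = nth None (somes c') k.
  by have := congr1 (fun f => f k.+1) E.
elim: c c' E => [|x c IH] [|y c'] E //; try by have := E 0.
have [->] : Some x = Some y := E 0.
by rewrite (IH c') // => k; have := E k.+1.
Qed.

Section Spec.
Variable N : nat.
Hypothesis N_gt2 : 2 < N.
Local Notation run := (run N).

Lemma run_decode_input (s : store) x : s tX = home (map Bit x) -> s tP = home [::] ->
    size x <= N ->
  run 11 decode_input s (fun s' => exists t,
    s' = upd (upd s tX t) tP (home (decode x))).
Proof.
move=> sX sP xN.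
pose I m s' := exists t1 l y, [/\ decode x = t1 ++ decode y, m = size y &
   s' = upd (upd s tX (mk l (somes (map Bit y)))) tP (mk (somes (rev t1)) [::])].
have I0 : I (size x) s.
  by exists [::], [::], x; split=> //; rewrite upd_id upd_id.
apply: (run_seq N_gt2 (k := 10)).
  apply: (run_conseq N_gt2 (run_while N_gt2 (k := 8) _ I0 xN)) (fun=> id) => //.
  move=> m s1 [t1 [l [y [xE mE s1E]]]].
  rewrite /nonblank (scan_mk (l := l) (r := somes (map Bit y))); last by rewrite s1E.
  case: y xE mE s1E => [|b y] // xE mE s1E _.
  apply: (run_conseq N_gt2 (run_decode_tok N_gt2 4 [::] (l := l) (p := somes (rev t1)) (y := b :: y) _ _)) => //;
    try by rewrite s1E.
  move=> s2 [l' ->]; exists (size (drop 4 (b :: y))).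
    by rewrite mE size_drop /= subSS ltnS leq_subr.
  exists (rcons t1 (decode_sym (take 4 (b :: y ++ nseq 4 false)))), l', (drop 4 (b :: y)).
  split=> //; first by rewrite xE decode_cons cat_rcons.
  by rewrite s1E rev_rcons; store_eq.
move=> s1 [[m [t1 [l [y [xE mE s1E]]]]]].
rewrite /nonblank (scan_mk (l := l) (r := somes (map Bit y))); last by rewrite s1E.
case: y xE mE s1E => [|b y] //; rewrite cats0 => xE mE s1E _.
apply: (run_conseq N_gt2 (run_rewind N_gt2 (a := t1) (r := [::]) _ _)) => //.
- by rewrite s1E.
- by rewrite -xE; apply: leq_trans xN; apply: size_decode.
move=> s2 <-; rewrite s1E; eexists; rewrite upd_upd cats0 -xE; reflexivity.
Qed.

Lemma run_increment (s : store) b : s tC = home (map Bit b) -> size b <= N ->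
  run 7 increment s (eq (upd s tC
    (if all id b then mk (somes (nseq (size b) (Bit false))) [::]
     else home (map Bit (nseq (find negb b) false ++ true :: drop (find negb b).+1 b))))).
Proof.
move=> sC bN.
pose I m s' := exists i, [/\ all id (take i b), m + i = size b &
  s' = upd s tC (mk (somes (nseq i (Bit false))) (somes (map Bit (drop i b))))].
have I0 : I (size b) s.
  by exists 0; rewrite take0 drop0 addn0; split=> //; rewrite upd_id.
apply: (run_seq N_gt2 (k := 6)).
  apply: (run_conseq N_gt2 (run_while N_gt2 (k := 0) _ I0 bN)) (fun=> id) => //.
  move=> m s1 [i [ai mi s1E]].
  rewrite (scan_mk (l := somes (nseq i (Bit false))) (r := somes (map Bit (drop i b))));
    last by rewrite s1E.
  case: m mi => [|m] mi.
    by rewrite drop_oversize // -mi.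
  have ib : i < size b by rewrite -mi; lia.
  rewrite (drop_nth false ib) => /eqP[bi].
  apply: run_act1; exists m => //; exists i.+1; split.
  - by rewrite (take_nth false) // all_rcons bi.
  - by rewrite addnS -addSn.
  - by rewrite s1E upd_eq upd_upd (drop_nth false ib) mk_moveR.
move=> s1 [[m [i [ai mi s1E]]]].
rewrite (scan_mk (l := somes (nseq i (Bit false))) (r := somes (map Bit (drop i b))));
    last by rewrite s1E.
have ib : i <= size b by rewrite -mi leq_addl.
move: ib; rewrite leq_eqVlt => /orP[/eqP ib|ib].
  rewrite ib drop_size take_size in ai s1E *; move=> _.
  rewrite ai; apply: (run_if N_gt2 (k := 5)).
  rewrite /nonblank (scan_mk (l := somes (nseq (size b) (Bit false))) (r := [::]));
    last by rewrite s1E.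
  by apply: (run_conseq N_gt2 (run_skip _)) (fun=> id).
rewrite (drop_nth false ib) /= => bi.
have {}bi : nth false b i = false by case: nth bi.
have aF : all id b = false.
  by rewrite -(cat_take_drop i b) (drop_nth false ib) all_cat /= bi andbF.
have fE : find negb b = i.
  rewrite -{1}(cat_take_drop i b) (drop_nth false ib) find_cat /= bi /=.
  have -> : has negb (take i b) = false by rewrite has_predC ai.
  by rewrite addn0 size_takel // ltnW.
rewrite aF fE; apply: (run_if N_gt2 (k := 5)).
rewrite /nonblank (scan_mk (l := somes (nseq i (Bit false))) (r := somes (map Bit (drop i b))));
    last by rewrite s1E.
rewrite (drop_nth false ib) /=.
apply: (run_seq N_gt2 (k := 4)).
  by apply: (run_conseq N_gt2 (run_act1 (Q := eq _) erefl) _ (fun=> id)).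
move=> s2 <-.
apply: (run_conseq N_gt2 (run_rewind N_gt2 (a := nseq i (Bit false))
  (r := Some (Bit true) :: somes (map Bit (drop i.+1 b))) _ _)) => //.
- by rewrite upd_eq s1E upd_eq (drop_nth false ib) mk_stay rev_nseq.
- by rewrite size_nseq; apply: leq_trans bN; apply: ltnW.
- move=> s3 <-; rewrite s1E !upd_upd /home /somes; congr upd; congr mk.
  by rewrite !map_cat /= !map_nseq.
Qed.

Lemma counter_incr b : ~~ all id b ->
  counter (nseq (find negb b) false ++ true :: drop (find negb b).+1 b) = (counter b).+1
  /\ size (nseq (find negb b) false ++ true :: drop (find negb b).+1 b) = size b.
Proof.
elim: b => //= c b IH; case: c => /=; last by rewrite drop0.
by move/IH=> [-> ->]; split=> //; lia.
Qed.

Lemma spec_weaken p (s : store) n n' (S S' : store -> Prop) : spec p s n S -> n <= n' ->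
  (forall s', S s' <-> S' s') -> spec p s n' S'.
Proof. exact: SpecW. Qed.

Lemma spec_guess b c r (s : store) : 0 < size b -> size b <= N ->
    s tC = home (map Bit b) -> s tW = mk [::] (None :: somes c) ->
    r + counter b = 2 ^ size b ->
  spec guess s (r * (N ^ 8)).+1 (fun s' => exists g, [/\ size g <= r, all is_wsym g &
    s' = upd (upd s tC (mk (somes (nseq (size b) (Bit false))) [::]))
             tW (mk [::] (None :: somes (g ++ c)))]).
Proof.
elim: r b c s => [|r IH] b c s b0 bN sC sW rE.
  by have := counter_lt b; rewrite -rE; lia.
pose S1 s1 := exists g, [/\ size g <= 1, all is_wsym g &
  s1 = upd s tW (mk [::] (None :: somes (g ++ c)))].
pose C' := if all id b then mk (somes (nseq (size b) (Bit false))) [::]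
     else home (map Bit (nseq (find negb b) false ++ true :: drop (find negb b).+1 b)).
pose S2 s2 := exists2 s1, S1 s1 & s2 = upd s1 tC C'.
have guessS : spec guess_sym s 1 S1.
  apply: (spec_weaken (SpecOp _ _)) => // s'.
  have sc : forall a : sym, sacts [ffun j => if j == tW then (Some a, MoveL)
        else (scan_of s j, Stay)] s = upd s tW (mk [::] (None :: Some a :: somes c)).
    move=> a; apply: funext => j; rewrite /sacts /upd ffunE.
    by case: eqP => [->|_]; rewrite ?sact_scan // sW mk_moveL_nil.
  have sn : sacts (noop (scan_of s)) s = s.
    by apply: funext => j; rewrite /sacts ffunE sact_scan.
  split.
  - case=> a; rewrite /guess_sym; case=> [<-|]; first by rewrite sn => ->; exists [::]; rewrite upd_id.
    by rewrite /=; do 4 (case=> [<-|]; first by rewrite sc => ->; match goal with |- context [None :: Some ?a :: _] => exists [:: a] end).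
  - case=> -[|a [|? ?]] [] //= _.
      by move=> _ ->; exists (noop (scan_of s)); [by left | rewrite sn upd_id].
    rewrite andbT => aw ->; exists [ffun j => if j == tW then (Some a, MoveL)
        else (scan_of s j, Stay)]; last by rewrite sc.
    by case: a aw => [[]|[[[]|?]|?]] // _; right; rewrite /=; auto.
have incS s1 : S1 s1 -> spec increment s1 (N ^ 7) (eq (upd s1 tC C')).
  case=> g [_ _ s1E].
  have s1C : s1 tC = home (map Bit b) by rewrite s1E.
  by have [s2 <-] := run_increment s1C bN.
have bodyS : spec (Seq guess_sym increment) s (1 + N ^ 7).+1 S2.
  apply: (spec_weaken (SpecSeq guessS incS)) => // s'.
  by split=> -[s1 H1 H2]; exists s1.
have nb : nonblank tC (scan_of s).
  by rewrite /nonblank (scan_mk sC); case: (b) b0.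
pose S3 (s2 s' : store) := exists g c2, [/\ size g <= r, all is_wsym g,
    s2 tW = mk [::] (None :: somes c2) &
    s' = upd (upd s2 tC (mk (somes (nseq (size b) (Bit false))) [::]))
             tW (mk [::] (None :: somes (g ++ c2)))].
have restS s2 : S2 s2 -> spec guess s2 (r * N ^ 8).+1 (S3 s2).
  case=> s1 [g [g1 gw s1E]] s2E.
  have s2W : s2 tW = mk [::] (None :: somes (g ++ c)) by rewrite s2E s1E.
  have [ab|nab] := boolP (all id b).
    have CE : C' = mk (somes (nseq (size b) (Bit false))) [::] by rewrite /C' ab.
    have r0 : r = 0 by move: ab rE; rewrite counter_all => /eqP<-; lia.
    have s2C : s2 tC = mk (somes (nseq (size b) (Bit false))) [::] by rewrite s2E upd_eq.
    rewrite /S3 r0; apply: (spec_weaken (SpecWhileF _ _)) => //.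
      by rewrite /nonblank (scan_mk s2C).
    move=> s'; split.
      by move=> <-; exists [::], (g ++ c); split=> //; rewrite upd_id ?upd_neq // upd_id.
    case=> -[|? ?] [c2 [//= _ _ c2E ->]].
    by rewrite upd_id ?upd_neq // upd_id.
  have [cE zE] := counter_incr nab.
  set b' := _ ++ _ in cE zE.
  have s2C : s2 tC = home (map Bit b') by rewrite s2E upd_eq /C' (negbTE nab).
  apply: (spec_weaken (IH b' (g ++ c) s2 _ _ s2C s2W _)) => //.
  - by rewrite zE.
  - by rewrite zE.
  - by rewrite zE cE -rE; lia.
  - move=> s'; rewrite zE; split.
      by case=> g' [g'r g'w ->]; exists g', (g ++ c); split.
    case=> g' [c2 [g'r g'w s2W' ->]]; exists g'; split=> //.
    by rewrite (@contents_inj c2 (g ++ c)) // -s2W' s2W.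
apply: (spec_weaken (SpecWhileT nb bodyS restS)).
  by rewrite mulSn expnS; have := expN_gt0 N_gt2 7; nia.
move=> s'; split.
  case=> s2 [s1 [g1 [g1s g1w s1E]] s2E] [g2 [c2 [g2s g2w s2W ->]]].
  exists (g2 ++ g1); split.
  - by rewrite size_cat; lia.
  - by rewrite all_cat g2w.
  - have -> : c2 = g1 ++ c by apply: contents_inj; rewrite -s2W s2E s1E.
    by rewrite s2E s1E catA; store_eq.
case=> g [gs gw ->].
(* The guess is written from right to left, so its last symbol is the one chosen in the present
   round. *)
case/lastP: g gs gw => [|g a] gs gw.
  exists (upd (upd s tW (mk [::] (None :: somes c))) tC C').
    by exists (upd s tW (mk [::] (None :: somes c))) => //; exists [::].
  by exists [::], c; split=> //; store_eq.
rewrite size_rcons in gs; rewrite all_rcons in gw; case/andP: gw => aw gw.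
exists (upd (upd s tW (mk [::] (None :: somes (a :: c)))) tC C').
  exists (upd s tW (mk [::] (None :: somes (a :: c)))) => //.
  by exists [:: a]; rewrite /= aw.
by exists g, (a :: c); split=> //; rewrite cat_rcons; store_eq.
Qed.

End Spec.

End TheoryEvaluation.

Lemma size_input_entry x : size (input_entry x) = size x + 4.
Proof. by rewrite /input_entry /= size_cat size_map size_rev addn2 addn4. Qed.

(** The hypothesis lets [N] exceed the guessed word, the input entry and the clauses together. The
    nested search costs [N ^ 70], that is 35 for [check] and 7 for each of five variables; 90 leaves
    room for the other stages. *)
Lemma spec_solver x N : 2 ^ (size x).+1 + 2 * size x + 5 < N ->
  exists S, spec solver (@init_store extra 12 x) (N ^ 90) S /\
    (satisfiable x <-> exists s, S s).
Proof.
move=> NB; have N2 : 2 < N by lia.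
have xN : size x < N by lia.
set s0 := init_store _ _.
have s0E (j : 'I_13) : j != tX -> s0 j = mk [::] [::].
  move=> jX; rewrite /s0 /init_store.
  have -> : (j == ord0) = false.
    by apply: contraNF jX => /eqP->; apply/eqP/val_inj.
  by congr pair; apply: funext => k; rewrite nth_nil.
have s0X : s0 tX = home (map Bit x).
  rewrite /s0 /init_store /home /somes -map_comp.
  by congr pair; apply: funext => k; rewrite nth_nil.
have [s1 s1E prep] : run N 14 (Seq prepare decode_input) s0 (fun s' => exists t,
    s' = upd (upd (upd (upd s0 tW (mk [::] (None :: somes (input_entry x)))) tC
      (home (nseq (size x).+1 (Bit false)))) tX t) tP (home (decode x))).
  apply: (run_seq N2 (k := 13)).
    apply: (run_conseq N2 (run_prepare N2 s0X _ _ xN)) (fun=> id) => //.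
      by rewrite s0E // mk_nilr.
    by rewrite s0E.
  move=> s1 <-.
  apply: (run_conseq N2 (run_decode_input N2 (x := x) _ _ (ltnW xN))) => //.
  by rewrite !upd_neq // s0E.
have [t {}s1E] := s1E.
pose zs := mk (somes (nseq (size x).+1 (Bit false))) [::].
pose S2 s2 := exists g, [/\ size g <= 2 ^ (size x).+1, all is_wsym g &
  s2 = upd (upd s1 tC zs) tW (mk [::] (None :: somes (g ++ input_entry x)))].
have guessS : spec guess s1 (2 ^ (size x).+1 * N ^ 8).+1 S2.
  have := @spec_guess N N2 (nseq (size x).+1 false) (input_entry x) (2 ^ (size x).+1) s1.
  rewrite size_nseq; apply=> //.
  - by rewrite s1E map_nseq.
  - by rewrite s1E.
  - by rewrite counter_nseq_false addn0.
pose R g := refuted (g ++ input_entry x) (decode x) (enum 'I_5) (fun=> [::]).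
pose S3 s2 s' := exists g, [/\ s2 tW = mk [::] (None :: somes (g ++ input_entry x)),
  ~~ R g & s' = upd (upd s2 tW (home (g ++ input_entry x))) tB (flag (R g))].
have restS s2 : S2 s2 -> spec (Seq verify (If (nonblank tB) fail skip)) s2 (N ^ 80) (S3 s2).
  case=> g [gs gw s2E].
  have [s3 s3E verS] : run N 71 verify s2 (eq (upd (upd s2 tW (home (g ++ input_entry x)))
       tB (flag (R g)))).
    apply: (run_seq N2 (k := 70)).
      by apply: (run_conseq N2 (run_act1 (Q := eq _) erefl) _ (fun=> id)).
    move=> s3 <-.
    have -> : sact (scan_of s2 tW, MoveR) (s2 tW) = home (g ++ input_entry x).
      rewrite s2E upd_eq mk_moveR (scan_mk (l := [::])
        (r := None :: somes (g ++ input_entry x))) ?upd_eq //.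
      exact: mk_nill.
    have := @run_nest N N2 (enum 'I_5) (upd s2 tW (home (g ++ input_entry x)))
       (decode x) (g ++ input_entry x) (fun=> [::]) false.
    rewrite size_enum_ord orFb; apply.
    - exact: enum_uniq.
    - by move=> i; rewrite mem_enum inE upd_neq ?tV_neq // s2E s1E /upd !tV_neq // s0E ?tV_neq.
    - by [].
    - rewrite size_cat size_input_entry.
      apply: leq_ltn_trans NB.
      apply: leq_trans (leq_add (size_decode x) (leq_add gs (leqnn (size x + 4)))) _.
      by move: (2 ^ _) => M; lia.
    - by rewrite s2E s1E !upd_neq // s0E.
    - by rewrite upd_eq.
    - by rewrite s2E s1E !upd_neq // s0E.
    - by rewrite s2E s1E.
    - by rewrite s2E s1E !upd_neq // s0E.
    - by rewrite s2E s1E !upd_neq // s0E.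
  subst s3; set s3 := upd _ tB _ in verS.
  pose S4 s' := ~~ R g /\ s' = s3.
  have ifS : spec (If (nonblank tB) fail skip) s3 2 S4.
    apply: (spec_weaken (SpecIf _)) (leqnn 2) (fun=> iff_refl _).
    rewrite (scan_flag (b := R g)) ?upd_eq //; rewrite /S4; case: (R g).
      apply: (spec_weaken (SpecOp _ _)) => // s'; split; first by case.
      by case.
    have [s4 s4E skipS] := run_skip (N := N) (s := s3) (Q := eq s3) erefl.
    by apply: (spec_weaken skipS) => // s'; rewrite -s4E; split=> [->|[]].
  apply: (spec_weaken (SpecSeq (S' := fun=> S4) verS _)).
  - by move=> s4 <-; exact: ifS.
  - have h : 3 <= N ^ 71 by apply: (leq_trans N2); apply: (@leq_pexp2l N 1 71 (ltnW (ltnW N2)) isT).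
    have h1 : 3 * N ^ 71 <= N ^ 72 by rewrite expnS leq_mul2r N2 orbT.
    have h2 : N ^ 72 <= N ^ 80 by apply: (leq_pexp2l (ltnW (ltnW N2)) (isT : 72 <= 80)).
    apply: leq_trans h2; apply: leq_trans h1.
    by move: (N ^ 71) h => M; lia.
  - move=> s'; split.
      case=> s4 _ [Rg ->]; exists g; split=> //.
      by rewrite s2E upd_eq.
    case=> g' [gE Rg ->]; exists s3 => //.
    have gg' : g' ++ input_entry x = g ++ input_entry x.
      by apply: contents_inj; rewrite -gE s2E upd_eq.
    by move: Rg; rewrite /S4 /s3 /R gg'.
have SS := SpecSeq prep (fun s' (e : s1 = s') => eq_ind s1 (fun z => spec
  (Seq guess (Seq verify (If (nonblank tB) fail skip))) z _ _) (SpecSeq guessS restS) s' e).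
eexists; split; first apply: (spec_weaken SS _ (fun=> iff_refl _)).
  have N1 : 1 < N by apply: ltnW.
  have h1 : 2 ^ (size x).+1 * N ^ 8 <= N ^ 9.
    rewrite [N ^ 9]expnS leq_mul2r; apply/orP; right.
    by apply: leq_trans (ltnW NB); rewrite -addnA leq_addr.
  have h2 k : 3 * N ^ k <= N ^ k.+1 by rewrite expnS leq_mul2r N2 orbT.
  have h3 j k : j <= k -> N ^ j <= N ^ k by move=> jk; rewrite leq_exp2l.
  apply: leq_trans (h3 82 90 isT); apply: leq_trans (h2 81).
  have := h2 80; have := h3 14 80 isT; have := h3 9 80 isT; have := expN_gt0 N2 80.
  move: (N ^ 14) (N ^ 80) (N ^ 81) => A B C.
  move: (N ^ 9) (2 ^ _ * _) h1 => D E; lia.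
split.
- move/asboolP=> [g [gs gw Rg]].
  set s2 := upd (upd s1 tC zs) tW (mk [::] (None :: somes (g ++ input_entry x))).
  exists (upd (upd s2 tW (home (g ++ input_entry x))) tB (flag (R g))).
  exists s1 => //; exists s2; first by exists g.
  by exists g; split=> //; rewrite upd_eq.
- case=> s' [_ _ [s2 [g [gs gw s2E]] [g' [gE Rg _]]]].
  have gg' : g' ++ input_entry x = g ++ input_entry x.
    by apply: contents_inj; rewrite -gE s2E upd_eq.
  by apply/asboolP; exists g; split=> //; move: Rg; rewrite /R gg'.
Qed.

(** The time of [solver] is 2 to a linear function of n with a large slope. By 2nk <= n^2 + k^2 the
    slope moves into a constant factor. *)
Lemma pow_bound (k n : nat) : 2 ^ ((n + 4) * (2 * k)) <= 2 ^ (k * k + 8 * k) * 2 ^ (n ^ 2).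
Proof.
rewrite -expnD leq_exp2l // expnS expn1.
suff : 2 * (n * k) <= n * n + k * k by lia.
by rewrite !mulnn; apply: (nat_Cauchy n k).1.
Qed.

Lemma satisfiable_NEXP : NEXP satisfiable.
Proof.
exists 2 => //=.
pose N (x : seq bool) := 2 ^ (size x).+1 + 2 * size x + 6.
have NB x : 2 ^ (size x).+1 + 2 * size x + 5 < N x by rewrite /N; lia.
have H x := cid (spec_solver (NB x)).
have [c cE] : exists c, c = 2 ^ (45 * 45 + 8 * 45) by eexists.
apply: (@spec_NTIME extra 12 solver (fun x => N x ^ 90) (fun x => projT1 (H x)) satisfiable _ c).
- by move=> x; case: (H x) => S [].
- move=> x; rewrite /N; set n := size x.
  have h : 2 ^ n.+1 + 2 * n + 6 <= 2 ^ (n + 4).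
    have : n < 2 ^ n by rewrite ltn_expl.
    by rewrite expnS expnD -[2 ^ 4]/(16); lia.
  have h2 : (2 ^ n.+1 + 2 * n + 6) ^ 90 <= 2 ^ ((n + 4) * 90).
    by rewrite expnM leq_exp2r.
  apply: leq_trans h2 _; apply: leq_trans (leq_addr _ _).
  by rewrite cE; exact: (pow_bound 45 n).
- by move=> x; case: (H x) => S [].
Qed.

(** * Codes of clause sets *)

(** A prefix code: a stack of symbols becomes a concatenation, and a push or pop is a constant
    prefix in front of a variable, which is all that terms can express. *)
Definition unary (k : nat) : seq bool := nseq k true ++ [:: false].
Definition key (p : seq nat) : seq bool := flatten (map unary p).

Lemma unary_cat_inj j k u v : unary j ++ u = unary k ++ v -> j = k /\ u = v.
Proof.
elim: j k => [|j IH] [|k] //=; first by case.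
by case=> /IH[-> ->].
Qed.

Lemma key_inj : injective key.
Proof.
elim=> [|j p IH] [|k q] //=; rewrite /key /=; try by case: (j) || case: (k).
by move/unary_cat_inj=> [-> /IH ->].
Qed.

Definition fact (T : Type) : Type := (seq nat * seq T)%type.
Definition word : Type := seq bool.

(* The term [(c, vs)] is the constant [c] followed by the variables [vs]. *)
Definition term : Type := (word * seq 'I_5)%type.
Definition clause : Type := (seq (fact term) * seq (fact term))%type.
Definition assignment : Type := 'I_5 -> word.

Definition inst_term (a : assignment) (t : term) : word := t.1 ++ flatten (map a t.2).
Definition inst (a : assignment) (f : fact term) : fact word :=
  (f.1, map (inst_term a) f.2).

Definition holds (E : fact word -> Prop) (a : assignment) (c : clause) : Prop :=
  (forall f, f \in c.1 -> E (inst a f)) -> exists2 f, f \in c.2 & E (inst a f).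

Definition models (E : fact word -> Prop) (th : seq clause) : Prop :=
  forall c a, c \in th -> holds E a c.

Definition code (c : sym) : seq bool :=
  match c with
  | inl b => [:: false; false; false; b]
  | inr (inl (inl b)) => [:: false; false; true; b]
  | inr (inl (inr b)) => [:: false; true; false; b]
  | inr (inr None) => [:: false; true; true; true]
  | inr (inr (Some i)) => [:: true; odd (i %/ 4); odd (i %/ 2); odd i]
  end.

Lemma codeK c : decode_sym (code c) = c.
Proof.
case: c => [b|[[[]|b]|[i|]]] //=; congr (inr (inr (Some _))).
by apply: val_inj; rewrite /= inordK; case: i => -[|[|[|[|[|]]]]].
Qed.

Lemma size_code c : size (code c) = 4.
Proof. by case: c => [b|[[b|b]|[i|]]]. Qed.

Definition encode (ts : seq sym) : seq bool := flatten (map code ts).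

Lemma size_encode ts : size (encode ts) = 4 * size ts.
Proof.
by elim: ts => // t ts IH; rewrite /encode /= size_cat -/(encode ts) IH size_code mulnS.
Qed.

(** Padding by zeros turns into tokens [Bit false] because 0000 is the code of that symbol. *)
Lemma decode_encode ts k : exists j, decode (encode ts ++ nseq k false) =
  ts ++ nseq j (Bit false).
Proof.
elim: ts => [|t ts [j IH]] /=.
  elim/ltn_ind: k => -[|k] IH; first by exists 0.
  case: (IH (k - 3)) => [|j jE]; first by lia.
  exists j.+1; rewrite decode_cons drop_cons drop_nseq jE /=.
  by congr cons; case: (k) => [|[|[|?]]] //=; rewrite take0.
exists j; rewrite /encode /= -/(encode ts) -catA.
have := codeK t; have := size_code t; case: (code t) => [|a [|b [|c [|d [|]]]]] // _ tE.
rewrite decode_cons /= take0; congr cons; first exact: tE.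
by rewrite drop0 IH.
Qed.

Definition tok_term (t : term) : seq sym := map Bit t.1 ++ map Var t.2 ++ [:: Hash].
Definition tok_fact (f : fact term) : seq sym :=
  Dollar :: map Bit (key f.1) ++ Hash :: flatten (map tok_term f.2) ++ [:: Dollar].
Definition tok_lit b (f : fact term) : seq sym := Lit b :: tok_fact f.
Definition tok_clause (c : clause) : seq sym :=
  flatten (map (tok_lit false) c.1) ++ flatten (map (tok_lit true) c.2) ++ [:: End].
Definition tok_theory (th : seq clause) : seq sym := flatten (map tok_clause th).

Definition body (f : fact word) : seq sym :=
  flatten [seq map Bit a ++ [:: Hash] | a <- key f.1 :: f.2].
(** Delimited on both sides, so that an occurrence is a whole fact. Neighbouring facts in a word may
    share a delimiter, as in [facts_word]. *)
Definition entry (f : fact word) : seq sym := Dollar :: body f ++ [:: Dollar].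

Lemma input_entryE x : input_entry x = entry ([::], [:: rev x]).
Proof. by rewrite /input_entry /entry /body /= cats0 -!catA. Qed.

Definition occurs (w s : seq sym) : bool :=
  has (prefix s) [seq drop k w | k <- iota 0 (size w)].

Lemma occursP w s : s != [::] ->
  reflect (exists p q, w = p ++ s ++ q) (occurs w s).
Proof.
move=> s0; apply: (iffP hasP).
- case=> d /mapP[k _ ->] /prefixP[q qE]; exists (take k w), q.
  by rewrite -qE cat_take_drop.
- case=> p [q ->]; exists (s ++ q); last exact: prefix_prefix.
  apply/mapP; exists (size p); last by rewrite drop_size_cat.
  rewrite mem_iota /= !size_cat; case: (s) s0 => //= _ s' _.
  by rewrite addSn addnS ltnS leq_addr.
Qed.

Definition bits_of (c : sym) : option bool := if c is inl b then Some b else None.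
Definition assigned (v : valuation) : assignment :=
  fun i => pmap bits_of (takew is_bit (v i)).

Lemma takew_bits (s : seq sym) :
  map Bit (pmap bits_of (takew is_bit s)) = takew is_bit s.
Proof. by elim: s => // -[b|?] s IH //=; rewrite IH. Qed.

Lemma subst_cat v s t : subst v (s ++ t) = subst v s ++ subst v t.
Proof. by rewrite /subst map_cat flatten_cat. Qed.

Lemma subst_bits v (c : word) : subst v (map Bit c) = map Bit c.
Proof. by elim: c => //= b c IH; rewrite /subst /= -/(subst _ _) IH. Qed.

Lemma subst_term v t : subst v (tok_term t) = map Bit (inst_term (assigned v) t) ++ [:: Hash].
Proof.
rewrite /tok_term !subst_cat subst_bits /inst_term map_cat -catA; congr (_ ++ (_ ++ _)).
elim: t.2 => //= i s IH; rewrite /subst /= -/(subst _ _) IH map_cat.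
by rewrite /assigned takew_bits.
Qed.

Lemma subst_fact v f : subst v (tok_fact f) = entry (inst (assigned v) f).
Proof.
have sc c s : is_wsym c -> subst v (c :: s) = c :: subst v s.
  by case: c => [?|[[?|?]|[?|]]].
rewrite /entry /body /tok_fact sc //; congr cons.
rewrite subst_cat subst_bits sc // /= -!catA; congr (_ ++ (_ :: _)).
rewrite subst_cat sc //; congr cat.
by elim: f.2 => //= t s IH; rewrite subst_cat IH subst_term.
Qed.

Lemma all_pat_fact f : all is_pat (tok_fact f).
Proof.
rewrite /= all_cat /= all_cat /= andbT; apply/andP; split.
  by rewrite all_map; apply/allP.
elim: f.2 => //= t s IH; rewrite all_cat IH andbT /tok_term !all_cat /= andbT.
by rewrite !all_map; apply/andP; split; apply/allP.
Qed.

Lemma takew_pat p c s : all is_pat p -> ~~ is_pat c -> takew is_pat (p ++ c :: s) = p.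
Proof.
elim: p => /= [_ /negbTE->//|x p IH /andP[-> pp] cn]; by rewrite IH.
Qed.

Lemma eval_pat w v b p ts : all is_pat p -> eval w v b (p ++ ts) = eval w v b ts.
Proof. by elim: p => //= c p IH /andP[]; case: c => [?|[[?|?]|[?|]]]. Qed.

Lemma eval_lit w v b sgn f c ts : ~~ is_pat c ->
  eval w v b (tok_lit sgn f ++ c :: ts) =
  eval w v (b || (occurs w (entry (inst (assigned v) f)) == sgn)) (c :: ts).
Proof.
move=> cn; transitivity (eval w v (b || (found w v (tok_fact f ++ c :: ts) == sgn))
  (tok_fact f ++ c :: ts)); first by [].
by rewrite eval_pat ?all_pat_fact // /found takew_pat ?all_pat_fact // subst_fact.
Qed.

Definition bholds (E : fact word -> bool) (a : assignment) (c : clause) : bool :=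
  all (fun f => E (inst a f)) c.1 ==> has (fun f => E (inst a f)) c.2.

Lemma bholdsP (E : fact word -> bool) a c : reflect (holds E a c) (bholds E a c).
Proof.
apply: (iffP implyP) => [H P|H /allP P].
- have /hasP[f fc Ef] : has (fun f => E (inst a f)) c.2 by apply: H; apply/allP.
  by exists f.
- by have [f fc Ef] := H P; apply/hasP; exists f.
Qed.

Lemma eval_lits w v b sgn fs c ts : ~~ is_pat c ->
  eval w v b (flatten (map (tok_lit sgn) fs) ++ c :: ts) =
  eval w v (b || has (fun f => occurs w (entry (inst (assigned v) f)) == sgn) fs) (c :: ts).
Proof.
move=> cn; elim: fs b => [|f fs IH] b; first by rewrite /= orbF.
have -> : flatten (map (tok_lit sgn) (f :: fs)) ++ c :: ts =
    tok_lit sgn f ++ (flatten (map (tok_lit sgn) fs) ++ c :: ts) by rewrite catA.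
have [c' [ts' [E c'n]]] : exists c' ts', flatten (map (tok_lit sgn) fs) ++ c :: ts = c' :: ts' /\ ~~ is_pat c'.
  by case: (fs) => [|f' fs']; [exists c, ts | exists (Lit sgn); eexists].
by rewrite E eval_lit // -E IH /= orbA.
Qed.

Lemma eval_clause w v c ts :
  eval w v false (tok_clause c ++ ts) =
  bholds (fun f => occurs w (entry f)) (assigned v) c && eval w v false ts.
Proof.
rewrite /tok_clause -catA -catA.
have [c' [ts' [E c'n]]] : exists c' ts',
    flatten (map (tok_lit true) c.2) ++ [:: End] ++ ts = c' :: ts' /\ ~~ is_pat c'.
  by case: (c.2) => [|f' fs']; [exists End, ts | exists (Lit true); eexists].
rewrite E eval_lits // -E eval_lits //= /bholds implybE; congr (_ && _); congr (_ || _).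
  by rewrite -has_predC; apply: eq_has => f /=; rewrite eqbF_neg.
by apply: eq_has => f; rewrite eqb_id.
Qed.

Lemma eval_theory w v th k :
  eval w v false (tok_theory th ++ nseq k (Bit false)) =
  all (bholds (fun f => occurs w (entry f)) (assigned v)) th.
Proof.
elim: th => [|c th IH] /=; first by elim: k.
by rewrite -catA eval_clause IH.
Qed.

Lemma refutedP w ts vs v : reflect
  (exists2 v' : valuation,
     (forall i, (i \in vs -> v' i \in [seq drop k w | k <- iota 0 (size w)]) /\
                (i \notin vs -> v' i = v i)) & ~~ eval w v' false ts)
  (refuted w ts vs v).
Proof.
elim: vs v => [|i vs IH] v /=.
  apply: (iffP idP) => [H|[v' v'E]]; first by exists v.
  by rewrite (_ : v' = v) //; apply: funext => i; apply: (v'E i).2.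
apply: (iffP hasP).
- case=> s sw /IH[v' v'E H]; exists v' => // k; have [v'1 v'2] := v'E k.
  rewrite inE; move: v'2; rewrite /updv; case: (k =P i) => [->|_] v'2; split=> //=.
  by have := v'E i; rewrite /updv eqxx; case: (i \in vs) => -[// + ->//]; move=> h _; exact: h.
- case=> v' v'E H; exists (v' i); first by apply: (v'E i).1; rewrite inE eqxx.
  apply/IH; exists v' => // k; have [v'1 v'2] := v'E k; split=> [kv|kv].
    by apply: v'1; rewrite inE kv orbT.
  rewrite /updv; case: (k =P i) => [->//|/eqP ki].
  by apply: v'2; rewrite inE negb_or ki.
Qed.

Local Arguments entry : simpl never.

Definition olast (T : Type) (s : seq T) : option T := last None (map Some s).

Lemma olast_rcons (T : Type) (s : seq T) x : olast s = Some x -> exists s', s = rcons s' x.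
Proof.
case/lastP: s => // s y; rewrite /olast map_rcons last_rcons => -[->].
by exists s.
Qed.

Definition terms (fs : seq (fact term)) : seq term := flatten [seq f.2 | f <- fs].
Definition vars (fs : seq (fact term)) : seq 'I_5 := flatten [seq t.2 | t <- terms fs].
Definition last_vars (fs : seq (fact term)) : seq 'I_5 :=
  pmap (fun t : term => olast t.2) (terms fs).

(* A premise that contains [v ++ #] forces the value of [v] to be read off the
   guessed word, so that the valuations tried by [solver] suffice. *)
Definition range_restricted (c : clause) : bool :=
  all (fun i => i \in last_vars c.1) (vars c.1 ++ vars c.2).

Lemma inst_ext (a a' : assignment) fs f : f \in fs ->
  (forall i, i \in vars fs -> a i = a' i) -> inst a f = inst a' f.
Proof.
move=> ffs aa'; congr pair; apply/eq_in_map => t tf.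
rewrite /inst_term; congr (_ ++ flatten _); apply/eq_in_map => i it.
apply: aa'; apply/flattenP; exists t.2 => //; apply/mapP; exists t => //.
by apply/flattenP; exists f.2 => //; apply/mapP; exists f.
Qed.

Lemma entry_arg (h : seq nat) (l r : seq word) b : exists p q,
  entry (h, l ++ b :: r) = p ++ map Bit b ++ Hash :: q.
Proof.
rewrite /entry /body /= map_cat flatten_cat /=.
set A := map Bit (key h) ++ _; set L := flatten _; set R := flatten _.
exists (Dollar :: A ++ L), (R ++ [:: Dollar]).
by rewrite /= -!catA.
Qed.

Lemma entry_neq0 f : entry f != [::]. Proof. by []. Qed.

Lemma takew_all p (c : sym) s : all is_bit p -> ~~ is_bit c -> takew is_bit (p ++ c :: s) = p.
Proof.
elim: p => /= [_ /negbTE->//|x p IH /andP[-> pp] cn]; by rewrite IH.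
Qed.

Lemma all_bits (b : word) : all is_bit (map Bit b).
Proof. by rewrite all_map; apply/allP. Qed.

Lemma last_var_value w a fs i : i \in last_vars fs ->
    (forall f, f \in fs -> occurs w (entry (inst a f))) ->
  exists2 d, d \in [seq drop k w | k <- iota 0 (size w)] & takew is_bit d = map Bit (a i).
Proof.
rewrite /last_vars mem_pmap => /mapP[t /flattenP[fa /mapP[f ffs ->] tf] /esym ti] H.
have [vs vsE] := olast_rcons ti.
have /(occursP _ (entry_neq0 _))[p [q wE]] := H f ffs.
case: f {ffs} tf wE => h args tf wE.
have {wE} : w = p ++ entry (h, map (inst_term a) args) ++ q := wE.
case/splitPr: {tf} args / (tf : t \in args) => l r; rewrite map_cat map_cons.
have [p' [q' ->]] := entry_arg h (map (inst_term a) l) (map (inst_term a) r) (inst_term a t).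
have -> : inst_term a t = (t.1 ++ flatten (map a vs)) ++ a i.
  by rewrite /inst_term vsE map_rcons -cats1 flatten_cat /= cats0 catA.
rewrite map_cat; set u := map Bit (t.1 ++ _) => wE.
have {}wE : w = (p ++ p' ++ u) ++ (map Bit (a i) ++ Hash :: q' ++ q).
  by rewrite wE -!catA.
exists (map Bit (a i) ++ Hash :: q' ++ q); last by rewrite takew_all ?all_bits.
apply/mapP; exists (size (p ++ p' ++ u)); last by rewrite wE drop_size_cat.
rewrite mem_iota wE [size (_ ++ (_ ++ _ :: _))]size_cat /= -addn1 leq_add2l.
by rewrite size_cat addnS.
Qed.

(** The facts that occur in the guessed word form the model. Of its size only a bound on the
    arguments is kept; it later prevents runs from being prolonged forever. *)
Lemma satisfiable_models th k x : all range_restricted th ->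
    x = encode (tok_theory th) ++ nseq k false -> satisfiable x ->
  exists E B, [/\ forall f, E f -> all (fun a => size a <= B) f.2,
    E ([::], [:: rev x]) & models E th].
Proof.
move=> rr xE /asboolP[g [_ _ /negP nref]].
set w := g ++ input_entry x in nref.
exists (fun f => occurs w (entry f)), (size w); split.
- case=> h args /(occursP _ (entry_neq0 _))[p [q wE]]; apply/allP => b /= bargs.
  case/splitPr: bargs wE => l r.
  have [p' [q' ->]] := entry_arg h l r b => ->.
  rewrite !size_cat size_map addnCA; apply: leq_trans (leq_addr _ _).
  by rewrite addnCA leq_addr.
- apply/occursP => //; exists g, [::]; rewrite cats0 /w input_entryE //.
- move=> c a cth P.
  have rc := allP rr _ cth.
  have /choice[v vE] : forall i, exists d, d \in [seq drop k w | k <- iota 0 (size w)] /\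
      (i \in last_vars c.1 -> takew is_bit d = map Bit (a i)).
    move=> i.
    have [il|il] := boolP (i \in last_vars c.1).
      by have [d dw dE] := last_var_value il P; exists d.
    (* By range restriction this variable does not occur in [c], so its value is irrelevant. *)
    exists w; split=> //; apply/mapP; exists 0; rewrite ?drop0 //.
    by rewrite mem_iota /= /w size_cat size_input_entry addn4 addnS.
  have aE i : i \in vars c.1 ++ vars c.2 -> a i = assigned v i.
    move=> ic; have il : i \in last_vars c.1 by apply: (allP rc).
    rewrite /assigned (vE i).2 //; elim: (a i) => //= b s IH; by rewrite -IH.
  have : eval w v false (decode x).
    apply/negPn/negP => H; apply: nref; apply/refutedP; exists v => // i.
    by split=> [_|]; [exact: (vE i).1 | rewrite mem_enum inE].
  have [j dE] := decode_encode (tok_theory th) k.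
  rewrite xE dE eval_theory => /allP/(_ _ cth)/bholdsP H.
  have [f fc Ef] : exists2 f, f \in c.2 & occurs w (entry (inst (assigned v) f)).
    apply: H => f fc; rewrite -(inst_ext (a := a) fc); first exact: P.
    by move=> i ic; apply: aE; rewrite mem_cat ic.
  exists f => //; rewrite (inst_ext (a' := assigned v) fc) // => i ic.
  by apply: aE; rewrite mem_cat ic orbT.
Qed.

Lemma body_inj : injective body.
Proof.
have E : injective (fun s : seq word => flatten [seq map Bit a ++ [:: Hash] | a <- s]).
  elim=> [|a s IH] [|b t] //=; rewrite -?catA; try by [case: (a) | case: (b)].
  elim: a b => [|x a IHa] [|y b] //=; first by case=> /IH->.
  by case=> -> /IHa[-> ->].
by case=> h args [h' args'] /E[/key_inj-> ->].
Qed.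

Lemma body_dollar f : Dollar \notin body f.
Proof.
rewrite /body; elim: (key f.1 :: f.2) => //= a s IH.
rewrite !mem_cat !negb_or IH andbT; apply/andP; split=> //.
by apply/negP => /mapP[].
Qed.

Lemma dollar_split (a b s t : seq sym) : Dollar \notin a -> Dollar \notin b ->
  a ++ Dollar :: s = b ++ Dollar :: t -> a = b /\ s = t.
Proof.
elim: a b => [|x a IH] [|y b] //=.
- by move=> _ _ [].
- by move=> _ yb [E _]; rewrite -E inE eqxx in yb.
- by move=> xa _ [E _]; rewrite E inE eqxx in xa.
- rewrite !inE !negb_or => /andP[_ xa] /andP[_ yb] [-> /(IH _ xa yb)[-> ->]].
  by [].
Qed.

Definition facts_word (fs : seq (fact word)) : seq sym :=
  flatten [seq Dollar :: body f | f <- fs].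

Lemma facts_word_cons f fs : facts_word (f :: fs) = Dollar :: body f ++ facts_word fs.
Proof. by []. Qed.

Lemma facts_word_cat fs gs : facts_word (fs ++ gs) = facts_word fs ++ facts_word gs.
Proof. by rewrite /facts_word map_cat flatten_cat. Qed.

(** No body contains [Dollar], hence an occurrence of an entry is aligned with the delimiters of the
    word. *)
Lemma occurs_facts fs f : occurs (facts_word fs ++ [:: Dollar]) (entry f) = (f \in fs).
Proof.
apply/occursP/idP => //.
- case=> p [q]; rewrite /entry; elim: fs p => [|f' fs IH] p.
    case: p => [|x p] /=; last by case=> _; case: p.
    by case; case: (body f) => // ? ?; case.
  have [r rE] : exists r, facts_word fs ++ [:: Dollar] = Dollar :: r.
    by case: (fs) => [|? ?]; eexists.
  rewrite facts_word_cons cat_cons -catA rE.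
  case: p => [|x p]; rewrite ?cat0s ?cat_cons => E0.
    have E : body f' ++ Dollar :: r = (body f ++ [:: Dollar]) ++ q := congr1 behead E0.
    rewrite -catA in E.
    have [/body_inj-> _] := @dollar_split (body f') (body f) r q (body_dollar _) (body_dollar _) E.
    by rewrite inE eqxx.
  have E : body f' ++ Dollar :: r = p ++ (Dollar :: body f ++ [:: Dollar]) ++ q :=
    congr1 behead E0.
  clear E0; rewrite inE; apply/orP; right.
  have {E} : exists p', Dollar :: r = p' ++ (Dollar :: body f ++ [:: Dollar]) ++ q.
    elim: (body f') (body_dollar f') p E => [|y b IHb] yb p E; first by exists p.
    case: p E => [|z p] /=.
      by case=> E _; rewrite E inE eqxx in yb.
    case=> _; apply: IHb; by move: yb; rewrite inE negb_or => /andP[].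
  by rewrite -rE => -[p']; apply: IH.
- case/splitPr=> l r; exists (facts_word l).
  have [t tE] : exists t, facts_word r ++ [:: Dollar] = Dollar :: t.
    by case: (r) => [|? ?]; eexists.
  exists t; rewrite facts_word_cat facts_word_cons /entry.
  by move: (body f) => bf; rewrite -catA cat_cons -catA tE cat_cons -catA.
Qed.

Lemma facts_word_wsym fs : all is_wsym (facts_word fs).
Proof.
elim: fs => //= f fs IH; rewrite all_cat IH andbT /body.
elim: (key f.1 :: f.2) => //= a s IHs; rewrite !all_cat IHs all_map /= !andbT.
by apply/allP.
Qed.

Lemma models_satisfiable th k x (fs : seq (fact word)) :
    x = encode (tok_theory th) ++ nseq k false ->
    models (fun f => f \in ([::], [:: rev x]) :: fs) th ->
    size (facts_word fs) <= 2 ^ (size x).+1 -> satisfiable x.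
Proof.
move=> xE mod_fs fsB; apply/asboolP; exists (facts_word fs); split=> //.
  exact: facts_word_wsym.
have -> : facts_word fs ++ input_entry x =
    facts_word (rcons fs ([::], [:: rev x])) ++ [:: Dollar].
  by rewrite -cats1 facts_word_cat facts_word_cons cats0 -catA input_entryE.
apply/refutedP => -[v _]; have [j dE] := decode_encode (tok_theory th) k.
rewrite xE dE eval_theory -xE => /allPn[c cth /bholdsP]; apply.
move=> P; have [f fc Ef] : exists2 f, f \in c.2 &
    inst (assigned v) f \in ([::], [:: rev x]) :: fs.
  by apply: mod_fs => // f /P; rewrite occurs_facts mem_rcons.
by exists f => //; rewrite occurs_facts mem_rcons.
Qed.

(** * Clauses that describe runs *)

Definition vY : 'I_5 := @Ordinal 5 0 isT.
Definition vK : 'I_5 := @Ordinal 5 1 isT.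
Definition vL : 'I_5 := @Ordinal 5 2 isT.
Definition vR : 'I_5 := @Ordinal 5 3 isT.
Definition vS : 'I_5 := @Ordinal 5 4 isT.

Definition cv (c : word) (v : 'I_5) : term := (c, [:: v]).
Definition cst (c : word) : term := (c, [::]).
Definition tY := cv [::] vY.
Definition tK := cv [::] vK.
Definition tL := cv [::] vL.
Definition tR := cv [::] vR.
Definition tS := cv [::] vS.

Section Facts.
Variable T : Type.
Implicit Types (y k l r s u v w d : T).
(* The run of the machine number [t] on the reversed input [y], after the choices
   coded by [k]: [fTape] gives the two stacks of the tape [i], and [fScan] the
   state with the symbols scanned by the first [j] heads. [fConv] turns the part
   of [y] before [u] into the tape content [v], and [fLive] selects the choices
   that are explored. *)
Definition fStart (t : nat) y : fact T := ([:: 1; t], [:: y]).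
Definition fConv (t : nat) y u v : fact T := ([:: 2; t], [:: y; u; v]).
Definition fTape (t i : nat) y k l r : fact T := ([:: 3; t; i], [:: y; k; l; r]).
Definition fScan (t j : nat) y k s : fact T := ([:: 4; t; j], [:: y; k; s]).
Definition fLive (t : nat) y k : fact T := ([:: 5; t], [:: y; k]).
End Facts.

Definition assign (y k l r s : word) : assignment :=
  fun i => nth [::] [:: y; k; l; r; s] i.

Lemma key_cons n p : key (n :: p) = unary n ++ key p. Proof. by []. Qed.
Lemma key_cat p q : key (p ++ q) = key p ++ key q.
Proof. by rewrite /key map_cat flatten_cat. Qed.

Lemma unary_cat_key n u p : unary n ++ u = key p -> exists p', p = n :: p' /\ u = key p'.
Proof.
case: p => [|m p]; rewrite /key /=; first by case: n.
by case/unary_cat_inj=> <- ->; exists p.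
Qed.

Section Simulation.
Variables (G : ntm) (blocked : pred (state G)) (t : nat).
Local Notation K := (extra_tapes G).
Local Notation cellT := (option (bool + aux G)).

Definition rank (c : cell (aux G)) : nat := enum_rank (c : cellT).
Definition srank (q : state G) : nat := enum_rank q.

Lemma rank_inj : injective rank.
Proof. by move=> a b /val_inj/enum_rank_inj. Qed.

Lemma srank_inj : injective srank.
Proof. by move=> a b /val_inj/enum_rank_inj. Qed.

Definition ccode c : word := unary (rank c).
Definition enc (s : seq (cell (aux G))) : word := key (map rank s).
Definition scode q : word := unary (srank q).
(** The symbol read last comes first: reading one more head puts a constant in front of a
    variable. *)
Definition venc q (cs : seq (cell (aux G))) : word := key (map rank (rev cs)) ++ scode q.
Definition cells (a : {ffun 'I_K.+1 -> cell (aux G)}) : seq (cell (aux G)) :=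
  [seq a i | i <- enum 'I_K.+1].

Definition bitc (b : bool) : cell (aux G) := Some (inl b).

(** Moving the bits of [y] one by one onto a stack reverses them, so a simulation started with [y]
    has [rev y] on its tape. The empty input has its own clause because the scanned cell is then a
    blank. *)
Definition start_clauses : seq clause :=
  [:: ([:: fStart t tY], [:: fConv t tY tY (cst [::])]);
      ([:: fStart t tY], [:: fScan t 0 tY (cst [::]) (cst (scode (start G)))]);
      ([:: fStart t tY], [:: fLive t tY (cst [::])]);
      ([:: fConv t tY (cst [::]) (cst [::])],
       [:: fTape t 0 tY (cst [::]) (cst [::]) (cst (enc [:: None]))]) ] ++
  [seq ([:: fStart t tY],
        [:: fTape t (val i) tY (cst [::]) (cst [::]) (cst (enc [:: None]))])
     | i <- enum 'I_K.+1 & i != ord0] ++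
  [seq ([:: fConv t tY (cv [:: b] vL) tR], [:: fConv t tY tL (cv (ccode (bitc b)) vR)])
     | b <- [:: false; true]] ++
  [seq ([:: fConv t tY (cst [::]) (cv (ccode (bitc b)) vR)],
        [:: fTape t 0 tY (cst [::]) (cst [::]) (cv (ccode (bitc b)) vR)])
     | b <- [:: false; true]].

(** The heads are read one after the other. A clause that mentions all tapes at once would need a
    number of variables that grows with the number of tapes. *)
Definition scan_clauses : seq clause :=
  flatten [seq [seq ([:: fScan t (val i) tY tK tS;
                         fTape t (val i) tY tK tL (cv (ccode c) vR)],
                     [:: fScan t (val i).+1 tY tK (cv (ccode c) vS)])
                  | c <- enum {: cellT}] | i <- enum 'I_K.+1].

(* A stack is represented by its topmost symbols, followed by a variable
   unless these symbols are the whole stack. *)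
Definition sstack : Type := (seq (cell (aux G)) * bool)%type.
Definition stack_term (s : sstack) (v : 'I_5) : term :=
  (enc s.1, if s.2 then [:: v] else [::]).

Definition pop_case (d : option (cell (aux G))) : sstack :=
  if d is Some c then ([:: c], true) else ([::], false).

Definition sact_left (a : cell (aux G) * move) (l r : sstack) : sstack :=
  match a.2 with
  | MoveL => (behead l.1, l.2)
  | Stay => l
  | MoveR => (a.1 :: l.1, l.2)
  end.

Definition sact_right (a : cell (aux G) * move) (l r : sstack) : sstack :=
  match a.2 with
  | MoveL => (head None l.1 :: a.1 :: r.1, r.2)
  | Stay => (a.1 :: r.1, r.2)
  | MoveR => (head None r.1 :: behead r.1, r.2)
  end.

Definition pop_cases : seq (option (cell (aux G))) :=
  None :: [seq Some c | c <- enum {: cellT}].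

(** The history [k] is prolonged by the number [n] of the instruction, and only if the new history
    is live. Each tape has its own clauses, one for every combination of top symbols (or empty
    stacks) next to the head. *)
Definition step_clauses (q : state G) (a : {ffun 'I_K.+1 -> cell (aux G)}) (n : nat)
    (b : state G * {ffun 'I_K.+1 -> cell (aux G) * move}) : seq clause :=
  let live := fLive t tY (cv (unary n) vK) in
  let scan := fScan t K.+1 tY tK (cst (venc q (cells a))) in
  ([:: live; scan], [:: fScan t 0 tY (cv (unary n) vK) (cst (scode b.1))]) ::
  flatten [seq flatten [seq [seq
     let l := pop_case dl in let r := pop_case dr in
     ([:: live; scan; fTape t (val i) tY tK (stack_term l vL) (stack_term (a i :: r.1, r.2) vR)],
      [:: fTape t (val i) tY (cv (unary n) vK) (stack_term (sact_left (b.2 i) l r) vL)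
            (stack_term (sact_right (b.2 i) l r) vR)])
     | dr <- pop_cases] | dl <- pop_cases] | i <- enum 'I_K.+1].

(** Steps from [blocked] states are described elsewhere; for an oracle machine this is the query
    state. *)
Definition all_steps (F : state G -> {ffun 'I_K.+1 -> cell (aux G)} -> seq clause) :
    seq clause :=
  flatten [seq flatten [seq F q a | a <- enum {ffun 'I_K.+1 -> cellT}]
             | q <- enum (state G) & ~~ blocked q].

Definition run_clauses : seq clause :=
  all_steps (fun q a => flatten [seq
    (if onth (trans q a) n is Some b then step_clauses q a n b else [::])
    | n <- iota 0 (size (trans q a))]).

(** A live configuration that does not accept must have a live successor. Without successors the
    conclusion is empty, so a dead end violates the clause. *)
Definition exists_clauses : seq clause :=
  all_steps (fun q a => if accepting q then [::] else
    [:: ([:: fLive t tY tK; fScan t K.+1 tY tK (cst (venc q (cells a)))],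
         [seq fLive t tY (cv (unary n) vK) | n <- iota 0 (size (trans q a))])]).

(** All successors of live configurations are live, and none of them may accept. The scan by no
    heads is the bare state. *)
Definition forall_clauses : seq clause :=
  all_steps (fun q a => [seq
     ([:: fLive t tY tK; fScan t K.+1 tY tK (cst (venc q (cells a)))],
      [:: fLive t tY (cv (unary n) vK)]) | n <- iota 0 (size (trans q a))]) ++
  [seq ([:: fLive t tY tK; fScan t 0 tY tK (cst (scode q))], [::])
     | q <- enum (state G) & accepting q].

Definition sim_theory : seq clause := start_clauses ++ scan_clauses ++ run_clauses.

Lemma mem_all_steps F q a c : ~~ blocked q -> c \in F q a -> c \in all_steps F.
Proof.
move=> nq ca; apply/flatten_mapP; exists q; first by rewrite mem_filter nq mem_enum.
by apply/flatten_mapP; exists a => //; rewrite mem_enum.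
Qed.

Lemma all_stepsP F c : c \in all_steps F -> exists q a, ~~ blocked q /\ c \in F q a.
Proof.
case/flatten_mapP=> q; rewrite mem_filter => /andP[nq _] /flatten_mapP[a _ ca].
by exists q, a.
Qed.

Lemma range_sim : all range_restricted sim_theory.
Proof.
rewrite /sim_theory /start_clauses !all_cat; apply/andP; split.
  apply/and4P; split=> //; rewrite all_map //; apply/allP => i _.
  by [].
apply/andP; split; apply/allP => c.
  by case/flatten_mapP=> i _ /mapP[d _ ->].
case/all_stepsP=> q [a [_ /flatten_mapP[n _]]].
case: onth => // b; rewrite inE => /orP[/eqP->//|].
case/flatten_mapP=> i _ /flatten_mapP[dl _ /mapP[dr _ ->]].
by case: dl dr => [?|] [?|]; rewrite /sact_left /sact_right; case: (b.2 i) => ? [].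
Qed.

Lemma range_exists : all range_restricted exists_clauses.
Proof.
apply/allP => c /all_stepsP[q [a [_]]]; case: ifP => // _; rewrite inE => /eqP->.
apply/allP => i; rewrite mem_cat => /orP[//|].
case/flatten_mapP=> t0 /flatten_mapP[f /mapP[n _ ->]].
by rewrite !inE => /orP[] /eqP-> /=; rewrite inE => /eqP->.
Qed.

Lemma range_forall : all range_restricted forall_clauses.
Proof.
rewrite all_cat; apply/andP; split; apply/allP => c.
  by case/all_stepsP=> q [a [_ /mapP[n _ ->]]].
by case/mapP=> q _ ->.
Qed.

End Simulation.

(** Folds rather than quantifiers, so that explicit clauses simplify to plain conjunctions and
    disjunctions. *)
Definition premises (E : fact word -> Prop) a (P : seq (fact term)) : Prop :=
  foldr (fun f Q => E (inst a f) /\ Q) True P.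
Definition conclusions (E : fact word -> Prop) a (C : seq (fact term)) : Prop :=
  foldr (fun f Q => E (inst a f) \/ Q) False C.

Lemma premisesP E a P : premises E a P <-> (forall f, f \in P -> E (inst a f)).
Proof.
elim: P => [|f P IH] /=; first by split.
rewrite IH; split=> [[Ef EP] g|H].
  by rewrite inE => /orP[/eqP->|/EP].
split; first by apply: H; rewrite inE eqxx.
by move=> g gP; apply: H; rewrite inE gP orbT.
Qed.

Lemma conclusionsP E a C : conclusions E a C <-> exists2 f, f \in C & E (inst a f).
Proof.
elim: C => [|f C IH] /=; first by split=> // -[].
rewrite IH; split=> [[Ef|[g gC Eg]]|[g]].
- by exists f; rewrite // inE eqxx.
- by exists g; rewrite // inE gC orbT.
- by rewrite inE => /orP[/eqP->|gC] Eg; [left | right; exists g].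
Qed.

Lemma holdsE E a P C : holds E a (P, C) <-> (premises E a P -> conclusions E a C).
Proof. by rewrite premisesP conclusionsP. Qed.

Lemma models_use E th P C (y k l r s : word) : models E th -> (P, C) \in th ->
  premises E (assign y k l r s) P -> conclusions E (assign y k l r s) C.
Proof. by move=> M cth; apply/holdsE; apply: M. Qed.

Lemma models_cat E th th' : models E (th ++ th') <-> models E th /\ models E th'.
Proof.
split=> [M|[M M'] c a].
  by split=> c a ct; apply: M; rewrite mem_cat ct ?orbT.
by rewrite mem_cat => /orP[]; [apply: M | apply: M'].
Qed.

Lemma inst_stack G (st : sstack G) v a :
  inst_term a (stack_term st v) = enc st.1 ++ (if st.2 then a v else [::]).
Proof. by rewrite /inst_term /stack_term; case: st.2; rewrite /= ?cats0. Qed.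

(** * Models contain the runs that the clauses describe *)

Section Soundness.
Variables (G : ntm) (blocked : pred (state G)) (t : nat) (E : fact word -> Prop).
Hypothesis ME : models E (sim_theory blocked t).
Local Notation K := (extra_tapes G).

Definition scans (C : config G) : {ffun 'I_K.+1 -> cell (aux G)} :=
  [ffun i => scanned (C.2 i)].

Definition tape_fact (y k : word) (i : nat) (T : tape (aux G)) : fact word :=
  fTape t i y k (enc T.1.1) (enc (T.1.2 :: T.2)).

(** Only the presence of the right facts is asked for. A model may contain spurious ones as well;
    they do no harm, since soundness follows the facts forward from the start. *)
Definition describes (y k : word) (C : config G) : Prop :=
  E (fScan t 0 y k (scode C.1)) /\ forall i, E (tape_fact y k (val i) (C.2 i)).

Lemma enc_cons c (s : seq (cell (aux G))) : enc (c :: s) = ccode c ++ enc s.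
Proof. by []. Qed.

Lemma venc_rcons q (cs : seq (cell (aux G))) c : venc q (rcons cs c) = ccode c ++ venc q cs.
Proof. by rewrite /venc rev_rcons /= key_cons catA. Qed.

Lemma start_mem c : c \in start_clauses G t -> c \in sim_theory blocked t.
Proof. by move=> h; rewrite /sim_theory mem_cat h. Qed.

Lemma conv_sound y y1 u : E (fStart t y) -> y = y1 ++ u ->
  E (fConv t y u (enc [seq bitc G b | b <- rev y1])).
Proof.
move=> Sy; elim/last_ind: y1 u => [|y1 b IH] u yE.
  rewrite /= in yE; rewrite -yE.
  have := @models_use E _ _ _ y [::] [::] [::] [::] ME (start_mem (mem_head _ _)).
  by rewrite /= /inst /= /inst_term /= !cats0 => /(_ (conj Sy I))[].
rewrite rev_rcons /= enc_cons.
have cin : ([:: fConv t tY (cv [:: b] vL) tR], [:: fConv t tY tL (cv (ccode (bitc G b)) vR)])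
    \in sim_theory blocked t.
  apply: start_mem; rewrite /start_clauses !mem_cat; apply/orP; right; apply/orP; right.
  apply/orP; left; by case: (b); rewrite /= !inE eqxx ?orbT.
have := @models_use E _ _ _ y [::] u (enc [seq bitc G b | b <- rev y1]) [::] ME cin.
rewrite /= /inst /= /inst_term /= !cats0 => H.
have [] // := H _; split=> //; apply: IH; by rewrite yE cat_rcons.
Qed.

Lemma start_sound y : E (fStart t y) ->
  describes y [::] (init G (rev y)) /\ E (fLive t y [::]).
Proof.
move=> Sy.
have U P C y' k l r s := @models_use E _ P C y' k l r s ME.
split; last first.
  have := U [:: fStart t tY] [:: fLive t tY (cst [::])] y [::] [::] [::] [::].
  rewrite /= /inst /= /inst_term /= !cats0 => H.
  by case: H => //; apply: start_mem; rewrite !inE eqxx ?orbT.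
split.
  have := U [:: fStart t tY] [:: fScan t 0 tY (cst [::]) (cst (scode (start G)))] y [::] [::] [::] [::].
  rewrite /= /inst /= /inst_term /= !cats0 => H.
  by case: H => //; apply: start_mem; rewrite !inE eqxx ?orbT.
move=> i; rewrite /init /= ffunE; have [->|i0] := eqVneq i ord0; last first.
  have := U [:: fStart t tY] [:: fTape t (val i) tY (cst [::]) (cst [::]) (cst (enc [:: (None : cell (aux G))]))] y [::] [::] [::] [::].
  rewrite /= /inst /= /inst_term /= !cats0 => H.
  case: H => //; apply: start_mem; rewrite /start_clauses !mem_cat; apply/orP; right.
  apply/orP; left; apply/mapP; exists i => //.
  by rewrite mem_filter i0 mem_enum.
have := conv_sound Sy (esym (cats0 y)).
rewrite /tape_fact /input_tape /=; case: (rev y) => [|b w] CE.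
  have := U [:: fConv t tY (cst [::]) (cst [::])] [:: fTape t 0 tY (cst [::]) (cst [::]) (cst (enc [:: (None : cell (aux G))]))] y [::] [::] [::] [::].
  rewrite /= /inst /= /inst_term /= !cats0 => H.
  by case: H => //; apply: start_mem; rewrite !inE eqxx ?orbT.
have := U [:: fConv t tY (cst [::]) (cv (ccode (bitc G b)) vR)] [:: fTape t 0 tY (cst [::]) (cst [::]) (cv (ccode (bitc G b)) vR)] y [::] [::] (enc [seq bitc G b | b <- w]) [::].
rewrite /= /inst /= /inst_term /= !cats0 => H.
case: H => //; apply: start_mem; rewrite /start_clauses !mem_cat.
by do 3 (apply/orP; right); case: (b); rewrite /= !inE eqxx ?orbT.
Qed.

Lemma size_cells (a : {ffun 'I_K.+1 -> cell (aux G)}) : size (cells a) = K.+1.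
Proof. by rewrite size_map size_enum_ord. Qed.

Lemma nth_cells (a : {ffun 'I_K.+1 -> cell (aux G)}) (i : 'I_K.+1) :
  nth None (cells a) i = a i.
Proof. by rewrite (nth_map ord0) ?size_enum_ord // nth_ord_enum. Qed.

Lemma take_cells (a : {ffun 'I_K.+1 -> cell (aux G)}) (i : 'I_K.+1) :
  take i.+1 (cells a) = rcons (take i (cells a)) (a i).
Proof. by rewrite (take_nth None) ?size_cells // nth_cells. Qed.

Lemma scan_sound y k C j : describes y k C -> j <= K.+1 ->
  E (fScan t j y k (venc C.1 (take j (cells (scans C))))).
Proof.
move=> [S0 ST]; elim: j => [|j IH] jK; first by rewrite take0.
pose i := Ordinal jK; rewrite -[j]/(val i) take_cells venc_rcons.
have := @models_use E _ [:: fScan t (val i) tY tK tS;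
                         fTape t (val i) tY tK tL (cv (ccode (scans C i)) vR)]
                     [:: fScan t (val i).+1 tY tK (cv (ccode (scans C i)) vS)]
   y k (enc (C.2 i).1.1) (enc (C.2 i).2) (venc C.1 (take j (cells (scans C)))) ME.
rewrite /= /inst /= /inst_term /= !cats0 => H.
case: H => //; last first.
  split; first by apply: IH; apply: ltnW.
  split=> //; have := ST i; rewrite /tape_fact enc_cons /scans ffunE.
  by case: (C.2 i) => [[l c] r].
rewrite /sim_theory !mem_cat; apply/orP; right; apply/orP; left.
apply/flatten_mapP; exists i; first by rewrite mem_enum.
by apply/mapP; exists (scans C i); rewrite ?mem_enum.
Qed.

Lemma full_scan_sound y k C : describes y k C ->
  E (fScan t K.+1 y k (venc C.1 (cells (scans C)))).
Proof.
by move=> D; have := scan_sound D (leqnn _); rewrite take_oversize ?size_cells.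
Qed.

Lemma onth_successors (C : config G) n : onth (successors C) n =
  omap (fun b : state G * {ffun 'I_K.+1 -> cell (aux G) * move} =>
          (b.1, [ffun i => act (b.2 i) (C.2 i)])) (onth (trans C.1 (scans C)) n).
Proof. by rewrite /successors onth_map. Qed.

Definition slist (st : sstack G) (s : seq (cell (aux G))) := st.1 ++ (if st.2 then s else [::]).

(** A move touches at most the top symbol of either stack, so the remainders can stay variables in
    the clauses. *)
Lemma sact_correct (a : cell (aux G) * move) (l r : seq (cell (aux G))) c :
  let L := pop_case (ohead l) in let R := pop_case (ohead r) in
  let T := act a (l, c, r) in
  T.1.1 = slist (sact_left a L R) (behead l) /\
  T.1.2 :: T.2 = slist (sact_right a L R) (behead r).
Proof.
by case: a => x []; case: l => [|? ?]; case: r => [|? ?]; rewrite /slist /= ?cats0.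
Qed.

Lemma enc_cat (s s' : seq (cell (aux G))) : enc (s ++ s') = enc s ++ enc s'.
Proof. by rewrite /enc map_cat key_cat. Qed.

Lemma inst_slist (st : sstack G) v a s : a v = enc s ->
  inst_term a (stack_term st v) = enc (slist st s).
Proof. by move=> av; rewrite inst_stack /slist enc_cat; case: st.2; rewrite // av. Qed.

Lemma ohead_cases (s : seq (cell (aux G))) : ohead s \in pop_cases G.
Proof.
by case: s => [|c s]; rewrite /pop_cases inE //=; apply/mapP; exists c; rewrite ?mem_enum.
Qed.

Lemma step_sound y k C n C' : describes y k C -> ~~ blocked C.1 ->
    onth (successors C) n = Some C' -> E (fLive t y (unary n ++ k)) ->
  describes y (unary n ++ k) C'.
Proof.
move=> D nb; rewrite onth_successors; case bE : (onth _ _) => [b|] //= [<-] Lk.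
have Sk := full_scan_sound D.
have nsz : n \in iota 0 (size (trans C.1 (scans C))).
  by rewrite mem_iota /= -onthTE bE.
have sub c : c \in step_clauses t C.1 (scans C) n b -> c \in sim_theory blocked t.
  move=> cin; rewrite /sim_theory !mem_cat; apply/orP; right; apply/orP; right.
  apply: (mem_all_steps (a := scans C)) nb _; apply/flatten_mapP; exists n => //.
  by rewrite bE.
split=> [|i].
  have := @models_use E _ _ _ y k [::] [::] [::] ME (sub _ (mem_head _ _)).
  rewrite /= /inst /= /inst_term /= !cats0 => H.
  by case: H.
rewrite ffunE; case CiE : (C.2 i) => [[l c] r].
have ai : scans C i = c by rewrite /scans ffunE CiE.
have [TL TR] := sact_correct (b.2 i) l r c.
set L := pop_case (ohead l) in TL TR *; set R := pop_case (ohead r) in TL TR *.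
set T := act _ _ in TL TR *.
have := @models_use E _
  [:: fLive t tY (cv (unary n) vK); fScan t K.+1 tY tK (cst (venc C.1 (cells (scans C))));
      fTape t (val i) tY tK (stack_term L vL) (stack_term (scans C i :: R.1, R.2) vR)]
  [:: fTape t (val i) tY (cv (unary n) vK) (stack_term (sact_left (b.2 i) L R) vL)
            (stack_term (sact_right (b.2 i) L R) vR)] y k (enc (behead l)) (enc (behead r)) [::] ME.
rewrite /premises /conclusions /= /inst /= !(@inst_slist _ vL _ (behead l)) //.
rewrite !(@inst_slist _ vR _ (behead r)) // -TL -TR /inst_term /= !cats0.
have lE : slist L (behead l) = l by rewrite /L; case: (l).
have rE : slist (scans C i :: R.1, R.2) (behead r) = c :: r.
  by rewrite ai /R; case: (r).
rewrite lE rE => H; case: H => //.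
- apply: sub; rewrite /step_clauses inE; apply/orP; right.
  apply/flatten_mapP; exists i; first by rewrite mem_enum.
  apply/flatten_mapP; exists (ohead l); first exact: ohead_cases.
  by apply/mapP; exists (ohead r); first exact: ohead_cases.
- split=> //; split=> //; split=> //.
  by have := D.2 i; rewrite CiE.
Qed.

Lemma exists_sound y k C : models E (exists_clauses blocked t) -> describes y k C ->
    E (fLive t y k) -> ~~ blocked C.1 -> ~~ accepting C.1 ->
  exists n C', onth (successors C) n = Some C' /\ E (fLive t y (unary n ++ k)).
Proof.
move=> MX D Lk nb na; have Sk := full_scan_sound D.
have cin : ([:: fLive t tY tK; fScan t K.+1 tY tK (cst (venc C.1 (cells (scans C))))],
         [seq fLive t tY (cv (unary n) vK) | n <- iota 0 (size (trans C.1 (scans C)))])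
   \in exists_clauses blocked t.
  by apply: (mem_all_steps (a := scans C)) nb _; rewrite (negbTE na) inE eqxx.
have := models_use (y := y) (k := k) (l := [::]) (r := [::]) (s := [::]) MX cin.
rewrite {1}/premises /= /inst /= /inst_term /= !cats0 => /(_ (conj Lk (conj Sk I))).
case/conclusionsP=> f /mapP[n nsz ->]; rewrite /inst /= /inst_term /= !cats0 => Ln.
move: nsz; rewrite mem_iota /= -onthTE => nsz.
exists n; rewrite onth_successors; case: (onth _ n) nsz => // b _.
by eexists; split; first reflexivity.
Qed.

Lemma forall_sound y k C n C' : models E (forall_clauses blocked t) -> describes y k C ->
    E (fLive t y k) -> ~~ blocked C.1 -> onth (successors C) n = Some C' ->
  E (fLive t y (unary n ++ k)).
Proof.
move=> MA D Lk nb; have Sk := full_scan_sound D.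
rewrite onth_successors => CE.
have nsz : n \in iota 0 (size (trans C.1 (scans C))).
  by rewrite mem_iota /= -onthTE; case: onth CE.
have cin : ([:: fLive t tY tK; fScan t K.+1 tY tK (cst (venc C.1 (cells (scans C))))],
         [:: fLive t tY (cv (unary n) vK)]) \in forall_clauses blocked t.
  rewrite mem_cat; apply/orP; left; apply: (mem_all_steps (a := scans C)) nb _.
  by apply/mapP; exists n.
have := models_use (y := y) (k := k) (l := [::]) (r := [::]) (s := [::]) MA cin.
rewrite /= /inst /= /inst_term /= !cats0 => H.
by case: H.
Qed.

Lemma forall_not_accepting y k C : models E (forall_clauses blocked t) -> describes y k C ->
  E (fLive t y k) -> ~~ accepting C.1.
Proof.
move=> MA [D _] Lk; apply/negP => ac.
have cin : ([:: fLive t tY tK; fScan t 0 tY tK (cst (scode C.1))], [::])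
    \in forall_clauses blocked t.
  rewrite mem_cat; apply/orP; right; apply/mapP; exists C.1 => //.
  by rewrite mem_filter ac mem_enum.
have := models_use (y := y) (k := k) (l := [::]) (r := [::]) (s := [::]) MA cin.
by rewrite /= /inst /= /inst_term /= !cats0; apply.
Qed.

End Soundness.

Section Runs.
Variables (G : ntm) (blocked : pred (state G)) (t : nat) (E : fact word -> Prop).
Hypothesis ME : models E (sim_theory blocked t).
Variable R : rel (config G).
Hypothesis R_step : forall C C', ~~ blocked C.1 -> R C C' = step C C'.

Lemma onth_mem (T : eqType) (s : seq T) x : x \in s -> exists n, onth s n = Some x.
Proof.
elim: s => //= y s IH; rewrite inE => /orP[/eqP->|/IH[n nE]]; first by exists 0.
by exists n.+1.
Qed.

Lemma mem_onth (T : eqType) (s : seq T) n x : onth s n = Some x -> x \in s.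
Proof.
elim: s n => [|y s IH] [|n] //=; first by case=> ->; rewrite inE eqxx.
by move/IH; rewrite inE orbC => ->.
Qed.

(** Every step lengthens the history, which is an argument of a live fact and therefore has size at
    most [B]. So the run that is followed must end, and it can end only in an accepting state. *)
Lemma exists_accepts B y : models E (exists_clauses blocked t) ->
    (forall f, E f -> all (fun a => size a <= B) f.2) -> E (fStart t y) ->
    (forall k p, path R (init G (rev y)) p ->
       let C := last (init G (rev y)) p in
       describes t E y k C -> E (fLive t y k) -> blocked C.1 -> ~~ accepting C.1 ->
       exists n C', [/\ R C C', describes t E y (unary n ++ k) C' &
                       E (fLive t y (unary n ++ k))]) ->
  accepts R (rev y).
Proof.
move=> MX bd Sy Hb; have [D0 L0] := start_sound ME Sy.
suff H m k p : B < size k + m -> path R (init G (rev y)) p ->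
    describes t E y k (last (init G (rev y)) p) -> E (fLive t y k) -> accepts R (rev y).
  by apply: (H B.+1 [::] [::]).
elim: m k p => [|m IH] k p km pp D L.
  by have := bd _ L; rewrite /= andbT => /andP[_]; rewrite leqNgt -[size k]addn0 km.
set C := last _ _ in D.
have [ac|na] := boolP (accepting C.1); first by exists p.
have [n [C' [CC' D' L']]] : exists n C', [/\ R C C', describes t E y (unary n ++ k) C' &
                       E (fLive t y (unary n ++ k))].
  have [bl|nb] := boolP (blocked C.1); first exact: Hb.
  have [n [C' [nE L']]] := exists_sound ME MX D L nb na.
  exists n, C'; split=> //; first by rewrite R_step // /step; apply: mem_onth nE.
  exact: (step_sound ME D nb nE L').
apply: (IH (unary n ++ k) (rcons p C')) => //.
- by rewrite size_cat /unary size_cat /=; lia.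
- by rewrite rcons_path pp.
- by rewrite last_rcons.
Qed.

Lemma forall_rejects y : models E (forall_clauses blocked t) -> E (fStart t y) ->
    (forall k p C', path R (init G (rev y)) p ->
       let C := last (init G (rev y)) p in
       describes t E y k C -> E (fLive t y k) -> blocked C.1 -> R C C' ->
       exists n, describes t E y (unary n ++ k) C' /\ E (fLive t y (unary n ++ k))) ->
  ~ accepts R (rev y).
Proof.
move=> MA Sy Hb [p pp ac]; have [D0 L0] := start_sound ME Sy.
have [k D L] : exists2 k, describes t E y k (last (init G (rev y)) p) & E (fLive t y k).
  elim/last_ind: p pp {ac} => [|p C' IH]; first by exists [::].
  rewrite rcons_path last_rcons => /andP[pp CC']; have [k D L] := IH pp.
  have [bl|nb] := boolP (blocked (last (init G (rev y)) p).1).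
    by have [n [D' L']] := Hb k p C' pp D L bl CC'; exists (unary n ++ k).
  move: CC'; rewrite R_step // /step => /onth_mem[n nE].
  have L' := forall_sound ME MA D L nb nE.
  by exists (unary n ++ k); first exact: (step_sound ME D nb nE L').
by have := forall_not_accepting MA D L; rewrite ac.
Qed.

End Runs.

(** * Oracle queries *)

Section OracleFacts.
Variable T : Type.
Implicit Types (y k l r w : T).
Definition fRewind y k l r : fact T := ([:: 6], [:: y; k; l; r]).
Definition fQuery y k r w : fact T := ([:: 7], [:: y; k; r; w]).
End OracleFacts.

(* The simulations with tags 1 and 2 certify positive and negative answers. *)
Section Oracle.
Variable M : ontm.
Local Notation K := (extra_tapes M).
Local Notation query := (query_state M).
Local Notation cellT := (option (bool + aux M)).
Definition is_query : pred (state M) := fun q => q == query.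

Definition cell_bit (c : cell (aux M)) : word := if c is Some (inl b) then [:: b] else [::].

(** The query tape is first rewound and then read to the right. The bits are pushed one by one, so
    the query comes out reversed, as [fStart] wants it. The model must then start one of the two
    certificates, and the answer follows its choice. An answer counts as instruction number 0. *)
Definition oracle_clauses : seq clause :=
  [:: ([:: fScan 0 0 tY tK (cst (scode query));
           fTape 0 (val (query_tape M)) tY tK tL tR], [:: fRewind tY tK tL tR]);
      ([:: fRewind tY tK (cst [::]) tR], [:: fQuery tY tK tR (cst [::])]);
      ([:: fQuery tY tK (cst [::]) tS], [:: fStart 1 tS; fStart 2 tS]);
      ([:: fQuery tY tK (cst [::]) tS; fStart 1 tS; fLive 0 tY (cv (unary 0) vK)],
       [:: fScan 0 0 tY (cv (unary 0) vK) (cst (scode (yes_state M)))]);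
      ([:: fQuery tY tK (cst [::]) tS; fStart 2 tS; fLive 0 tY (cv (unary 0) vK)],
       [:: fScan 0 0 tY (cv (unary 0) vK) (cst (scode (no_state M)))]) ] ++
  [seq ([:: fRewind tY tK (cv (ccode c) vL) tR], [:: fRewind tY tK tL (cv (ccode c) vR)])
     | c <- enum {: cellT}] ++
  [seq ([:: fQuery tY tK (cv (ccode c) vR) tS], [:: fQuery tY tK tR (cv (cell_bit c) vS)])
     | c <- enum {: cellT}] ++
  [seq ([:: fScan 0 0 tY tK (cst (scode query)); fLive 0 tY (cv (unary 0) vK);
            fTape 0 (val i) tY tK tL tR],
        [:: fTape 0 (val i) tY (cv (unary 0) vK) tL tR]) | i <- enum 'I_K.+1].

(** Separate from [oracle_clauses] because an accepting run may end in a query state, if that state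
    accepts. *)
Definition oracle_live : seq clause :=
  [:: ([:: fLive 0 tY tK; fScan 0 0 tY tK (cst (scode query))],
       [:: fLive 0 tY (cv (unary 0) vK)])].

Lemma range_oracle : all range_restricted oracle_clauses.
Proof. by rewrite /oracle_clauses !all_cat /= !all_map; do !(apply/andP; split=> //); apply/allP. Qed.

Lemma range_oracle_live : all range_restricted oracle_live. Proof. by []. Qed.

Variable E : fact word -> Prop.
Hypothesis ME : models E oracle_clauses.

Definition query_word (C : config M) : seq bool := tape_word (C.2 (query_tape M)).

Lemma query_sound y k C : describes 0 E y k C -> is_query C.1 ->
  E (fQuery y k [::] (rev (query_word C))).
Proof.
move=> [D0 DT] /eqP Cq; rewrite Cq in D0.
have U P C' y' k' l r s := @models_use E _ P C' y' k' l r s ME.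
rewrite /query_word; have := DT (query_tape M); rewrite /tape_fact.
case: (C.2 (query_tape M)) => [[l c] r] /= Dq.
have Rw l1 l2 : l = l1 ++ l2 -> E (fRewind y k (enc l2) (enc (rev l1 ++ c :: r))).
  elim/last_ind: l1 l2 => [|l1 d IH] l2 lE.
    rewrite /= in lE; rewrite -lE /=.
    have := U [:: fScan 0 0 tY tK (cst (scode query));
           fTape 0 (val (query_tape M)) tY tK tL tR] [:: fRewind tY tK tL tR]
      y k (enc l) (enc (c :: r)) [::].
    rewrite /= /inst /= /inst_term /= !cats0 => H.
    by case: H => //; rewrite /oracle_clauses !inE eqxx.
  have := U [:: fRewind tY tK (cv (ccode d) vL) tR] [:: fRewind tY tK tL (cv (ccode d) vR)]
      y k (enc l2) (enc (rev l1 ++ c :: r)) [::].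
  rewrite /= /inst /= /inst_term /= !cats0 rev_rcons /= => H.
  case: H => //; last by split=> //; apply: (IH (d :: l2)); rewrite lE cat_rcons.
  rewrite /oracle_clauses !mem_cat; apply/orP; right; apply/orP; left.
  by apply/mapP; exists d; rewrite ?mem_enum.
have := U [:: fRewind tY tK (cst [::]) tR] [:: fQuery tY tK tR (cst [::])] y k [::] (enc (rev l ++ c :: r)) [::].
rewrite /= /inst /= /inst_term /= !cats0 => H.
case: H; [by rewrite /oracle_clauses !inE eqxx ?orbT | by split=> //; apply: (Rw l [::]); rewrite cats0 | move=> Q0 | by []].
set w := rev l ++ c :: r in Q0 *.
pose bits := pmap (fun d : cell (aux M) => if d is Some (inl b) then Some b else None).
rewrite -/(bits w).
suff Q w1 w2 : w = w1 ++ w2 -> E (fQuery y k (enc w2) (rev (bits w1))).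
  by apply: (Q w [::]); rewrite cats0.
elim/last_ind: w1 w2 => [|w1 d IH] w2 wE; first by rewrite /= in wE; rewrite -wE.
have := U [:: fQuery tY tK (cv (ccode d) vR) tS] [:: fQuery tY tK tR (cv (cell_bit d) vS)]
   y k [::] (enc w2) (rev (bits w1)).
rewrite /= /inst /= /inst_term /= !cats0 => {}H.
have -> : rev (bits (rcons w1 d)) = cell_bit d ++ rev (bits w1).
  rewrite /bits -cats1 pmap_cat rev_cat /=; case: (d) => [[b|g]|] //=.
case: H => //; last by split=> //; apply: (IH (d :: w2)); rewrite wE cat_rcons.
rewrite /oracle_clauses !mem_cat; apply/orP; right; apply/orP; right; apply/orP; left.
by apply/mapP; exists d; rewrite ?mem_enum.
Qed.

Lemma answer_start y k C : describes 0 E y k C -> is_query C.1 ->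
  E (fStart 1 (rev (query_word C))) \/ E (fStart 2 (rev (query_word C))).
Proof.
move=> D Cq; have Q := query_sound D Cq.
have := @models_use E _ [:: fQuery tY tK (cst [::]) tS] [:: fStart 1 tS; fStart 2 tS]
  y k [::] [::] (rev (query_word C)) ME.
rewrite /= /inst /= /inst_term /= !cats0 => H.
by case: H => // [|[]//]; [left | right].
Qed.

(** Correctness of the certificates is assumed for the present query only: negative ones are
    justified by all runs in one clause set and by the list in the other. *)
Lemma oracle_sound (A : language) y k C : describes 0 E y k C -> is_query C.1 ->
    E (fLive 0 y (unary 0 ++ k)) ->
    (E (fStart 1 (rev (query_word C))) -> A (query_word C)) ->
    (E (fStart 2 (rev (query_word C))) -> ~ A (query_word C)) ->
  describes 0 E y (unary 0 ++ k)
    (if A (query_word C) then yes_state M else no_state M, C.2).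
Proof.
move=> D Cq L A1 A2; have Q := query_sound D Cq.
have U P C' y' k' l r s := @models_use E _ P C' y' k' l r s ME.
split=> [|i] /=.
  case: (answer_start D Cq) => S12.
    rewrite (A1 S12).
    have := U [:: fQuery tY tK (cst [::]) tS; fStart 1 tS; fLive 0 tY (cv (unary 0) vK)]
       [:: fScan 0 0 tY (cv (unary 0) vK) (cst (scode (yes_state M)))]
       y k [::] [::] (rev (query_word C)).
    rewrite /= /inst /= /inst_term /= !cats0 => H.
    by case: H => //; rewrite /oracle_clauses !inE eqxx ?orbT.
  have := A2 S12; case: (A _) => // _.
  have := U [:: fQuery tY tK (cst [::]) tS; fStart 2 tS; fLive 0 tY (cv (unary 0) vK)]
       [:: fScan 0 0 tY (cv (unary 0) vK) (cst (scode (no_state M)))]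
       y k [::] [::] (rev (query_word C)).
  rewrite /= /inst /= /inst_term /= !cats0 => H.
  by case: H => //; rewrite /oracle_clauses !inE eqxx ?orbT.
case: D => D0 DT; rewrite (eqP Cq) in D0; have := DT i.
rewrite /tape_fact; set l := enc _; set r := enc _ => Di.
have := U [:: fScan 0 0 tY tK (cst (scode query)); fLive 0 tY (cv (unary 0) vK);
            fTape 0 (val i) tY tK tL tR]
        [:: fTape 0 (val i) tY (cv (unary 0) vK) tL tR] y k l r [::].
rewrite /= /inst /= /inst_term /= !cats0 => H.
case: H => //; rewrite /oracle_clauses !mem_cat.
by do 3 (apply/orP; right); apply/mapP; exists i; rewrite ?mem_enum.
Qed.

Lemma oracle_live_sound y k C : models E oracle_live -> describes 0 E y k C ->
  is_query C.1 -> E (fLive 0 y k) -> E (fLive 0 y (unary 0 ++ k)).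
Proof.
move=> MO [D0 _] /eqP Cq L; rewrite Cq in D0.
have := @models_use E _ _ _ y k [::] [::] [::] MO (mem_head _ _).
rewrite /= /inst /= /inst_term /= !cats0 => H.
by case: H.
Qed.

Lemma oracle_step_query (A : language) C C' : is_query C.1 -> oracle_step A C C' ->
  C' = (if A (query_word C) then yes_state M else no_state M, C.2).
Proof. by rewrite /oracle_step /is_query => -> /eqP. Qed.

Lemma oracle_step_other (A : language) C C' : ~~ is_query C.1 ->
  oracle_step A C C' = step C C'.
Proof. by rewrite /oracle_step /is_query => /negbTE->. Qed.

End Oracle.

(** * Models of exponential size *)

Section Codes.
Variable G : ntm.
Local Notation K := (extra_tapes G).
Implicit Types (c d : cell (aux G)) (s : seq (cell (aux G))).

Lemma enc_inj : injective (@enc G).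
Proof. by move=> s s' /key_inj; apply: inj_map; apply: rank_inj. Qed.

Lemma ccode_cat_enc c u s : ccode c ++ u = enc s -> exists s', s = c :: s' /\ u = enc s'.
Proof.
case: s => [|d s].
  by move/esym/(congr1 size)/eqP; rewrite size_cat /ccode /unary size_cat addn1.
by rewrite enc_cons => /unary_cat_inj[/rank_inj-> ->]; exists s.
Qed.

Lemma enc_nil s : [::] = enc s -> s = [::].
Proof. by rewrite -[[::]]/(@enc G [::]) => /enc_inj. Qed.

Lemma venc_inj (q q' : state G) s s' : venc q s = venc q' s' -> q = q' /\ s = s'.
Proof.
have E r z : venc r z = key (rcons (map (@rank G) (rev z)) (srank r)).
  by rewrite -cats1 key_cat /venc /scode /key /= cats0.
rewrite !E => /key_inj/eqP; rewrite eqseq_rcons => /andP[/eqP/(inj_map (@rank_inj G))/(can_inj revK)->].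
by move/eqP/srank_inj=> ->.
Qed.

Lemma cells_inj : injective (@cells G).
Proof. by move=> a b ab; apply/ffunP => i; rewrite -nth_cells ab nth_cells. Qed.

Lemma venc_take q s (C : config G) : venc q s = venc C.1 (take K.+1 (cells (scans C))) ->
  q = C.1 /\ s = cells (scans C).
Proof. by rewrite take_oversize ?size_cells // => /venc_inj. Qed.
End Codes.

Section Model.
Variables (G : ntm) (blocked : pred (state G)) (t : nat).
Variables (Y : word -> Prop) (conf : word -> seq nat -> option (config G))
  (live : word -> seq nat -> Prop).
Local Notation K := (extra_tapes G).

(** The intended model of one simulation: [Y] holds for the inputs that are started, [live] for the
    histories that are explored, and [conf] gives the configuration that a history leads to. *)
Definition sim_model (f : fact word) : Prop :=
  match f.1, f.2 with
  | [:: 1; _], [:: y] => Y y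
  | [:: 2; _], [:: y; u; v] =>
      Y y /\ exists y1, y = y1 ++ u /\ v = enc [seq bitc G b | b <- rev y1]
  | [:: 3; _; i], [:: y; k; l; r] => exists p C (j : 'I_K.+1),
      [/\ live y p, conf y p = Some C, k = key p, i = val j &
          l = enc (C.2 j).1.1 /\ r = enc ((C.2 j).1.2 :: (C.2 j).2)]
  | [:: 4; _; j], [:: y; k; s] => exists p C,
      [/\ live y p, conf y p = Some C, k = key p, j <= K.+1 &
          s = venc C.1 (take j (cells (scans C)))]
  | [:: 5; _], [:: y; k] => exists2 p, live y p & k = key p
  | _, _ => False
  end.

Record run_model : Prop := RunModel {
  conf0 : forall y, Y y -> conf y [::] = Some (init G (rev y));
  live0 : forall y, Y y -> live y [::];
  live_start : forall y p, live y p -> Y y;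
  live_conf : forall y p, live y p -> exists C, conf y p = Some C;
  live_behead : forall y n p, live y (n :: p) -> live y p;
  confS : forall y n p C, conf y p = Some C -> ~~ blocked C.1 ->
    conf y (n :: p) = onth (successors C) n
}.
Hypothesis RM : run_model.

Variable E : fact word -> Prop.
Hypothesis EM : forall k h args, 0 < k < 6 ->
  E (k :: t :: h, args) <-> sim_model (k :: t :: h, args).

Lemma E1 y : E ([:: 1; t], [:: y]) <-> Y y.
Proof. exact: EM. Qed.
Lemma E2 y u v : E ([:: 2; t], [:: y; u; v]) <->
  Y y /\ exists y1, y = y1 ++ u /\ v = enc [seq bitc G b | b <- rev y1].
Proof. exact: EM. Qed.
Lemma E3 i y k l r : E ([:: 3; t; i], [:: y; k; l; r]) <-> exists p C (j : 'I_K.+1),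
      [/\ live y p, conf y p = Some C, k = key p, i = val j &
          l = enc (C.2 j).1.1 /\ r = enc ((C.2 j).1.2 :: (C.2 j).2)].
Proof. exact: EM. Qed.
Lemma E4 j y k s : E ([:: 4; t; j], [:: y; k; s]) <-> exists p C,
      [/\ live y p, conf y p = Some C, k = key p, j <= K.+1 &
          s = venc C.1 (take j (cells (scans C)))].
Proof. exact: EM. Qed.
Lemma E5 y k : E ([:: 5; t], [:: y; k]) <-> exists2 p, live y p & k = key p.
Proof. exact: EM. Qed.

Lemma init_tape y i : Y y -> forall l r, 
   l = enc ((init G (rev y)).2 i).1.1 ->
   r = enc (((init G (rev y)).2 i).1.2 :: ((init G (rev y)).2 i).2) ->
   E ([:: 3; t; val i], [:: y; [::]; l; r]).
Proof.
move=> Yy l r lE rE; apply/E3; exists [::], (init G (rev y)), i; split=> //.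
- exact: live0.
- exact: conf0.
Qed.

Lemma start_model : models E (start_clauses G t).
Proof.
move=> c a; rewrite /start_clauses !mem_cat => /orP[|/orP[|/orP[]]].
- rewrite !inE => /or4P[] /eqP-> /=; apply/holdsE => /=;
    rewrite /inst /= /inst_term /= ?cats0 => -[].
  + by move/E1=> Yy _; left; apply/E2; split=> //; exists [::].
  + move/E1=> Yy _; left; apply/E4; exists [::], (init G (rev (a vY))).
    by split=> //; [exact: live0 | exact: conf0 | rewrite take0].
  + by move/E1=> Yy _; left; apply/E5; exists [::] => //; exact: live0.
  + move/E2=> [Yy [y1 [yE /enc_nil yn]]] _; left; rewrite cats0 in yE.
    have y0 : rev (a vY) = [::] by rewrite yE; case: (rev y1) yn.
    by apply: (@init_tape _ ord0) => //; rewrite /init /= ffunE eqxx y0.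
- case/mapP=> i; rewrite mem_filter => /andP[i0 _] ->; apply/holdsE => /=.
  rewrite /inst /= /inst_term /= ?cats0 => -[/E1 Yy _]; left.
  by apply: init_tape => //; rewrite /init /= ffunE (negbTE i0).
- case/mapP=> b _ ->; apply/holdsE => /=.
  rewrite /inst /= /inst_term /= ?cats0 => -[/E2[Yy [y1 [yE vE]]] _]; left.
  apply/E2; split=> //; exists (rcons y1 b); rewrite cat_rcons; split=> //.
  by rewrite rev_rcons vE.
- case/mapP=> b _ ->; apply/holdsE => /=.
  rewrite /inst /= /inst_term /= ?cats0 => -[/E2[Yy [y1 [yE vE]]] _]; left.
  rewrite cats0 in yE; have [w [wE wE']] := ccode_cat_enc vE.
  apply: (@init_tape _ ord0) => //; rewrite /init /= ffunE eqxx yE.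
    by case: (rev y1) wE.
  by rewrite vE; case: (rev y1) wE.
Qed.

(** Premises of a clause that share the variable for the history speak of one configuration. *)
Lemma same_run y p p' C C' : conf y p = Some C -> conf y p' = Some C' ->
  key p = key p' -> p' = p /\ C' = C.
Proof. by move=> cp cp' /key_inj pp; move: cp'; rewrite -pp cp => -[]. Qed.

Lemma scan_model : models E (scan_clauses G t).
Proof.
move=> c a /flatten_mapP[i _ /mapP[d _ ->]]; apply/holdsE => /=.
rewrite /inst /= /inst_term /= ?cats0.
case=> /E4[p [C [Lp cp kE iK sE]]] [/E3[p' [C' [j [Lp' cp' kE' ij [lE rE]]]]] _]; left.
have [pp' CC'] := same_run cp cp' (etrans (esym kE) kE'); rewrite {}CC' in cp' lE rE.
apply/E4; exists p, C; split=> //.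
rewrite take_cells venc_rcons sE; congr (ccode _ ++ _).
have [s' [[dE _] _]] := ccode_cat_enc rE; rewrite -dE /scans ffunE.
have -> : i = j by apply: val_inj.
by case: (C.2 j) => [[]].
Qed.

Lemma slist_enc (st : sstack G) v (a : assignment) s :
    st = pop_case (ohead st.1) -> inst_term a (stack_term st v) = enc s ->
  st = pop_case (ohead s) /\ (if st.2 then a v = enc (behead s) else true).
Proof.
rewrite inst_stack; case: st => [[|c u] b] /=.
  by case=> -> /= h; have -> := enc_nil h.
case=> -> -> /=; rewrite -[enc [:: c]]/(ccode c ++ [::]) cats0.
by move=> /ccode_cat_enc[s' [-> ->]].
Qed.

Lemma run_clauses_model : models E (run_clauses blocked t).
Proof.
move=> c a /all_stepsP[q [sc [nb /flatten_mapP[n _]]]].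
case bE : (onth _ n) => [b|] //.
have main p C : live (a vY) (n :: p) -> conf (a vY) p = Some C -> q = C.1 ->
    cells sc = cells (scans C) ->
    conf (a vY) (n :: p) = Some (b.1, [ffun i => act (b.2 i) (C.2 i)]).
  move=> Lp cp qC /cells_inj sC; rewrite (confS RM _ cp) -?qC //.
  by rewrite onth_successors -qC -sC bE.
rewrite inE => /orP[/eqP->|].
  apply/holdsE => /=; rewrite /inst /= /inst_term /= ?cats0.
  case=> /E5[p' Lp' /unary_cat_key[p [p'E kE]]] [/E4[p1 [C [Lp1 cp1 kE1 _ /venc_take[qC sC]]]] _].
  left; have pE := key_inj (etrans (esym kE) kE1); subst p p'.
  apply/E4; exists (n :: p1), (b.1, [ffun i => act (b.2 i) (C.2 i)]); split=> //.
  - exact: main.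
  - by rewrite kE1 key_cons.
  - by rewrite take0.
case/flatten_mapP=> i _ /flatten_mapP[dl _ /mapP[dr _ ->]].
apply/holdsE; rewrite /premises /conclusions /= /inst.
rewrite [map _ [:: cv _ _; _]]/= [map _ [:: tY; tK; cst _]]/=.
rewrite ![map _ [:: _; _; _; _]]/=.
set L := pop_case dl; set R := pop_case dr.
have -> : inst_term a tY = a vY by rewrite /inst_term /= cats0.
have -> : inst_term a tK = a vK by rewrite /inst_term /= cats0.
have -> : inst_term a (cv (unary n) vK) = unary n ++ a vK by rewrite /inst_term /= cats0.
have -> : inst_term a (cst (venc q (cells sc))) = venc q (cells sc) by rewrite /inst_term /= cats0.
case=> /E5[p' Lp' /unary_cat_key[p [p'E kE]]] [/E4[p1 [C [Lp1 cp1 kE1 _ /venc_take[qC sC]]]]].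
case=> /E3[p2 [C2 [j [Lp2 cp2 kE2 ij [lE rE]]]]] _; left.
have pE := key_inj (etrans (esym kE) kE1); subst p p'.
have [p2E C2E] := same_run cp1 cp2 (etrans (esym kE1) kE2); subst p2 C2.
have {}ij : i = j by apply: val_inj.
subst j.
apply/E3; exists (n :: p1), (b.1, [ffun i => act (b.2 i) (C.2 i)]), i; split=> //.
- exact: main.
- by rewrite kE1 key_cons.
have [lc rv] : L = pop_case (ohead (C.2 i).1.1) /\
    (if L.2 then a vL = enc (behead (C.2 i).1.1) else true).
  by apply: slist_enc lE; rewrite /L; case: (dl).
move: rE; rewrite inst_stack /= enc_cons -catA => /ccode_cat_enc[s' [[cE sE] rE]].
rewrite -{s'}sE in rE.
have [rc rv'] : R = pop_case (ohead (C.2 i).2) /\ (if R.2 then a vR = enc (behead (C.2 i).2) else true).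
  by apply: (@slist_enc _ vR a); [rewrite /R; case: (dr) | rewrite inst_stack].
rewrite /= ffunE; move: cE lc rv rc rv'; case: (C.2 i) => [[l x] r] /= cE lc rv rc rv'.
have [TL TR] := sact_correct (b.2 i) l r x.
rewrite /= -lc -rc in TL TR.
have st_enc (st : sstack G) v s : (if st.2 then a v = enc s else true) ->
    inst_term a (stack_term st v) = enc (slist st s).
  by rewrite inst_stack /slist enc_cat; case: st.2 => // ->.
have L2 : (sact_left (b.2 i) L R).2 = L.2 by rewrite /sact_left; case: (b.2 i).2.
have R2 : (sact_right (b.2 i) L R).2 = R.2 by rewrite /sact_right; case: (b.2 i).2.
rewrite (st_enc _ _ (behead l)) ?L2 // (st_enc _ _ (behead r)) ?R2 // -TL -TR.
by case: (b.2 i) => y []; case: (l); case: (r).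
Qed.

Lemma sim_theory_model : models E (sim_theory blocked t).
Proof.
by apply/models_cat; split; [exact: start_model | apply/models_cat; split;
  [exact: scan_model | exact: run_clauses_model]].
Qed.

Lemma exists_model :
    (forall y p C, live y p -> conf y p = Some C -> ~~ blocked C.1 -> ~~ accepting C.1 ->
       exists n, live y (n :: p)) ->
  models E (exists_clauses blocked t).
Proof.
move=> HX c a /all_stepsP[q [sc [nb]]]; case: ifP => // /negbT na; rewrite inE => /eqP->.
apply/holdsE; rewrite /premises /= /inst /= /inst_term /= ?cats0.
case=> /E5[p Lp kE] [/E4[p1 [C [Lp1 cp1 kE1 _ /venc_take[qC /cells_inj sC]]]] _].
have pE := key_inj (etrans (esym kE) kE1); subst p1.
rewrite qC in nb na; have [n Ln] := HX _ _ _ Lp cp1 nb na.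
have [C' CE] := live_conf RM Ln; rewrite (confS RM _ cp1 nb) onth_successors in CE.
apply/conclusionsP; exists (fLive t tY (cv (unary n) vK)).
  apply/mapP; exists n => //; rewrite mem_iota /= -onthTE qC sC.
  by case: onth CE.
by rewrite /inst /= /inst_term /= !cats0; apply/E5; exists (n :: p); rewrite // kE key_cons.
Qed.

Lemma forall_model :
    (forall y p C n, live y p -> conf y p = Some C -> ~~ blocked C.1 ->
       n < size (successors C) -> live y (n :: p)) ->
    (forall y p C, live y p -> conf y p = Some C -> ~~ accepting C.1) ->
  models E (forall_clauses blocked t).
Proof.
move=> HA Hac c a; rewrite mem_cat => /orP[].
  case/all_stepsP=> q [sc [nb /mapP[n nsz ->]]].
  apply/holdsE; rewrite /premises /= /inst /= /inst_term /= ?cats0.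
  case=> /E5[p Lp kE] [/E4[p1 [C [Lp1 cp1 kE1 _ /venc_take[qC /cells_inj sC]]]] _].
  have pE := key_inj (etrans (esym kE) kE1); subst p1; left.
  apply/E5; exists (n :: p); last by rewrite kE key_cons.
  apply: HA cp1 _ _ => //; first by rewrite -qC.
  by rewrite /successors size_map -qC -/(scans C) -sC; rewrite mem_iota in nsz.
case/mapP=> q; rewrite mem_filter => /andP[ac _] ->.
apply/holdsE; rewrite /premises /= /inst /= /inst_term /= ?cats0.
case=> /E5[p Lp kE] [/E4[p1 [C [Lp1 cp1 kE1 _ sE]]] _].
have pE := key_inj (etrans (esym kE) kE1); subst p1.
have [] := negP (Hac _ _ _ Lp cp1).
suff -> : C.1 = q by [].
by move: sE; rewrite take0 -[scode q]/(venc q [::]) => /venc_inj[->].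
Qed.

End Model.

Section Conf.
Variables (G : ntm) (blocked : pred (state G)) (succs : config G -> seq (config G)).
Hypothesis succsE : forall C, ~~ blocked C.1 -> succs C = successors C.

Definition succ_rel : rel (config G) := fun C C' => C' \in succs C.

(* [p] lists the numbers of the chosen successors, the last choice first, and
   [y] is the reversed input. *)
Fixpoint conf_of (y : word) (p : seq nat) : option (config G) :=
  if p is n :: p' then obind (fun C => onth (succs C) n) (conf_of y p')
  else Some (init G (rev y)).

Lemma conf_of_path y p C : conf_of y p = Some C -> exists q,
  [/\ path succ_rel (init G (rev y)) q, last (init G (rev y)) q = C & size q = size p].
Proof.
elim: p C => [|n p IH] C /=; first by case=> <-; exists [::].
case pE : (conf_of y p) => [C'|] //= nE; have [q [qp qC qs]] := IH _ pE.
exists (rcons q C); rewrite last_rcons size_rcons qs; split=> //.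
by rewrite rcons_path qp qC; apply: mem_onth nE.
Qed.

Lemma path_conf_of y q : path succ_rel (init G (rev y)) q -> exists p,
  conf_of y p = Some (last (init G (rev y)) q) /\ size p = size q.
Proof.
elim/last_ind: q => [|q C IH]; first by exists [::].
rewrite rcons_path last_rcons => /andP[/IH[p [pE ps]] /onth_mem[n nE]].
by exists (n :: p); rewrite /= pE size_rcons ps.
Qed.

Variable Y : word -> Prop.

Section Exists.
Variable chosen : word -> seq nat.
Hypothesis chosenP : forall y, Y y -> exists2 C, conf_of y (chosen y) = Some C & accepting C.1.

(** As the last choice stands first, the suffixes of a history are the moments of a single run. *)
Definition live_ex (y : word) (p : seq nat) : Prop := Y y /\ suffix p (chosen y).

Lemma suffix_behead (T : eqType) (x : T) p q : suffix (x :: p) q -> suffix p q.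
Proof.
by case/suffixP=> s ->; apply/suffixP; exists (rcons s x); rewrite cat_rcons.
Qed.

Lemma conf_of_suffix y p q C : conf_of y q = Some C -> suffix p q ->
  exists C', conf_of y p = Some C'.
Proof.
move=> qE /suffixP[s sE]; move: qE; rewrite sE.
elim: s C {sE} => [|n s IH] C /=; first by exists C.
by case sE : (conf_of y (s ++ p)) => [C'|] // _; apply: IH sE.
Qed.

Lemma run_model_ex : run_model blocked Y conf_of live_ex.
Proof.
split=> //.
- by move=> y Yy; split=> //; apply: suffix0s.
- by move=> y p [].
- by move=> y p [Yy sp]; have [C cE _] := chosenP Yy; apply: conf_of_suffix cE sp.
- by move=> y n p [Yy sp]; split=> //; apply: suffix_behead sp.
- by move=> y n p C pE nb; rewrite /= pE /= succsE.
Qed.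

Lemma live_ex_next y p C : live_ex y p -> conf_of y p = Some C -> ~~ accepting C.1 ->
  exists n, live_ex y (n :: p).
Proof.
move=> [Yy /suffixP[s sE]] pE na; case/lastP: s sE => [|s n] sE.
  have [C' cE ac] := chosenP Yy; move: cE; rewrite sE cat0s pE => -[CE].
  by move: na; rewrite CE ac.
by exists n; split=> //; apply/suffixP; exists s; rewrite sE cat_rcons.
Qed.
End Exists.

Definition live_all (y : word) (p : seq nat) : Prop := Y y /\ conf_of y p <> None.

Lemma run_model_all : run_model blocked Y conf_of live_all.
Proof.
split=> //.
- by move=> y p [].
- by move=> y p []; case: conf_of => // C _ _; exists C.
- by move=> y n p [Yy /=]; case pE : (conf_of y p) => [C|] // _; split=> //; rewrite pE.
- by move=> y n p C pE nb; rewrite /= pE /= succsE.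
Qed.

Lemma live_all_next y p C n : live_all y p -> conf_of y p = Some C ->
  n < size (succs C) -> live_all y (n :: p).
Proof. by move=> [Yy _] pE; rewrite /live_all /= pE /= -onthTE; case: onth. Qed.
End Conf.

Section OracleModel.
Variables (M : ontm) (A : language).
Local Notation K := (extra_tapes M).
Local Notation query := (query_state M).

(** The answer is the only successor in the query state and hence has number 0, in agreement with
    the clauses. *)
Definition oracle_succs (C : config M) : seq (config M) :=
  if C.1 == query then [:: (if A (query_word C) then yes_state M else no_state M, C.2)]
  else successors C.

Lemma oracle_succsE C : ~~ is_query C.1 -> oracle_succs C = successors C.
Proof. by rewrite /oracle_succs /is_query => /negbTE->. Qed.

Lemma oracle_succ_rel : succ_rel oracle_succs = oracle_step A (M := M).
Proof.
apply: funext => C; apply: funext => C'; rewrite /succ_rel /oracle_succs /oracle_step.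
by case: ifP => _ //; rewrite inE.
Qed.

Variables (Y Y1 Y2 : word -> Prop) (live : word -> seq nat -> Prop).
Local Notation conf := (conf_of oracle_succs).
Hypothesis RM : run_model (@is_query M) Y conf live.
Hypothesis Y1A : forall w, Y1 (rev w) -> A w.
Hypothesis Y2A : forall w, Y2 (rev w) -> ~ A w.
Hypothesis Yquery : forall y p C, live y p -> conf y p = Some C -> is_query C.1 ->
  (A (query_word C) -> Y1 (rev (query_word C))) /\
  (~ A (query_word C) -> Y2 (rev (query_word C))).

Definition query_tape_word (T : tape (aux M)) : seq (cell (aux M)) :=
  rev T.1.1 ++ T.1.2 :: T.2.

Definition word_bits : seq (cell (aux M)) -> word :=
  pmap (fun d : cell (aux M) => if d is Some (inl b) then Some b else None).

Lemma query_wordE C : query_word C = word_bits (query_tape_word (C.2 (query_tape M))).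
Proof. by rewrite /query_word; case: (C.2 _) => [[l c] r]. Qed.

Definition oracle_model (f : fact word) : Prop :=
  match f.1, f.2 with
  | [:: 6], [:: y; k; l; r] => exists p C l1 l2,
      [/\ live y p, conf y p = Some C, k = key p, is_query C.1 &
        let T := C.2 (query_tape M) in
        [/\ T.1.1 = l1 ++ l2, l = enc l2 & r = enc (rev l1 ++ T.1.2 :: T.2)]]
  | [:: 7], [:: y; k; r; w] => exists p C w1 w2,
      [/\ live y p, conf y p = Some C, k = key p, is_query C.1 &
        [/\ query_tape_word (C.2 (query_tape M)) = w1 ++ w2, r = enc w2 &
            w = rev (word_bits w1)]]
  | _, _ => False
  end.

Variable E : fact word -> Prop.
Hypothesis EM : forall k h args, 0 < k < 6 ->
  E (k :: 0 :: h, args) <-> sim_model Y conf live (k :: 0 :: h, args).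
Hypothesis EO : forall k args, 6 <= k <= 7 -> E ([:: k], args) <-> oracle_model ([:: k], args).
Hypothesis ES1 : forall y, E (fStart 1 y) <-> Y1 y.
Hypothesis ES2 : forall y, E (fStart 2 y) <-> Y2 y.

Let E3' := E3 EM.
Let E4' := E4 EM.
Let E5' := E5 EM.

Lemma E6 y k l r : E ([:: 6], [:: y; k; l; r]) <-> exists p C l1 l2,
      [/\ live y p, conf y p = Some C, k = key p, is_query C.1 &
        let T := C.2 (query_tape M) in
        [/\ T.1.1 = l1 ++ l2, l = enc l2 & r = enc (rev l1 ++ T.1.2 :: T.2)]].
Proof. exact: EO. Qed.

Lemma E7 y k r w : E ([:: 7], [:: y; k; r; w]) <-> exists p C w1 w2,
      [/\ live y p, conf y p = Some C, k = key p, is_query C.1 &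
        [/\ query_tape_word (C.2 (query_tape M)) = w1 ++ w2, r = enc w2 &
            w = rev (word_bits w1)]].
Proof. exact: EO. Qed.

Lemma oracle_clauses_model : models E (oracle_clauses M).
Proof.
have simp := (cats0, @inst_stack).
have tE a v c : inst_term a (cv c v) = c ++ a v by rewrite /inst_term /= cats0.
have cE a c : inst_term a (cst c) = c by rewrite /inst_term /= cats0.
have tapeE (i : 'I_K.+1) y k l r p C : conf y p = Some C -> live y p -> k = key p ->
    E ([:: 3; 0; val i], [:: y; k; l; r]) ->
    l = enc (C.2 i).1.1 /\ r = enc ((C.2 i).1.2 :: (C.2 i).2).
  move=> cp Lp -> /E3'[p' [C' [j [Lp' cp' kE /val_inj <- [-> ->]]]]].
  by have [_ ->] := same_run cp cp' kE.
have queryE y k : E ([:: 4; 0; 0], [:: y; k; scode query]) ->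
    exists p C, [/\ live y p, conf y p = Some C, k = key p & is_query C.1].
  move=> /E4'[p [C [Lp cp -> _ qE]]]; exists p, C; split=> //.
  by move: qE; rewrite take0 -[scode query]/(venc query [::]) => /venc_inj[<- _]; exact: eqxx.
have finE y k w : E ([:: 7], [:: y; k; [::]; w]) -> exists p C,
    [/\ live y p, conf y p = Some C, k = key p, is_query C.1 & w = rev (query_word C)].
  move=> /E7[p [C [w1 [w2 [Lp cp -> Cq [wE /enc_nil w20 ->]]]]]]; exists p, C; split=> //.
  by rewrite query_wordE wE w20 cats0.
have answE y k w q b : (forall w', w = rev w' -> A w' = b) ->
    q = (if b then yes_state M else no_state M) ->
    E ([:: 7], [:: y; k; [::]; w]) -> E ([:: 5; 0], [:: y; unary 0 ++ k]) ->
    E ([:: 4; 0; 0], [:: y; unary 0 ++ k; scode q]).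
  move=> Ab -> /finE[p [C [Lp cp -> Cq wE]]] /E5'[p' Lp' /unary_cat_key[p1 [p'E /key_inj pE]]].
  subst p1 p'; apply/E4'; exists (0 :: p).
  exists ((if A (query_word C) then yes_state M else no_state M), C.2); split=> //.
    by rewrite /= cp /= /oracle_succs; rewrite /is_query in Cq; rewrite Cq.
  by rewrite take0 (Ab _ wE).
move=> c a; rewrite /oracle_clauses !mem_cat => /orP[|/orP[|/orP[]]].
- rewrite !inE => /or4P[| | |/orP[]] /eqP-> /=; apply/holdsE => /=; rewrite /inst /= !(tE, cE) /=.
  + case=> /queryE[p [C [Lp cp kE Cq]]] [/(tapeE _ _ _ _ _ _ _ cp Lp kE)[lE rE] _].
    left; apply/E6; exists p, C, [::], (C.2 (query_tape M)).1.1; split=> //.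
  + case=> /E6[p [C [l1 [l2 [Lp cp kE Cq [lE /enc_nil l20 rE]]]]]] _; left.
    apply/E7; exists p, C, [::], (query_tape_word (C.2 (query_tape M))); split=> //; split=> //.
    by rewrite rE /query_tape_word lE l20 cats0.
  + case=> /finE[p [C [Lp cp kE Cq ->]]] _; have [H1 H2] := Yquery Lp cp Cq.
    have [Aw|nA] := boolP (A (query_word C)); first by left; apply/ES1/H1.
    by right; left; apply/ES2/H2/negP.
  + case=> Q [/ES1 S1 [L _]]; left; apply: (answE _ _ _ _ true) Q L => // w wE.
    by apply: Y1A; rewrite -wE.
  + case=> Q [/ES2 S2 [L _]]; left; apply: (answE _ _ _ _ false) Q L => // w wE.
    by apply/negbTE/negP; apply: Y2A; rewrite -wE.
- case/mapP=> d _ ->; apply/holdsE => /=; rewrite /inst /= !(tE, cE) /=.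
  case=> /E6[p [C [l1 [l2 [Lp cp kE Cq [lE dE rE]]]]]] _; left.
  have [l3 [l2E l3E]] := ccode_cat_enc dE; apply/E6.
  exists p, C, (rcons l1 d), l3; split=> //; split=> //; first by rewrite lE l2E cat_rcons.
  by rewrite rev_rcons rE.
- case/mapP=> d _ ->; apply/holdsE => /=; rewrite /inst /= !(tE, cE) /=.
  case=> /E7[p [C [w1 [w2 [Lp cp kE Cq [wE dE sE]]]]]] _; left.
  have [w3 [w2E w3E]] := ccode_cat_enc dE; apply/E7.
  exists p, C, (rcons w1 d), w3; split=> //; split=> //; first by rewrite wE w2E cat_rcons.
  by rewrite sE /word_bits -cats1 pmap_cat rev_cat /=; case: (d) => [[b|g]|].
- case/mapP=> i _ ->; apply/holdsE => /=; rewrite /inst /= !(tE, cE) /=.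
  rewrite -[false :: a vK]/(unary 0 ++ a vK).
  case=> /queryE[p [C [Lp cp kE Cq]]] [/E5'[p' Lp' /unary_cat_key[p1 [p'E kE1]]]].
  have pE := key_inj (etrans (esym kE) kE1); subst p1 p'.
  case=> /(tapeE _ _ _ _ _ _ _ cp Lp kE)[lE rE] _; left.
  apply/E3'; exists (0 :: p).
  exists ((if A (query_word C) then yes_state M else no_state M), C.2), i; split=> //.
    by rewrite /= cp /= /oracle_succs; rewrite /is_query in Cq; rewrite Cq.
  by rewrite kE key_cons.
Qed.

Lemma oracle_live_model :
    (forall y p C, live y p -> conf y p = Some C -> is_query C.1 -> live y (0 :: p)) ->
  models E (oracle_live M).
Proof.
move=> H c a; rewrite inE => /eqP->; apply/holdsE => /=.
rewrite /inst /= /inst_term /= ?cats0 => -[/E5'[p Lp kE] [/E4'[p1 [C [Lp1 cp1 kE1 _ qE]]] _]].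
left; apply/E5'; exists (0 :: p1); last by rewrite kE1 key_cons.
apply: H cp1 _ => //.
by move: qE; rewrite take0 -[scode query]/(venc query [::]) => /venc_inj[<- _]; exact: eqxx.
Qed.

End OracleModel.

(** * Counting the facts of the intended models *)

Local Arguments key : simpl never.

Definition fits (L : nat) (f : fact word) : bool :=
  all (fun a => size a <= L) (key f.1 :: f.2) && (size f.2 <= 4).

Lemma size_flatten_le (T : eqType) (U : Type) (f : T -> seq U) (s : seq T) b :
  (forall x, x \in s -> size (f x) <= b) -> size (flatten (map f s)) <= size s * b.
Proof.
elim: s => //= x s IH H; rewrite size_cat mulSn leq_add //.
  by apply: H; rewrite inE eqxx.
by apply: IH => y ys; apply: H; rewrite inE ys orbT.
Qed.

Lemma size_body L f : fits L f -> size (body f) <= 5 * L.+1.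
Proof.
case/andP=> /allP sL s4; rewrite /body.
apply: (@leq_trans ((size f.2).+1 * L.+1)); last by rewrite leq_mul2r ltnS s4 orbT.
apply: (@size_flatten_le _ _ _ (key f.1 :: f.2)) => a af.
by rewrite size_cat size_map addn1 ltnS sL.
Qed.

(** A fact consists of at most five words, its name included, each followed by [Hash]; one more unit
    pays for [Dollar]. *)
Lemma size_facts_word L fs : (forall f, f \in fs -> fits L f) ->
  size (facts_word fs) <= size fs * (6 * L.+1).
Proof.
move=> H; apply: size_flatten_le => f ffs /=.
by apply: (leq_ltn_trans (size_body (H _ ffs))); lia.
Qed.

Lemma fitsW L L' f : L <= L' -> fits L f -> fits L' f.
Proof.
move=> LL /andP[sL s4]; rewrite /fits s4 andbT; apply: sub_all sL => a.
by move/leq_trans; apply.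
Qed.

Lemma size_unary n : size (unary n) = n.+1.
Proof. by rewrite /unary size_cat size_nseq addn1. Qed.

Lemma size_key_cons n p : size (key (n :: p)) = n.+1 + size (key p).
Proof. by rewrite key_cons size_cat size_unary. Qed.

Lemma size_key D p : all (fun n => n < D) p -> size (key p) <= size p * D.
Proof.
elim: p => //= n p IH /andP[nD /IH h].
by rewrite key_cons size_cat size_unary mulSn leq_add.
Qed.

Section Sizes.
Variable G : ntm.
Local Notation K := (extra_tapes G).
Local Notation cellT := (option (bool + aux G)).

Lemma size_enc s : size (@enc G s) <= size s * #|{: cellT}|.
Proof.
rewrite /enc; apply: leq_trans (size_key (D := #|{: cellT}|) _) _; last by rewrite size_map.
by rewrite all_map; apply/allP => c _ /=; rewrite /rank.
Qed.

Lemma size_scode q : size (@scode G q) <= #|state G|.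
Proof. by rewrite /scode size_unary /srank. Qed.

Lemma size_venc q s : size (@venc G q s) <= size s * #|{: cellT}| + #|state G|.
Proof.
rewrite /venc size_cat leq_add ?size_scode //.
by have := size_enc (rev s); rewrite size_rev /enc.
Qed.

End Sizes.

Section Covers.
Variables (G : ntm) (blocked : pred (state G)) (t : nat).
Variables (succs : config G -> seq (config G)) (D : nat).
Local Notation K := (extra_tapes G).
Local Notation cellT := (option (bool + aux G)).
Hypothesis succs_branch : forall C, size (succs C) <= D.
Hypothesis succs_size : forall C C' i, C' \in succs C ->
  size (C'.2 i).1.1 + size (C'.2 i).2 <= (size (C.2 i).1.1 + size (C.2 i).2).+1.

Lemma conf_of_size y p C i : conf_of succs y p = Some C ->
  size (C.2 i).1.1 + size (C.2 i).2 <= size y + size p.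
Proof.
elim: p C => [|n p IH] C /=.
  case=> <- /=; rewrite ffunE addn0; case: (i == ord0) => //=.
  by rewrite /input_tape /= size_behead size_map size_rev leq_pred.
case pE : (conf_of succs y p) => [C'|] //= /mem_onth nE.
by apply: (leq_trans (succs_size i nE)); rewrite addnS ltnS IH.
Qed.

Lemma conf_of_branch y p C : conf_of succs y p = Some C -> all (fun n => n < D) p.
Proof.
elim: p C => //= n p IH C; case pE : (conf_of succs y p) => [C'|] //= nE.
rewrite (IH C') // andbT; apply: leq_trans (succs_branch C').
by rewrite -onthTE nE.
Qed.

(** A factor depending on the machine only: multiplied by the input length plus the number of steps,
    it bounds every argument, since symbols, states and choices are coded in unary. *)
Definition sim_width : nat :=
  #|{: cellT}| + D + (K.+1 * #|{: cellT}| + #|state G|) + (t + K + 20).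

Variables (Y : word -> Prop) (live : word -> seq nat -> Prop).
Hypothesis RM : run_model blocked Y (conf_of succs) live.
Variables (Ys : seq word) (Ps : word -> seq (seq nat)) (m T b : nat).
Hypothesis YsP : forall y, Y y -> y \in Ys /\ size y <= m.
Hypothesis PsP : forall y p, live y p -> p \in Ps y /\ size p <= T.
Hypothesis Psb : forall y, y \in Ys -> size (Ps y) <= b.

Definition conf_facts y p (C : config G) : seq (fact word) :=
  [seq fTape t (val i) y (key p) (enc (C.2 i).1.1) (enc ((C.2 i).1.2 :: (C.2 i).2))
     | i <- enum 'I_K.+1] ++
  [seq fScan t j y (key p) (venc C.1 (take j (cells (scans C)))) | j <- iota 0 K.+2] ++
  [:: fLive t y (key p)].

(** A list that contains all facts of the model with tag [t] and is easy to count;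
    [model_satisfiable] filters out the rest. *)
Definition sim_cover : seq (fact word) :=
  [seq fStart t y | y <- Ys] ++
  flatten [seq [seq fConv t y (drop j y) (enc [seq bitc G b | b <- rev (take j y)])
                  | j <- iota 0 m.+1] | y <- Ys] ++
  flatten [seq flatten [seq oapp (conf_facts y p) [::] (conf_of succs y p) | p <- Ps y]
             | y <- Ys].

Lemma size_sim_cover : size sim_cover <= size Ys * (m + b * (2 * K + 4) + 2).
Proof.
rewrite /sim_cover !size_cat size_map.
have h1 : size (flatten [seq [seq fConv t y (drop j y) (enc [seq bitc G b | b <- rev (take j y)])
                  | j <- iota 0 m.+1] | y <- Ys]) <= size Ys * m.+1.
  by apply: size_flatten_le => y _; rewrite size_map size_iota.
have h2 : size (flatten [seq flatten [seq oapp (conf_facts y p) [::] (conf_of succs y p) | p <- Ps y]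
             | y <- Ys]) <= size Ys * (b * (2 * K + 4)).
  apply: size_flatten_le => y yYs; apply: (@leq_trans (size (Ps y) * (2 * K + 4))).
    apply: size_flatten_le => p _; case: conf_of => //= C.
    by rewrite /conf_facts !size_cat size_map size_enum_ord size_map size_iota /=; lia.
  by rewrite leq_mul2r Psb ?orbT.
by move: h1 h2; move: (size (flatten _)) (size (flatten _)) => u v; nia.
Qed.

Lemma live_cover y p C f : live y p -> conf_of succs y p = Some C ->
  f \in conf_facts y p C -> f \in sim_cover.
Proof.
move=> Lp cp fin; rewrite /sim_cover !mem_cat; apply/orP; right; apply/orP; right.
apply/flatten_mapP; exists y; first by have [] := YsP (live_start RM Lp).
by apply/flatten_mapP; exists p; [have [] := PsP Lp | rewrite cp].
Qed.

Lemma sim_model_cover k h args : sim_model Y (conf_of succs) live (k :: t :: h, args) ->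
  (k :: t :: h, args) \in sim_cover /\ fits (sim_width * (m + T + 1)) (k :: t :: h, args).
Proof.
set L := sim_width * _.
have Lge w : w <= m + T + 1 -> w <= L.
  by move=> h1; apply: (leq_trans h1); rewrite /L leq_pmull // /sim_width; lia.
have LgeM w c : c <= sim_width -> w <= (m + T + 1) * c -> w <= L.
  by move=> h1 h2; apply: (leq_trans h2); rewrite mulnC /L leq_mul2r h1 orbT.
have c1 : #|{: cellT}| <= sim_width by rewrite /sim_width; lia.
have Lenc (s : seq (cell (aux G))) : size s <= m + T + 1 -> size (enc s) <= L.
  move=> h1; apply: LgeM c1 _; apply: (leq_trans (size_enc s)).
  by rewrite leq_mul2r h1 orbT.
have Ly y : Y y -> size y <= L.
  by move=> /YsP[_ ym]; apply: Lge; lia.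
have Lk y p : live y p -> size (key p) <= L.
  move=> Lp; have [C cp] := live_conf RM Lp; have [_ pT] := PsP Lp.
  apply: (LgeM _ D); first by rewrite /sim_width; lia.
  apply: (leq_trans (size_key (conf_of_branch cp))).
  by rewrite leq_mul2r; apply/orP; right; lia.
have Lh n j : n <= 5 -> j <= K.+1 -> size (key [:: n; t; j]) <= L.
  move=> n5 jK; apply: (LgeM _ sim_width) => //; rewrite !size_key_cons [size (key [::])]/=.
  by rewrite /sim_width; nia.
have Lh' n : n <= 5 -> size (key [:: n; t]) <= L.
  move=> n5; apply: (LgeM _ sim_width) => //; rewrite !size_key_cons [size (key [::])]/=.
  by rewrite /sim_width; nia.
have Lf (f : fact word) : size (key f.1) <= L -> all (fun a => size a <= L) f.2 ->
    size f.2 <= 4 -> fits L f by rewrite /fits /= => -> -> ->.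
case: k => [|[|[|[|[|[|k]]]]]] //.
- case: h => //; case: args => [|y []] // Yy; split.
    by rewrite mem_cat; apply/orP; left; apply/mapP; exists y => //; have [] := YsP Yy.
  by apply: Lf => //; [exact: Lh' | rewrite /= Ly].
- case: h => //; case: args => [|y [|u [|v []]]] // [Yy [y1 [yE vE]]].
  have [yYs ym] := YsP Yy.
  have y1m : size y1 <= m by apply: leq_trans ym; rewrite yE size_cat leq_addr.
  split.
    rewrite /sim_cover !mem_cat; apply/orP; right; apply/orP; left.
    apply/flatten_mapP; exists y => //; apply/mapP; exists (size y1).
      by rewrite mem_iota ltnS.
    by rewrite vE yE drop_size_cat // take_size_cat.
  apply: Lf => //; first exact: Lh'.
  rewrite /= Ly //= vE Lenc ?andbT; last by rewrite size_map size_rev; lia.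
  by apply: leq_trans (Ly _ Yy); rewrite yE size_cat leq_addl.
- case: h => [|i []] //; case: args => [|y [|k [|l [|r []]]]] //.
  case=> p [C [j [Lp cp -> -> [-> ->]]]]; split.
    apply: (live_cover Lp cp); rewrite mem_cat; apply/orP; left.
    by apply/mapP; exists j; rewrite ?mem_enum.
  have [_ pT] := PsP Lp; have Yy := live_start RM Lp; have [_ ym] := YsP Yy.
  have sz := conf_of_size j cp.
  apply: Lf => //; first exact: (Lh 3 j isT (ltnW (ltn_ord j))).
  by rewrite /= Ly //= (Lk _ _ Lp) /= !Lenc //=; lia.
- case: h => [|j []] //; case: args => [|y [|k [|s []]]] //.
  case=> p [C [Lp cp -> jK ->]]; split.
    apply: (live_cover Lp cp); rewrite !mem_cat; apply/orP; right; apply/orP; left.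
    by apply/mapP; exists j; rewrite // mem_iota ltnS.
  have Yy := live_start RM Lp.
  apply: Lf => //; first exact: Lh.
  rewrite /= Ly //= (Lk _ _ Lp) /= andbT.
  apply: (LgeM _ (K.+1 * #|{: cellT}| + #|state G|)); first by rewrite /sim_width; lia.
  apply: leq_trans (size_venc _ _) _.
  have h1 : size (take j (cells (scans C))) * #|{: cellT}| <= K.+1 * #|{: cellT}|.
    by rewrite leq_mul2r; apply/orP; right; rewrite size_take size_cells; case: ltnP.
  by rewrite mulnDl mul1n; apply: leq_trans (leq_addl _ _); rewrite leq_add2r.
- case: h => //; case: args => [|y [|k []]] // [p Lp ->]; split.
    have [C cp] := live_conf RM Lp.
    by apply: (live_cover Lp cp); rewrite !mem_cat !inE eqxx !orbT.
  apply: Lf => //; first exact: Lh'.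
  by rewrite /= (Lk _ _ Lp) (Ly _ (live_start RM Lp)).
Qed.

End Covers.

Definition branch (G : ntm) : nat :=
  (\max_(q : state G) \max_(a : {ffun 'I_(extra_tapes G).+1 -> option (bool + aux G)})
     size (@trans G q a)).+1.

Lemma successors_branch (G : ntm) (C : config G) : size (successors C) <= branch G.
Proof.
rewrite /successors size_map; apply: leqW.
pose a : {ffun 'I_(extra_tapes G).+1 -> option (bool + aux G)} := [ffun i => scanned (C.2 i)].
apply: leq_trans (leq_bigmax C.1).
exact: (leq_bigmax (F := fun a => size (@trans G C.1 a)) a).
Qed.

Lemma act_size (G : finType) a (T : tape G) :
  size (act a T).1.1 + size (act a T).2 <= (size T.1.1 + size T.2).+1.
Proof.
case: T => [[l c] r]; case: a => x [] /=; rewrite ?size_behead; lia.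
Qed.

Lemma successors_size (G : ntm) (C C' : config G) i : C' \in successors C ->
  size (C'.2 i).1.1 + size (C'.2 i).2 <= (size (C.2 i).1.1 + size (C.2 i).2).+1.
Proof. by case/In_map=> b _ -> /=; rewrite ffunE act_size. Qed.

Lemma oracle_succs_branch (M : ontm) A (C : config M) : size (oracle_succs A C) <= branch M.
Proof. by rewrite /oracle_succs; case: ifP => _ //; apply: successors_branch. Qed.

Lemma oracle_succs_size (M : ontm) A (C C' : config M) i : C' \in oracle_succs A C ->
  size (C'.2 i).1.1 + size (C'.2 i).2 <= (size (C.2 i).1.1 + size (C.2 i).2).+1.
Proof.
rewrite /oracle_succs; case: ifP => _; last exact: successors_size.
by rewrite inE => /eqP-> /=; apply: leqnSn.
Qed.

Section OracleCover.
Variables (M : ontm) (A : language).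
Local Notation K := (extra_tapes M).
Local Notation cellT := (option (bool + aux M)).
Local Notation conf := (conf_of (oracle_succs A (M := M))).
Variables (Y : word -> Prop) (live : word -> seq nat -> Prop).
Hypothesis RM : run_model (@is_query M) Y conf live.
Variables (Ys : seq word) (Ps : word -> seq (seq nat)) (m T b : nat).
Hypothesis YsP : forall y, Y y -> y \in Ys /\ size y <= m.
Hypothesis PsP : forall y p, live y p -> p \in Ps y /\ size p <= T.
Hypothesis Psb : forall y, y \in Ys -> size (Ps y) <= b.

(** After at most [T] steps on an input of length at most [m] a tape stores at most [m + T + 1]
    cells, hence there are at most [m + T + 2] positions at which to cut it. *)
Definition query_facts y p (C : config M) : seq (fact word) :=
  let X := C.2 (query_tape M) in
  [seq fRewind y (key p) (enc (drop j X.1.1)) (enc (rev (take j X.1.1) ++ X.1.2 :: X.2))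
     | j <- iota 0 (m + T + 2)] ++
  [seq fQuery y (key p) (enc (drop j (query_tape_word X))) (rev (word_bits (take j (query_tape_word X))))
     | j <- iota 0 (m + T + 2)].

Definition oracle_cover : seq (fact word) :=
  flatten [seq flatten [seq oapp (query_facts y p) [::] (conf y p) | p <- Ps y] | y <- Ys].

Lemma size_oracle_cover : size oracle_cover <= size Ys * (b * (2 * (m + T + 2))).
Proof.
apply: size_flatten_le => y yYs; apply: (@leq_trans (size (Ps y) * (2 * (m + T + 2)))).
  apply: size_flatten_le => p _; case: conf => //= C.
  by rewrite /query_facts size_cat !size_map size_iota addnn mul2n.
by rewrite leq_mul2r Psb ?orbT.
Qed.

Lemma query_cover y p C f : live y p -> conf y p = Some C ->
  f \in query_facts y p C -> f \in oracle_cover.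
Proof.
move=> Lp cp fin; apply/flatten_mapP; exists y; first by have [] := YsP (live_start RM Lp).
by apply/flatten_mapP; exists p; [have [] := PsP Lp | rewrite cp].
Qed.

Lemma size_word_bits s : size (@word_bits M s) <= size s.
Proof. by rewrite /word_bits size_pmap count_size. Qed.

Lemma oracle_model_cover k args : @oracle_model M A live ([:: k], args) ->
  ([:: k], args) \in oracle_cover /\
  fits (sim_width M 0 (branch M) * (m + T + 1)) ([:: k], args).
Proof.
set L := sim_width _ _ _ * _.
have Lge w : w <= m + T + 1 -> w <= L.
  by move=> h1; apply: (leq_trans h1); rewrite /L leq_pmull // /sim_width; lia.
have LgeM w c : c <= sim_width M 0 (branch M) -> w <= (m + T + 1) * c -> w <= L.
  by move=> h1 h2; apply: (leq_trans h2); rewrite mulnC /L leq_mul2r h1 orbT.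
have c1 : #|{: cellT}| <= sim_width M 0 (branch M) by rewrite /sim_width; lia.
have Lenc (s : seq (cell (aux M))) : size s <= m + T + 1 -> size (enc s) <= L.
  move=> h1; apply: LgeM c1 _; apply: (leq_trans (size_enc s)).
  by rewrite leq_mul2r h1 orbT.
have Ly y : Y y -> size y <= L.
  by move=> /YsP[_ ym]; apply: Lge; lia.
have Lk y p : live y p -> size (key p) <= L.
  move=> Lp; have [C cp] := live_conf RM Lp; have [_ pT] := PsP Lp.
  apply: (LgeM _ (branch M)); first by rewrite /sim_width; lia.
  apply: (leq_trans (size_key (conf_of_branch (oracle_succs_branch A (M := M)) cp))).
  by rewrite leq_mul2r; apply/orP; right; lia.
have Lh n : n <= 7 -> size (key [:: n]) <= L.
  move=> n5; apply: (LgeM _ (sim_width M 0 (branch M))) => //.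
  by rewrite size_key_cons [size (key [::])]/= /sim_width; nia.
have Lf (f : fact word) : size (key f.1) <= L -> all (fun a => size a <= L) f.2 ->
    size f.2 <= 4 -> fits L f by rewrite /fits /= => -> -> ->.
case: k => [|[|[|[|[|[|[|[|k]]]]]]]] //.
- case: args => [|y [|k [|l [|r []]]]] //.
  case=> p [C [l1 [l2 [Lp cp -> Cq]]]] /=; set X := C.2 _ => -[lE -> ->].
  have Yy := live_start RM Lp; have [_ ym] := YsP Yy; have [_ pT] := PsP Lp.
  have sz := conf_of_size (oracle_succs_size (A := A) (M := M)) (query_tape M) cp.
  rewrite -/X in sz.
  have szl : size l1 + size l2 = size X.1.1 by rewrite lE size_cat.
  split.
    apply: (query_cover Lp cp); rewrite mem_cat; apply/orP; left.
    apply/mapP; exists (size l1); first by rewrite mem_iota; lia.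
    by rewrite -/X lE drop_size_cat // take_size_cat.
  apply: Lf => //; first exact: (Lh 6).
  rewrite /= Ly //= (Lk _ _ Lp) /= !Lenc //; last by lia.
  by rewrite size_cat size_rev /=; lia.
- case: args => [|y [|k [|r [|w []]]]] //.
  case=> p [C [w1 [w2 [Lp cp -> Cq]]]] /=; set X := C.2 _ => -[wE -> ->].
  have Yy := live_start RM Lp; have [_ ym] := YsP Yy; have [_ pT] := PsP Lp.
  have sz := conf_of_size (oracle_succs_size (A := A) (M := M)) (query_tape M) cp.
  rewrite -/X in sz.
  have szw : size w1 + size w2 = (size X.1.1 + size X.2).+1.
    by rewrite -size_cat -wE size_cat size_rev /= addnS.
  split.
    apply: (query_cover Lp cp); rewrite mem_cat; apply/orP; right.
    apply/mapP; exists (size w1); first by rewrite mem_iota; lia.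
    by rewrite -/X wE drop_size_cat // take_size_cat.
  apply: Lf => //; first exact: (Lh 7).
  rewrite /= Ly //= (Lk _ _ Lp) /= !Lenc //=; last by lia.
  rewrite size_rev andbT; apply: Lge; apply: leq_trans (size_word_bits _) _.
  by lia.
Qed.

End OracleCover.

Lemma tape_word_size (M : ontm) A y p (C : config M) :
  conf_of (oracle_succs A (M := M)) y p = Some C ->
  size (query_word C) <= size y + size p + 1.
Proof.
move=> cp; have sz := conf_of_size (oracle_succs_size (A := A) (M := M)) (query_tape M) cp.
rewrite query_wordE; apply: leq_trans (size_word_bits _) _.
by rewrite size_cat size_rev /= addnS addn1 ltnS.
Qed.

Fixpoint all_choices (D T : nat) : seq (seq nat) :=
  if T is T'.+1 then
    [::] :: flatten [seq [seq n :: p | p <- all_choices D T'] | n <- iota 0 D]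
  else [:: [::]].

Lemma all_choicesP D T p : all (fun n => n < D) p -> size p <= T -> p \in all_choices D T.
Proof.
elim: T p => [|T IH] [|n p] //= /andP[nD pD]; rewrite ltnS => pT.
rewrite inE; apply/orP; right; apply/flatten_mapP; exists n; first by rewrite mem_iota.
by apply/mapP; exists p => //; apply: IH.
Qed.

Lemma size_all_choices D T : 0 < size (all_choices D T) <= D.+1 ^ T.
Proof.
elim: T => [|T /andP[h0 IH]] //=; rewrite expnS mulSn.
apply: (@leq_trans (1 + size (iota 0 D) * size (all_choices D T))).
  by rewrite add1n ltnS; apply: size_flatten_le => n _; rewrite size_map.
rewrite size_iota leq_add //; first by rewrite expn_gt0.
by rewrite leq_mul2l IH orbT.
Qed.

(** The empty name is reserved for the distinguished fact. [E0] must avoid it because that fact is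
    added by [satisfiable] and not guessed. *)
Lemma model_satisfiable th k x (E0 : fact word -> Prop) raw L :
    (forall f, E0 f -> [/\ f \in raw, fits L f & f.1 <> [::]]) ->
    (forall E : fact word -> Prop, (forall f, f.1 <> [::] -> (E f <-> E0 f)) ->
       (forall args, E ([::], args) <-> args = [:: rev x]) -> models E th) ->
    x = encode (tok_theory th) ++ nseq k false ->
    size raw * (6 * L.+1) <= 2 ^ (size x).+1 -> satisfiable x.
Proof.
move=> E0P Mod xE szB; pose fs := [seq f <- raw | `[<E0 f>]].
apply: (models_satisfiable (fs := fs) xE).
  apply: Mod => [f f0|args].
    rewrite inE; case: eqP => [fE|_] /=; first by rewrite fE in f0.
    rewrite mem_filter; split=> [/andP[/asboolP]//|E0f].
    by have [-> _ _] := E0P _ E0f; rewrite andbT; apply/asboolP.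
  rewrite inE; split=> [|->]; last by rewrite eqxx.
  case/orP=> [/eqP[]//|]; rewrite mem_filter => /andP[/asboolP E0f _].
  by have [_ _ /(_ erefl)] := E0P _ E0f.
apply: leq_trans (size_facts_word (L := L) _) _.
  by move=> f; rewrite mem_filter => /andP[/asboolP/E0P[]].
apply: leq_trans szB; rewrite leq_mul2r; apply/orP; right.
by rewrite size_filter count_size.
Qed.

Definition full_model (s0 s1 s2 o : fact word -> Prop) (f : fact word) : Prop :=
  match f.1 with
  | k :: t :: _ => if 0 < k < 6 then
      match t with 0 => s0 f | 1 => s1 f | 2 => s2 f | _ => False end else o f
  | _ => o f
  end.

(** * Codes that are satisfiable iff the machine rejects *)

Section Complement.
Variables (M : ontm) (V : ntm) (A : language).
Hypothesis VA : forall w, A w <-> accepts (@step V) w.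

Local Notation query := (@is_query M).
Local Notation none := (pred0 : pred (state V)).

Definition certify_yes : seq clause := sim_theory none 1 ++ exists_clauses none 1.
Definition certify_no : seq clause := sim_theory none 2 ++ forall_clauses none 2.

Definition reject_base : seq clause :=
  sim_theory query 0 ++ forall_clauses query 0 ++ oracle_clauses M ++ oracle_live M ++
  certify_yes ++ certify_no.

(** Only the last clause depends on [x], so other clauses can compute this code from [x] by mere
    copying. *)
Definition reject_theory (x : word) : seq clause :=
  reject_base ++ [:: ([::], [:: fStart 0 (cst (rev x))])].

Lemma range_reject x : all range_restricted (reject_theory x).
Proof.
have h th th' : all range_restricted th -> all range_restricted th' ->
    all range_restricted (th ++ th') by rewrite all_cat => -> ->.
apply: (h); last by [].
exact: (h _ _ (range_sim _ _) (h _ _ (range_forall _ _) (h _ _ (range_oracle M)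
  (h _ _ (range_oracle_live M) (h _ _ (h _ _ (range_sim _ _) (range_exists _ _))
  (h _ _ (range_sim _ _) (range_forall _ _))))))).
Qed.

Definition reject_code (k : nat) (x : word) : word :=
  encode (tok_theory (reject_theory x)) ++ nseq k false.

Section Sound.
Variables (E : fact word -> Prop) (B : nat).
Hypothesis bd : forall f, E f -> all (fun a => size a <= B) f.2.

Lemma yes_sound w : models E certify_yes -> E (fStart 1 (rev w)) -> A w.
Proof.
move=> /models_cat[MS MX] S1; apply/VA; rewrite -[w]revK.
exact: (exists_accepts (R := @step V) MS _ MX bd S1).
Qed.

Lemma no_sound w : models E certify_no -> E (fStart 2 (rev w)) -> ~ A w.
Proof.
move=> /models_cat[MS MA] S2 /VA; rewrite -[w]revK.
exact: (forall_rejects (R := @step V) MS _ MA S2).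
Qed.
End Sound.

Lemma reject_sound k x : satisfiable (reject_code k x) -> ~ accepts (oracle_step A (M := M)) x.
Proof.
move=> /(satisfiable_models (range_reject x) erefl)[E [B [bd _]]].
case/models_cat; rewrite /reject_base.
case/models_cat=> MS /models_cat[MA /models_cat[MO /models_cat[ML /models_cat[MY MN]]]] Mx.
have S0 : E (fStart 0 (rev x)).
  have := @models_use E _ _ _ [::] [::] [::] [::] [::] Mx (mem_head _ _).
  by rewrite /= /inst /= /inst_term /= !cats0 => /(_ I)[].
rewrite -[x in accepts _ x]revK; apply: (forall_rejects MS _ MA S0).
  by move=> C C' nq; apply: oracle_step_other.
move=> k1 p C' _ C D L Cq CC'; exists 0.
have L' := oracle_live_sound ML D Cq L.
split=> //; rewrite (oracle_step_query Cq CC').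
by apply: (oracle_sound MO D Cq L'); [exact: yes_sound bd _ MY | exact: no_sound MN].
Qed.

End Complement.

Section Chosen.
Variables (G : ntm) (succs : config G -> seq (config G)).
Definition accepting_path (y : word) : seq nat :=
  xget [::] (fun p => exists2 C, conf_of succs y p = Some C & accepting C.1).

Lemma accepting_pathP y : accepts (succ_rel succs) (rev y) ->
  exists2 C, conf_of succs y (accepting_path y) = Some C & accepting C.1.
Proof.
case=> q qp ac; apply: (@xgetPex _ [::] (fun p => exists2 C, conf_of succs y p = Some C & accepting C.1)).
have [p [pE _]] := path_conf_of qp; exists p.
by exists (last (init G (rev y)) q).
Qed.

Lemma conf_of_time tG y p C : halts_within (succ_rel succs) tG (rev y) ->
  conf_of succs y p = Some C -> size p <= tG.
Proof. by move=> H /conf_of_path[q [qp _ <-]]; apply: H. Qed.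
End Chosen.

(** [X] bounds the numbers of histories and of queries, [Z] all polynomial quantities. The summands
    of [raw] belong to the runs of M, to the positive and the negative certificates and to the
    reading of queries; none has more than two factors of the size of [X]. *)
Lemma count_bound Z X m0 m1 b0 b1 b2 k0 k1 u raw L :
    3 < Z -> 0 < X -> m0 + 2 <= Z -> m1 + 2 <= Z -> b0 <= X -> b1 <= X -> b2 <= X ->
    k0 <= Z -> k1 <= Z -> u <= Z -> L <= Z * Z ->
    raw <= (m0 + b0 * k0 + 2) + b0 * (m1 + b1 * k1 + 2) + b0 * (m1 + b2 * k1 + 2)
           + b0 * (2 * u) ->
  raw * (6 * L.+1) <= X * X * Z ^ 6.
Proof.
move=> Z4 X0 m0Z m1Z b0X b1X b2X k0Z k1Z uZ LZ rawE.
have h0 : b0 * k0 <= X * Z by apply: leq_mul.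
have h1 : b1 * k1 <= X * Z by apply: leq_mul.
have h2 : b2 * k1 <= X * Z by apply: leq_mul.
have ZX : Z <= X * Z by rewrite leq_pmull.
have XX : X * Z <= X * (X * Z) by rewrite leq_mul2l leq_pmull ?orbT.
have h3 : b0 * (m1 + b1 * k1 + 2) <= X * (2 * (X * Z)) by apply: leq_mul => //; lia.
have h4 : b0 * (m1 + b2 * k1 + 2) <= X * (2 * (X * Z)) by apply: leq_mul => //; lia.
have h5 : b0 * (2 * u) <= X * (2 * Z) by apply: leq_mul => //; lia.
have rawB : raw <= 8 * (X * (X * Z)) by lia.
have LB : 6 * L.+1 <= 7 * (Z * Z) by nia.
apply: leq_trans (leq_mul rawB LB) _.
have -> : 8 * (X * (X * Z)) * (7 * (Z * Z)) = X * X * (56 * (Z * Z * Z)) by lia.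
rewrite leq_mul2l; apply/orP; right.
have -> : Z ^ 6 = (Z * Z * Z) * (Z * Z * Z) by rewrite !expnS expn0 muln1 !mulnA.
rewrite leq_mul2r; apply/orP; right.
(* The product 8 * 7 of the two numerical factors is below the cube of [Z]. *)
by apply: (@leq_trans (4 * 4 * 4)) => //; do 2 (apply: leq_mul => //).
Qed.

Lemma exp_mono a b e : a <= b -> a ^ e <= b ^ e.
Proof. by move=> ab; elim: e => // e IH; rewrite !expnS leq_mul. Qed.

(** The right side is the origin of the padding [4 * (Z * Z)]: the number of histories is bounded by
    [X = Z ^ Z] in [count_bound]. *)
Lemma pow_pow_bound Z : 3 < Z -> Z ^ Z * Z ^ Z * Z ^ 6 <= 2 ^ (4 * (Z * Z)).
Proof.
move=> Z4; rewrite -!expnD; apply: (@leq_trans ((2 ^ Z) ^ (Z + Z + 6))).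
  by rewrite leq_exp2r; [apply: ltnW; apply: ltn_expl | lia].
by rewrite -expnM leq_exp2l //; nia.
Qed.

Lemma mem_cat4 (T : eqType) (f : T) a b c d :
  f \in a ++ b ++ c ++ d = [|| f \in a, f \in b, f \in c | f \in d].
Proof. by rewrite !mem_cat. Qed.

Lemma size_cat4 (T : Type) (a b c d : seq T) :
  size (a ++ b ++ c ++ d) = size a + size b + size c + size d.
Proof. by rewrite !size_cat !addnA. Qed.

Section Complement.
Variables (M : ontm) (V : ntm) (A : language) (tM tV : nat -> nat).
Hypothesis VA : forall w, A w <-> accepts (@step V) w.
Hypothesis Mtime : forall x, halts_within (oracle_step A (M := M)) (tM (size x)) x.
Hypothesis Vtime : forall x, halts_within (@step V) (tV (size x)) x.
Hypothesis tV_mono : forall m n, m <= n -> tV m <= tV n.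

Local Notation query := (@is_query M).
Local Notation none := (pred0 : pred (state V)).
Local Notation osuccs := (oracle_succs A (M := M)).

Definition sim_const : nat :=
  branch M + branch V + 2 * extra_tapes M + 2 * extra_tapes V + sim_width M 0 (branch M) +
  sim_width V 1 (branch V) + sim_width V 2 (branch V) + 10.

Definition reject_size (n : nat) : nat :=
  sim_const + (n + tM n + 1) + tM n + tV (n + tM n + 1).

Section Model.
Variable x : word.
Hypothesis Mx : ~ accepts (oracle_step A (M := M)) x.
Local Notation n := (size x).

Definition rY0 (y : word) : Prop := y = rev x.
Definition rlive0 := live_all osuccs rY0.
Definition rqueried (y : word) : Prop := exists p C,
  [/\ rlive0 (rev x) p, conf_of osuccs (rev x) p = Some C, query C.1 & y = rev (query_word C)].
Definition rY1 (y : word) : Prop := rqueried y /\ A (rev y).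
Definition rY2 (y : word) : Prop := rqueried y /\ ~ A (rev y).
Definition rlive1 := live_ex rY1 (accepting_path (@successors V)).
Definition rlive2 := live_all (@successors V) rY2.

Definition reject_model : fact word -> Prop :=
  full_model (sim_model rY0 (conf_of osuccs) rlive0)
    (sim_model rY1 (conf_of (@successors V)) rlive1)
    (sim_model rY2 (conf_of (@successors V)) rlive2)
    (oracle_model M A rlive0).

Lemma rRM0 : run_model query rY0 (conf_of osuccs) rlive0.
Proof. exact/run_model_all/oracle_succsE. Qed.

Lemma rRM1 : run_model none rY1 (conf_of (@successors V)) rlive1.
Proof.
by apply: run_model_ex => // y [_ /VA]; apply: accepting_pathP.
Qed.

Lemma rRM2 : run_model none rY2 (conf_of (@successors V)) rlive2.
Proof. exact: run_model_all. Qed.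

Let T0 := tM n.
Let m1 := n + tM n + 1.
Let T1 := tV m1.
Definition rPs0 (y : word) := all_choices (branch M) T0.
(** Queries are enumerated through the histories that lead to them, so there are at most as many
    queries as histories. *)
Definition rYs : seq word := pmap (fun p => omap (fun C => rev (query_word C))
  (conf_of osuccs (rev x) p)) (all_choices (branch M) T0).
Definition rPs1 (y : word) : seq (seq nat) :=
  [seq drop j (accepting_path (@successors V) y) | j <- iota 0 T1.+1].
Definition rPs2 (y : word) := all_choices (branch V) T1.

Lemma rlive0_size p : rlive0 (rev x) p -> p \in rPs0 (rev x) /\ size p <= T0.
Proof.
case=> _; case pE : conf_of => [C|] // _.
have sp : size p <= T0.
  by apply: conf_of_time pE; rewrite revK oracle_succ_rel; apply: Mtime.
split=> //; apply: all_choicesP sp.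
exact: (conf_of_branch (oracle_succs_branch A (M := M)) pE).
Qed.

Lemma rqueried_size y : rqueried y -> y \in rYs /\ size y <= m1.
Proof.
case=> p [C [Lp cp Cq ->]]; have [pP pT] := rlive0_size Lp; split.
  by rewrite mem_pmap; apply/mapP; exists p; rewrite // cp.
rewrite size_rev; apply: leq_trans (tape_word_size cp) _.
by rewrite size_rev /m1 leq_add2r leq_add2l.
Qed.

Lemma rtime1 y p C : rqueried y -> conf_of (@successors V) y p = Some C -> size p <= T1.
Proof.
move=> /rqueried_size[_ ym] cp; apply: leq_trans (tV_mono ym).
apply: conf_of_time cp; have := @Vtime (rev y); rewrite size_rev; exact: id.
Qed.

Lemma rlive1_size y p : rlive1 y p -> p \in rPs1 y /\ size p <= T1.
Proof.
move=> Lp; have [[qy Ay] sp] := Lp; have [C cE _] := accepting_pathP ((VA (rev y)).1 Ay).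
have cT := rtime1 qy cE; have {}sp : suffix p (accepting_path (@successors V) y) := sp.
move/suffixP: sp => [s sE]; split.
  apply/mapP; exists (size s); last by rewrite sE drop_size_cat.
  by rewrite mem_iota ltnS; apply: leq_trans cT; rewrite sE size_cat leq_addr.
by apply: leq_trans cT; rewrite sE size_cat leq_addl.
Qed.

Lemma rlive2_size y p : rlive2 y p -> p \in rPs2 y /\ size p <= T1.
Proof.
case=> -[qy _]; case pE : conf_of => [C|] // _; have sp := rtime1 qy pE.
split=> //; apply: all_choicesP sp.
exact: (conf_of_branch (@successors_branch V) pE).
Qed.

Definition reject_cover : seq (fact word) :=
  sim_cover 0 osuccs [:: rev x] rPs0 n ++
  sim_cover 1 (@successors V) rYs rPs1 m1 ++
  sim_cover 2 (@successors V) rYs rPs2 m1 ++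
  oracle_cover M A [:: rev x] rPs0 n T0.

Let Z := reject_size n.

Lemma reject_model_cover f : reject_model f ->
  [/\ f \in reject_cover, fits (Z * Z) f & f.1 <> [::]].
Proof.
have fW w m T f' : w <= sim_const -> m + T + 1 <= Z -> fits (w * (m + T + 1)) f' -> fits (Z * Z) f'.
  move=> wZ mZ; apply: fitsW; apply: leq_mul => //; apply: leq_trans wZ _.
  by rewrite /Z /reject_size; lia.
have ZE : Z = sim_const + m1 + T0 + T1 by [].
have c1 : 10 <= sim_const by rewrite /sim_const; lia.
have m1Z : m1 + T1 + 1 <= Z by move: ZE c1 => ->; move: sim_const m1 T0 T1; lia.
have m0Z : n + T0 + 1 <= Z.
  by move: ZE c1 => -> c1; rewrite {1}/m1 -/T0; move: c1; move: sim_const T0 T1; lia.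
have YP0 y : rY0 y -> y \in [:: rev x] /\ size y <= n.
  by move=> ->; rewrite inE eqxx size_rev.
have PP0 y p : rlive0 y p -> p \in rPs0 y /\ size p <= T0.
  by move=> Lp; have yE := live_start rRM0 Lp; rewrite yE in Lp *; apply: rlive0_size.
have orc k args : oracle_model M A rlive0 ([:: k], args) ->
    [/\ ([:: k], args) \in reject_cover, fits (Z * Z) ([:: k], args) & [:: k] <> [::]].
  move=> om; have [fin ff] := oracle_model_cover rRM0 YP0 PP0 om; split=> //.
    by rewrite /reject_cover mem_cat4 fin !orbT.
  by apply: fW ff; [rewrite /sim_const; lia | exact: m0Z].
case: f => -[|k [|t h]] args; rewrite /reject_model /full_model //=.
  exact: orc.
case: ifP => [k6|_].
  case: t => [|[|[|t]]] // sm.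
  - have [fin ff] := sim_model_cover (oracle_succs_branch A (M := M))
      (oracle_succs_size (A := A) (M := M)) rRM0 YP0 PP0 sm; split=> //.
      by rewrite /reject_cover mem_cat4 fin.
    by apply: fW ff; [rewrite /sim_const; lia | exact: m0Z].
  - have [fin ff] := sim_model_cover (@successors_branch V) (@successors_size V) rRM1
      (fun y (Yy : rY1 y) => rqueried_size Yy.1) rlive1_size sm; split=> //.
      by rewrite /reject_cover mem_cat4 fin !orbT.
    by apply: fW ff; [rewrite /sim_const; lia | exact: m1Z].
  - have [fin ff] := sim_model_cover (@successors_branch V) (@successors_size V) rRM2
      (fun y (Yy : rY2 y) => rqueried_size Yy.1) rlive2_size sm; split=> //.
      by rewrite /reject_cover mem_cat4 fin !orbT.
    by apply: fW ff; [rewrite /sim_const; lia | exact: m1Z].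
by case: k => [|[|[|[|[|[|[|[|k]]]]]]]].
Qed.

Lemma reject_model_models E :
    (forall f, f.1 <> [::] -> (E f <-> reject_model f)) -> models E (reject_theory M V x).
Proof.
move=> EP.
have EM0 k h args : 0 < k < 6 -> E (k :: 0 :: h, args) <->
    sim_model rY0 (conf_of osuccs) rlive0 (k :: 0 :: h, args).
  by move=> k6; rewrite EP // /reject_model /full_model /=; case: ifP => //; rewrite k6.
have EM1 k h args : 0 < k < 6 -> E (k :: 1 :: h, args) <->
    sim_model rY1 (conf_of (@successors V)) rlive1 (k :: 1 :: h, args).
  by move=> k6; rewrite EP // /reject_model /full_model /=; case: ifP => //; rewrite k6.
have EM2 k h args : 0 < k < 6 -> E (k :: 2 :: h, args) <->
    sim_model rY2 (conf_of (@successors V)) rlive2 (k :: 2 :: h, args).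
  by move=> k6; rewrite EP // /reject_model /full_model /=; case: ifP => //; rewrite k6.
have EO k args : 6 <= k <= 7 -> E ([:: k], args) <-> oracle_model M A rlive0 ([:: k], args).
  by move=> k6; rewrite EP.
have ES1 y : E (fStart 1 y) <-> rY1 y by apply: EM1.
have ES2 y : E (fStart 2 y) <-> rY2 y by apply: EM2.
apply/models_cat; split; last first.
  move=> c a; rewrite inE => /eqP->; apply/holdsE => _ /=; left.
  by rewrite /inst /= /inst_term /= !cats0; apply/EM0.
rewrite /reject_base.
apply/models_cat; split; first exact: (sim_theory_model rRM0 EM0).
apply/models_cat; split.
  apply: (forall_model EM0).
    move=> y p C k Lp cp nq kC; apply: (live_all_next Lp cp).
    by rewrite oracle_succsE.
  move=> y p C Lp cp; apply/negP => ac; apply: Mx.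
  have yE := live_start rRM0 Lp; rewrite yE in cp.
  have [q [qp qC _]] := conf_of_path cp; rewrite revK in qp qC.
  by rewrite -oracle_succ_rel; exists q => //; rewrite qC.
apply/models_cat; split.
  apply: (oracle_clauses_model (Y1 := rY1) (Y2 := rY2) _ _ _ EM0 EO ES1 ES2).
  - by move=> w [_]; rewrite revK.
  - by move=> w [_]; rewrite revK.
  - move=> y p C Lp cp Cq; have yE := live_start rRM0 Lp; rewrite yE in Lp cp.
    by split=> Aw; split; rewrite ?revK //; exists p, C.
apply/models_cat; split.
  apply: (oracle_live_model EM0) => y p C Lp cp Cq; apply: (live_all_next Lp cp).
  by rewrite /oracle_succs; rewrite /is_query in Cq; rewrite Cq.
rewrite /certify_yes /certify_no; apply/models_cat; split; apply/models_cat; split.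
- exact: (sim_theory_model rRM1 EM1).
- apply: (exists_model rRM1 EM1) => y p C Lp cp _ na.
  apply: (live_ex_next _ Lp cp na) => y' [_ /VA]; exact: accepting_pathP.
- exact: (sim_theory_model rRM2 EM2).
- apply: (forall_model EM2).
    by move=> y p C k Lp cp _ kC; apply: (live_all_next Lp cp kC).
  move=> y p C Lp cp; apply/negP => ac.
  have [_ nA] := live_start rRM2 Lp; apply: nA; apply/VA.
  have [q [qp qC _]] := conf_of_path cp.
  by exists q => //; rewrite qC.
Qed.

(** All runs of both machines are stored. Their number is exponential in [Z * Z], a polynomial in
    the length of [x], and the padding raises the permitted size accordingly. *)
Lemma reject_complete k : 4 * (Z * Z) <= k -> satisfiable (reject_code M V k x).
Proof.
move=> kZ.
apply: (model_satisfiable (L := Z * Z) reject_model_cover _ erefl).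
  by move=> E EP _; apply: reject_model_models.
have Z4 : 3 < Z by rewrite /Z /reject_size /sim_const; lia.
have b0X : size (all_choices (branch M) T0) <= Z ^ Z.
  have /andP[_ h] := size_all_choices (branch M) T0; apply: leq_trans h _.
  apply: (@leq_trans (Z ^ T0)).
    by apply: exp_mono; rewrite /Z /reject_size /sim_const; lia.
  by rewrite leq_exp2l; [rewrite /Z /reject_size /T0; lia | lia].
have b2X : size (all_choices (branch V) T1) <= Z ^ Z.
  have /andP[_ h] := size_all_choices (branch V) T1; apply: leq_trans h _.
  apply: (@leq_trans (Z ^ T1)).
    by apply: exp_mono; rewrite /Z /reject_size /sim_const; lia.
  by rewrite leq_exp2l; [rewrite /Z /reject_size /T1 /m1; lia | lia].
apply: leq_trans (_ : 2 ^ (4 * (Z * Z)) <= _); last first.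
  rewrite leq_exp2l // /reject_code size_cat size_nseq; lia.
apply: leq_trans (pow_pow_bound Z4).
apply: (@count_bound Z (Z ^ Z) n m1 (size (all_choices (branch M) T0)) T1.+1
   (size (all_choices (branch V) T1)) (2 * extra_tapes M + 4) (2 * extra_tapes V + 4) (n + T0 + 2)) => //.
- by rewrite expn_gt0; lia.
- by rewrite /Z /reject_size /sim_const; lia.
- by rewrite /Z /reject_size /sim_const /m1; lia.
- apply: (@leq_trans Z); first by rewrite /Z /reject_size /sim_const /T1 /m1; lia.
  by rewrite -{1}(expn1 Z) leq_exp2l; lia.
- by rewrite /Z /reject_size /sim_const; lia.
- by rewrite /Z /reject_size /sim_const; lia.
- by rewrite /Z /reject_size /sim_const /T0; lia.
rewrite /reject_cover size_cat4; apply: leq_add; [apply: leq_add; [apply: leq_add|]|].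
- by have := @size_sim_cover M 0 osuccs [:: rev x] rPs0 n _ (fun y _ => leqnn _); rewrite mul1n.
- have yb : size rYs <= size (all_choices (branch M) T0) by rewrite size_pmap count_size.
  apply: leq_trans (size_sim_cover 1 _ m1 (b := T1.+1) _) _.
    by move=> y _; rewrite size_map size_iota.
  by rewrite leq_mul2r yb orbT.
- have yb : size rYs <= size (all_choices (branch M) T0) by rewrite size_pmap count_size.
  apply: leq_trans (size_sim_cover 2 _ m1 (b := size (all_choices (branch V) T1)) _) _ => //.
  by rewrite leq_mul2r yb orbT.
- by have := @size_oracle_cover M A [:: rev x] rPs0 n T0 _ (fun y _ => leqnn _); rewrite mul1n.
Qed.

End Model.
End Complement.

(** * Counting words *)

Definition words (B : language) (n : nat) : seq word :=
  flatten [seq [seq val t | t <- enum [pred t : i.-tuple bool | B t]] | i <- iota 0 n.+1].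

Lemma mem_words B n w : (w \in words B n) = (size w <= n) && B w.
Proof.
apply/flatten_mapP/andP => [[i]|[wn Bw]].
  rewrite mem_iota /= add0n ltnS => i_n /mapP[t]; rewrite mem_enum => Bt ->.
  by rewrite size_tuple.
exists (size w); first by rewrite mem_iota.
by apply/mapP; exists (in_tuple w); rewrite ?mem_enum.
Qed.

Lemma size_words B n : size (words B n) = density B n.
Proof.
rewrite /words size_flatten /shape -map_comp sumnE big_map /density -(big_mkord xpredT (fun i => #|[pred x : i.-tuple bool | B x]|)).
rewrite /index_iota subn0; apply: eq_bigr => i _.
by rewrite /= size_map cardE.
Qed.

Lemma uniq_words B n : uniq (words B n).
Proof.
rewrite /words; elim: (iota 0 n.+1) (iota_uniq 0 n.+1) => //= i s IH /andP[i_s us].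
rewrite cat_uniq IH // andbT (map_inj_uniq val_inj) enum_uniq /=.
apply/hasPn => w /flatten_mapP[j js /mapP[t _ wt]]; apply/negP => /mapP[t' _ wt'].
by move: i_s; rewrite -(size_tuple t') -wt' wt size_tuple js.
Qed.

(** An index set of prescribed size: if digit i of [a] is 1, all 2^i words of length i belong to it.
    It takes one clause for each digit 1 to describe it. *)
Definition bit_language (a : nat) : language := fun u => odd (a %/ 2 ^ size u).

Lemma density_bit_language a r : a < 2 ^ r.+1 -> density (bit_language a) r = a.
Proof.
move=> ar; rewrite /density.
have -> : \sum_(i < r.+1) #|[pred x : i.-tuple bool | bit_language a x]| =
    \sum_(i < r.+1) nat_of_bool (odd (a %/ 2 ^ i)) * 2 ^ i.
  apply: eq_bigr => i _; rewrite -{2}card_bool -card_tuple.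
  case: (boolP (odd (a %/ 2 ^ i))) => o.
    rewrite [RHS]mul1n; apply: eq_card => x; rewrite !inE /bit_language size_tuple o.
    by [].
  rewrite mul0n; apply: eq_card0 => x; rewrite !inE /bit_language size_tuple.
  exact: negbTE.
elim: r a ar => [|r IH] a ar.
  by rewrite big_ord1 expn0 divn1 muln1; case: a ar => [|[|a]].
rewrite big_ord_recl expn0 divn1 muln1.
rewrite -[RHS](odd_double_half a); congr (_ + _).
rewrite -muln2 -divn2 -[in RHS](IH (a %/ 2)); last first.
  by rewrite ltn_divLR // -expnSr.
rewrite big_distrl /=; apply: eq_bigr => i _.
by rewrite expnS divnMA -mulnA [2 ^ i * 2]mulnC.
Qed.

Lemma size_words_le B n : size (words B n) <= 2 ^ n.+1.
Proof.
rewrite size_words /density; apply: (@leq_trans (\sum_(i < n.+1) 2 ^ i)).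
  apply: leq_sum => i _; rewrite -[X in X ^ _]card_bool -card_tuple; exact: max_card.
elim: n => [|n IH]; first by rewrite big_ord1.
rewrite big_ord_recr /= [2 ^ n.+2]expnS mul2n -addnn; exact: leq_add.
Qed.

(** * Deciding the oracle by a list of its words *)

Section Facts.
Variable T : Type.
Implicit Types (d u w v : T).
(* The indices of the list are the words [u] such that the bit number [size u] of
   [a] is set, hence there are [a] of them. [fNode] generates them, [d] being the
   number in unary of the bits to be chosen, [fSearch] extends [w] to the word
   listed at [u] as long as the budget [v] permits, [fPower] doubles [v] at each
   step, and [fCopy] computes the image of the input under [reject_code]. *)
Definition fNode d u : fact T := ([:: 8], [:: d; u]).
Definition fSearch u w v : fact T := ([:: 9], [:: u; w; v]).
Definition fListed u w : fact T := ([:: 10], [:: u; w]).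
Definition fEqual u w : fact T := ([:: 11], [:: u; w]).
Definition fPower d v : fact T := ([:: 12], [:: d; v]).
Definition fCopy u v : fact T := ([:: 13], [:: u; v]).
Definition fImage v : fact T := ([:: 14], [:: v]).
End Facts.

Lemma encode_cat s t : encode (s ++ t) = encode s ++ encode t.
Proof. by rewrite /encode map_cat flatten_cat. Qed.

Section Accept.
Variables (M : ontm) (V : ntm).

(** It breaks off inside the last clause of [reject_theory], where the bits of [rev x] have to be
    inserted; [code_post] completes the clause. *)
Definition code_pre : word := encode (tok_theory (reject_base M V) ++
  [:: Lit true; Dollar] ++ map Bit (key [:: 1; 0]) ++ [:: Hash]).
Definition code_post : word := encode [:: Hash; Dollar; End].

Lemma reject_codeE k x : reject_code M V k x =
  code_pre ++ encode (map Bit (rev x)) ++ code_post ++ nseq k false.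
Proof.
rewrite /reject_code /code_pre /code_post [in RHS]catA [in RHS]catA; congr (_ ++ _).
rewrite -!encode_cat; congr encode.
rewrite /reject_theory /tok_theory map_cat flatten_cat -!catA; congr (_ ++ _).
rewrite /= /tok_clause /= /tok_lit /tok_fact /= /tok_term /= !cats0.
by rewrite -!catA.
Qed.

(* [e] and [e'] are the logarithms of the bound on the length of the queries
   and of the length of the padding; [a] is the number of listed words. *)
Variables (r a e e' : nat).

(** In the clause for [fSearch] the model chooses to stop or to put one more bit in front. A listed
    word starts a positive certificate, so it belongs to the oracle. A word listed at two indices
    forces [fEqual], which is refuted bit by bit unless they coincide; so different indices list
    different words. The last clause then rules out negative answers for listed words. *)
Definition list_clauses : seq clause :=
  [seq ([::], [:: fNode (cst (nseq i true)) (cst [::])]) | i <- iota 0 r.+1 & odd (a %/ 2 ^ i)] ++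
  [:: ([:: fNode (cv [:: true] vK) tY], [:: fNode tK (cv [:: false] vY)]);
      ([:: fNode (cv [:: true] vK) tY], [:: fNode tK (cv [:: true] vY)]);
      ([::], [:: fPower (cst (nseq e true)) (cst [:: false])]);
      ([:: fPower (cv [:: true] vK) tR], [:: fPower tK ([::], [:: vR; vR])]);
      ([:: fNode (cst [::]) tY; fPower (cst [::]) tR], [:: fSearch tY (cst [::]) tR]);
      ([:: fSearch tY tL (cst [::])], [:: fListed tY tL]);
      ([:: fSearch tY tL (cv [:: false] vR)],
       [:: fListed tY tL; fSearch tY (cv [:: false] vL) tR; fSearch tY (cv [:: true] vL) tR]);
      ([:: fListed tY tL], [:: fStart 1 tL]);
      ([:: fListed tY tL; fListed tK tL], [:: fEqual tY tK]);
      ([:: fEqual (cv [:: false] vY) (cv [:: false] vK)], [:: fEqual tY tK]);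
      ([:: fEqual (cv [:: true] vY) (cv [:: true] vK)], [:: fEqual tY tK]);
      ([:: fEqual (cv [:: false] vY) (cv [:: true] vK)], [::]);
      ([:: fEqual (cv [:: true] vY) (cv [:: false] vK)], [::]);
      ([:: fEqual (cst [::]) (cv [:: false] vK)], [::]);
      ([:: fEqual (cst [::]) (cv [:: true] vK)], [::]);
      ([:: fEqual (cv [:: false] vY) (cst [::])], [::]);
      ([:: fEqual (cv [:: true] vY) (cst [::])], [::]);
      ([:: fStart 1 tY; fStart 2 tY], [::])].

(** The distinguished fact supplies [rev x], which is coded bit by bit onto a stack; the result is
    the reversed code, as [fStart] wants it. Its padding has [2 ^ e'] zeros, found in [fPower] after
    e' doublings, when [e - e'] strokes are left. *)
Definition image_clauses : seq clause :=
  [:: ([:: ([::], [:: tY])], [:: fCopy tY (cst (rev code_pre))]);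
      ([:: fCopy (cv [:: false] vY) tR], [:: fCopy tY (cv (rev (code (Bit false))) vR)]);
      ([:: fCopy (cv [:: true] vY) tR], [:: fCopy tY (cv (rev (code (Bit true))) vR)]);
      ([:: fCopy (cst [::]) tR], [:: fImage (cv (rev code_post) vR)]);
      ([:: fImage tL; fPower (cst (nseq (e - e') true)) tR],
       [:: fStart 0 ([::], [:: vR; vL])])].

(** In contrast to [reject_base], [fStart 2] starts no simulation: all runs on queries of this
    length would be too many for the model. Negative answers are controlled by the list alone. *)
Definition accept_theory : seq clause :=
  sim_theory (@is_query M) 0 ++ exists_clauses (@is_query M) 0 ++ oracle_clauses M ++
  (if accepting (query_state M) then [::] else oracle_live M) ++
  certify_yes V ++ list_clauses ++ image_clauses.

Lemma range_accept : all range_restricted accept_theory.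
Proof.
have h th th' : all range_restricted th -> all range_restricted th' ->
    all range_restricted (th ++ th') by rewrite all_cat => -> ->.
rewrite /accept_theory /certify_yes; apply: (h _ _ (range_sim _ _)).
apply: (h _ _ (range_exists _ _)); apply: (h _ _ (range_oracle M)).
apply: (h); first by case: ifP => // _; apply: range_oracle_live.
apply: (h _ _ (h _ _ (range_sim _ _) (range_exists _ _))).
apply: (h); last by [].
by apply: (h); [rewrite all_map; apply/allP | ].
Qed.

Section Sound.
Variables (A : language) (E : fact word -> Prop) (B : nat).
Hypothesis VA : forall w, A w <-> accepts (@step V) w.
Hypothesis bd : forall f, E f -> all (fun a => size a <= B) f.2.
Hypothesis ML : models E list_clauses.
Hypothesis MI : models E image_clauses.
Hypothesis MY : models E (certify_yes V).

Lemma power_sound j : j <= e -> E (fPower (nseq (e - j) true) (nseq (2 ^ j) false)).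
Proof.
have U P C y k l s t := @models_use E _ P C y k l s t ML.
elim: j => [_|j IH je].
  have := U [::] [:: fPower (cst (nseq e true)) (cst [:: false])] [::] [::] [::] [::] [::].
  rewrite /= /inst /= /inst_term /= !cats0 subn0 => H; case: H => //.
  by rewrite /list_clauses mem_cat !inE eqxx !orbT.
have := U [:: fPower (cv [:: true] vK) tR] [:: fPower tK ([::], [:: vR; vR])]
  [::] (nseq (e - j.+1) true) [::] (nseq (2 ^ j) false) [::].
rewrite /= /inst /= /inst_term /= !cats0 => H; case: H => //.
- by rewrite /list_clauses mem_cat !inE eqxx !orbT.
- split=> //; have := IH (ltnW je); have -> : e - j = (e - j.+1).+1 by lia.
  by [].
- by rewrite -nseqD addnn -mul2n -expnS.
Qed.

Lemma node_sound d u : (size u + d <= r) -> odd (a %/ 2 ^ (size u + d)) -> E (fNode (nseq d true) u).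
Proof.
have U P C y k l s t := @models_use E _ P C y k l s t ML.
elim: u d => [|b u IH] d dr od.
  have := U [::] [:: fNode (cst (nseq d true)) (cst [::])] [::] [::] [::] [::] [::].
  rewrite /= /inst /= /inst_term /= !cats0 => H; case: H => //.
  rewrite /list_clauses mem_cat; apply/orP; left; apply/mapP; exists d => //.
  by rewrite mem_filter od mem_iota.
have En : E (fNode (nseq d.+1 true) u) by apply: IH; rewrite addnS -addSn.
have := U [:: fNode (cv [:: true] vK) tY] [:: fNode tK (cv [:: b] vY)] u (nseq d true) [::] [::] [::].
rewrite /= /inst /= /inst_term /= !cats0 => H; case: H => //.
by rewrite /list_clauses mem_cat; apply/orP; right; case: (b); rewrite !inE eqxx ?orbT.
Qed.

Lemma search_sound m u w : E (fSearch u w (nseq m false)) ->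
  exists2 w', E (fListed u w') & size w' <= size w + m.
Proof.
have U P C y k l s t := @models_use E _ P C y k l s t ML.
elim: m w => [|m IH] w Es.
  exists w; last by rewrite addn0.
  have := U [:: fSearch tY tL (cst [::])] [:: fListed tY tL] u [::] w [::] [::].
  rewrite /= /inst /= /inst_term /= !cats0 => H; case: H => //.
  by rewrite /list_clauses mem_cat !inE eqxx !orbT.
have := U [:: fSearch tY tL (cv [:: false] vR)]
  [:: fListed tY tL; fSearch tY (cv [:: false] vL) tR; fSearch tY (cv [:: true] vL) tR]
  u [::] w (nseq m false) [::].
rewrite /= /inst /= /inst_term /= !cats0 => H; case: H => //.
- by rewrite /list_clauses mem_cat !inE eqxx !orbT.
- by move=> El; exists w => //; rewrite leq_addr.
- by case=> [|[|//]] /IH[w' Ew']; rewrite /= addSnnS; exists w'.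
Qed.

Lemma equal_sound u u' : E (fEqual u u') -> u = u'.
Proof.
have U P C y k := @models_use E _ P C y k [::] [::] [::] ML.
elim: u u' => [|b u IH] [|b' u'] //.
- have := U [:: fEqual (cst [::]) (cv [:: b'] vK)] [::] [::] u'.
  rewrite /= /inst /= /inst_term /= !cats0 => H Eq; case: H => //.
  by rewrite /list_clauses mem_cat; apply/orP; right; case: (b'); rewrite !inE eqxx ?orbT.
- have := U [:: fEqual (cv [:: b] vY) (cst [::])] [::] u [::].
  rewrite /= /inst /= /inst_term /= !cats0 => H Eq; case: H => //.
  by rewrite /list_clauses mem_cat; apply/orP; right; case: (b); rewrite !inE eqxx ?orbT.
- have [<-|nb] := eqVneq b b'.
    have := U [:: fEqual (cv [:: b] vY) (cv [:: b] vK)] [:: fEqual tY tK] u u'.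
    rewrite /= /inst /= /inst_term /= !cats0 => H Eq; case: H => //.
      by rewrite /list_clauses mem_cat; apply/orP; right; case: (b); rewrite !inE eqxx ?orbT.
    by move/IH=> ->.
  have := U [:: fEqual (cv [:: b] vY) (cv [:: b'] vK)] [::] u u'.
  rewrite /= /inst /= /inst_term /= !cats0 => H Eq; case: H => //.
  rewrite /list_clauses mem_cat; apply/orP; right.
  by case: (b) (b') nb => -[] //; rewrite !inE eqxx ?orbT.
Qed.

Lemma listed_inj u u' w : E (fListed u w) -> E (fListed u' w) -> u = u'.
Proof.
move=> Eu Eu'; apply: equal_sound.
have := @models_use E _ [:: fListed tY tL; fListed tK tL] [:: fEqual tY tK] u u' w [::] [::] ML.
rewrite /= /inst /= /inst_term /= !cats0 => H; case: H => //.
by rewrite /list_clauses mem_cat !inE eqxx !orbT.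
Qed.

Lemma listed_start u w : E (fListed u w) -> E (fStart 1 w).
Proof.
move=> Eu; have := @models_use E _ [:: fListed tY tL] [:: fStart 1 tL] u [::] w [::] [::] ML.
rewrite /= /inst /= /inst_term /= !cats0 => H; case: H => //.
by rewrite /list_clauses mem_cat !inE eqxx !orbT.
Qed.

Hypothesis ar : a < 2 ^ r.+1.
Hypothesis dA : density A (2 ^ e) = a.

(** Pigeonhole: the [a] indices list [a] different words of the oracle of length at most [2 ^ e],
    and by [dA] there are no others. *)
Lemma all_listed w : A w -> size w <= 2 ^ e -> E (fStart 1 (rev w)).
Proof.
move=> Aw we.
have /choice[g gE] u : exists w', u \in words (bit_language a) r ->
    E (fListed u (rev w')) /\ size w' <= 2 ^ e.
  have [uS|] := boolP (u \in words _ _); last by exists [::].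
  have : E (fSearch u [::] (nseq (2 ^ e) false)).
    have Pe := power_sound (leqnn e); rewrite subnn in Pe.
    have := @models_use E _ [:: fNode (cst [::]) tY; fPower (cst [::]) tR]
      [:: fSearch tY (cst [::]) tR] u [::] [::] (nseq (2 ^ e) false) [::] ML.
    rewrite /= /inst /= /inst_term /= !cats0 => H; case: H => //.
      by rewrite /list_clauses mem_cat !inE eqxx !orbT.
    split=> //; move: uS; rewrite mem_words => /andP[ur ub].
    by apply: (node_sound (d := 0)); rewrite addn0.
  by move/search_sound=> [w' Ew' sw']; exists (rev w') => _; rewrite revK size_rev.
have us : uniq (map g (words (bit_language a) r)).
  rewrite map_inj_in_uniq ?uniq_words // => u u' uS uS' gg.
  have [E1 _] := gE _ uS; have [E2 _] := gE _ uS'; rewrite -gg in E2.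
  exact: listed_inj E1 E2.
have sub : {subset map g (words (bit_language a) r) <= words A (2 ^ e)}.
  move=> _ /mapP[u uS ->]; have [/listed_start S1 sw] := gE _ uS.
  by rewrite mem_words sw /=; apply: (yes_sound VA bd MY).
have [|_ eqm] := uniq_min_size us sub.
  by rewrite size_map !size_words density_bit_language // dA.
have : w \in words A (2 ^ e) by rewrite mem_words we.
rewrite -eqm.
by case/mapP=> u uS ->; have [/listed_start] := gE _ uS.
Qed.

Lemma query_answer w : size w <= 2 ^ e -> E (fStart 2 (rev w)) -> ~ A w.
Proof.
move=> we S2 Aw; have S1 := all_listed Aw we.
have := @models_use E _ [:: fStart 1 tY; fStart 2 tY] [::] (rev w) [::] [::] [::] [::] ML.
rewrite /= /inst /= /inst_term /= !cats0 => H; case: H => //.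
by rewrite /list_clauses mem_cat !inE eqxx !orbT.
Qed.

Lemma copy_sound u v : E (fCopy u v) -> E (fCopy [::] (rev (encode (map Bit u)) ++ v)).
Proof.
elim: u v => // b u IH v Ec.
have := @models_use E _ [:: fCopy (cv [:: b] vY) tR] [:: fCopy tY (cv (rev (code (Bit b))) vR)]
  u [::] [::] v [::] MI.
rewrite /= /inst /= /inst_term /= !cats0 => H; case: H => //.
  by case: (b); rewrite !inE eqxx ?orbT.
move/IH; have -> : encode (map Bit (b :: u)) = code (Bit b) ++ encode (map Bit u) by [].
by rewrite rev_cat -catA.
Qed.

Lemma image_sound x : e' <= e -> E ([::], [:: rev x]) ->
  E (fStart 0 (rev (reject_code M V (2 ^ e') x))).
Proof.
move=> ee Ex.
have U P C y k l s t := @models_use E _ P C y k l s t MI.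
have : E (fCopy (rev x) (rev code_pre)).
  have := U [:: ([::], [:: tY])] [:: fCopy tY (cst (rev code_pre))] (rev x) [::] [::] [::] [::].
  rewrite /= /inst /= /inst_term /= !cats0 => H; case: H => //.
  by rewrite !inE eqxx.
move/copy_sound; set v := _ ++ _ => Ec.
have Ei : E (fImage (rev code_post ++ v)).
  have := U [:: fCopy (cst [::]) tR] [:: fImage (cv (rev code_post) vR)] [::] [::] [::] v [::].
  rewrite /= /inst /= /inst_term /= !cats0 => H; by case: H.
have rev_cat4 (b c d f : word) : rev (b ++ c ++ d ++ f) = rev f ++ (rev d ++ (rev c ++ rev b)).
  by rewrite !rev_cat !catA.
rewrite reject_codeE rev_cat4 rev_nseq -/v.
move: (rev code_post ++ v) Ei => q Ei.
have := U [:: fImage tL; fPower (cst (nseq (e - e') true)) tR] [:: fStart 0 ([::], [:: vR; vL])]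
  [::] [::] q (nseq (2 ^ e') false) [::].
rewrite /= /inst /= /inst_term /= !cats0 => H; case: H => //.
- by rewrite !inE eqxx !orbT.
- by split=> //; split=> //; apply: power_sound.
Qed.

End Sound.

Lemma accept_sound (A : language) (tM : nat -> nat) k x :
    (forall w, A w <-> accepts (@step V) w) ->
    (forall y, halts_within (oracle_step A (M := M)) (tM (size y)) y) ->
    a < 2 ^ r.+1 -> density A (2 ^ e) = a -> e' <= e ->
    x = encode (tok_theory accept_theory) ++ nseq k false ->
    (let n := size (reject_code M V (2 ^ e') x) in n + tM n + 1 <= 2 ^ e) ->
  satisfiable x -> accepts (oracle_step A (M := M)) (reject_code M V (2 ^ e') x).
Proof.
move=> VA Mtime ar dA ee xE nB /(satisfiable_models range_accept xE)[E [B [bd Ex]]].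
case/models_cat=> MS /models_cat[MX /models_cat[MO /models_cat[ML /models_cat[MY /models_cat[MLi MI]]]]].
have S0 := image_sound MLi MI ee Ex.
set f := reject_code _ _ _ _ in S0 nB *.
rewrite -[f in accepts _ f]revK; apply: (exists_accepts MS _ MX bd S0).
  by move=> C C' nq; apply: oracle_step_other.
move=> k1 p pp C D L Cq na.
have qn : ~~ accepting (query_state M) by rewrite -(eqP Cq).
rewrite (negbTE qn) in ML.
have L' := oracle_live_sound ML D Cq L.
(* A query is no longer than the input plus the number of steps plus one, so it lies in the range of
   the list. *)
have qs : size (query_word C) <= 2 ^ e.
  rewrite -oracle_succ_rel in pp; have [q [qE qs]] := path_conf_of pp.
  apply: leq_trans (tape_word_size qE) _; rewrite size_rev; apply: leq_trans nB.
  rewrite leq_add2r leq_add2l; apply: conf_of_time qE.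
  by rewrite oracle_succ_rel revK.
exists 0, (if A (query_word C) then yes_state M else no_state M, C.2); split=> //.
  by rewrite /oracle_step; rewrite /is_query in Cq; rewrite Cq.
by apply: (oracle_sound MO D Cq L'); [exact: (yes_sound VA bd MY) | exact: (query_answer VA bd MLi MY ar dA qs)].
Qed.

End Accept.

Local Arguments code_pre : simpl never.
Local Arguments code_post : simpl never.
Local Arguments code : simpl never.
Local Arguments rev : simpl never.
Local Arguments fits : simpl never.

(** * The intended model of the accepting clause set *)

Section Model.
Variables (M : ontm) (V : ntm) (A : language) (tM tV : nat -> nat).
Hypothesis VA : forall w, A w <-> accepts (@step V) w.
Hypothesis Mtime : forall x, halts_within (oracle_step A (M := M)) (tM (size x)) x.
Hypothesis Vtime : forall x, halts_within (@step V) (tV (size x)) x.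
Hypothesis tV_mono : forall m n, m <= n -> tV m <= tV n.
Variables (r a e e' : nat) (x : word).
Hypothesis ar : a < 2 ^ r.+1.
Hypothesis dA : density A (2 ^ e) = a.
Hypothesis ee : e' <= e.

Local Notation query := (@is_query M).
Local Notation none := (pred0 : pred (state V)).
Local Notation osuccs := (oracle_succs A (M := M)).
Local Notation f := (reject_code M V (2 ^ e') x).
Local Notation N := (2 ^ e).
Local Notation T0 := (tM (size f)).
Local Notation T1 := (tV N).

Hypothesis Mf : accepts (oracle_step A (M := M)) f.
Hypothesis nB : size f + T0 + 1 <= N.

Let S := words (bit_language a) r.
Definition listed (u : word) : word := rev (nth [::] (words A N) (index u S)).

Lemma size_listing : size S = size (words A N).
Proof. by rewrite !size_words density_bit_language // dA. Qed.

Lemma listedP u : u \in S -> A (rev (listed u)) /\ size (listed u) <= N.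
Proof.
move=> uS; rewrite /listed revK size_rev.
have : nth [::] (words A N) (index u S) \in words A N.
  by rewrite mem_nth // -size_listing index_mem.
by rewrite mem_words => /andP[-> ->].
Qed.

Lemma listed_unique u u' : u \in S -> u' \in S -> listed u = listed u' -> u = u'.
Proof.
move=> uS uS' /(can_inj revK) /eqP.
rewrite nth_uniq ?uniq_words -?size_listing ?index_mem // => /eqP ii.
by rewrite -(nth_index [::] uS) ii nth_index.
Qed.

Lemma mem_listing u : (u \in S) = (size u <= r) && odd (a %/ 2 ^ size u).
Proof. by rewrite mem_words. Qed.

Definition aY0 (y : word) : Prop := y = rev f.
Definition alive0 := live_ex aY0 (accepting_path osuccs).
Definition aqueried (y : word) : Prop := exists p C,
  [/\ alive0 (rev f) p, conf_of osuccs (rev f) p = Some C, query C.1 & y = rev (query_word C)].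
Definition aY1 (y : word) : Prop := A (rev y) /\ size y <= N.
Definition aY2 (y : word) : Prop := aqueried y /\ ~ A (rev y).
Definition alive1 := live_ex aY1 (accepting_path (@successors V)).

(** The search at [u] runs through the suffixes of the word listed there, as bits are added in
    front, and its budget is what the bound [N] leaves. *)
Definition list_model (g : fact word) : Prop :=
  match g.1, g.2 with
  | [:: 8], [:: d; u] => exists j, [/\ d = nseq j true, size u + j <= r & odd (a %/ 2 ^ (size u + j))]
  | [:: 9], [:: u; w; v] => [/\ u \in S, suffix w (listed u) & v = nseq (N - size w) false]
  | [:: 10], [:: u; w] => u \in S /\ w = listed u
  | [:: 11], [:: u; w] => u = w /\ size u <= r
  | [:: 12], [:: d; v] => exists j, [/\ j <= e, d = nseq (e - j) true & v = nseq (2 ^ j) false]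
  | [:: 13], [:: u; v] => exists p, rev x = p ++ u /\
      v = rev (encode (map Bit p)) ++ rev (code_pre M V)
  | [:: 14], [:: v] => v = rev code_post ++ rev (encode (map Bit (rev x))) ++ rev (code_pre M V)
  | _, _ => False
  end.

Definition negative_model (g : fact word) : Prop :=
  match g.1, g.2 with [:: 1; 2], [:: y] => aY2 y | _, _ => False end.

Definition other_model (g : fact word) : Prop :=
  match g.1 with
  | [:: k] => if k <= 7 then oracle_model M A alive0 g else list_model g
  | _ => False
  end.

Definition accept_model : fact word -> Prop :=
  full_model (sim_model aY0 (conf_of osuccs) alive0)
    (sim_model aY1 (conf_of (@successors V)) alive1) negative_model other_model.

Section Clauses.
Variable E : fact word -> Prop.
Hypothesis EL : forall k args, 8 <= k -> E ([:: k], args) <-> list_model ([:: k], args).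
Hypothesis ES0 : forall y, E (fStart 0 y) <-> aY0 y.
Hypothesis ES1 : forall y, E (fStart 1 y) <-> aY1 y.
Hypothesis ES2 : forall y, E (fStart 2 y) <-> aY2 y.
Hypothesis EX : forall args, E ([::], args) <-> args = [:: rev x].

Let E8 d u : E ([:: 8], [:: d; u]) <-> list_model ([:: 8], [:: d; u]) := @EL 8 _ isT.
Let E9 u w v : E ([:: 9], [:: u; w; v]) <-> list_model ([:: 9], [:: u; w; v]) := @EL 9 _ isT.
Let E10 u w : E ([:: 10], [:: u; w]) <-> list_model ([:: 10], [:: u; w]) := @EL 10 _ isT.
Let E11 u w : E ([:: 11], [:: u; w]) <-> list_model ([:: 11], [:: u; w]) := @EL 11 _ isT.
Let E12 u w : E ([:: 12], [:: u; w]) <-> list_model ([:: 12], [:: u; w]) := @EL 12 _ isT.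
Let E13 u w : E ([:: 13], [:: u; w]) <-> list_model ([:: 13], [:: u; w]) := @EL 13 _ isT.
Let E14 u : E ([:: 14], [:: u]) <-> list_model ([:: 14], [:: u]) := @EL 14 _ isT.

Let tE as_ v c : inst_term as_ (cv c v) = c ++ as_ v.
Proof. by rewrite /inst_term /= cats0. Qed.
Let cE as_ c : inst_term as_ (cst c) = c.
Proof. by rewrite /inst_term /= cats0. Qed.

Lemma consume_node b d u : E ([:: 8], [:: true :: d; u]) -> E ([:: 8], [:: d; b :: u]).
Proof.
move=> /E8[[|j] []] // [dE] ur od; apply/E8; exists j.
by rewrite /= addSnnS.
Qed.

Lemma list_clauses_model : models E (list_clauses r a e).
Proof.
move=> c as_; rewrite /list_clauses mem_cat => /orP[].
  case/mapP=> i; rewrite mem_filter mem_iota ltnS => /andP[od ir] -> /=; apply/holdsE => /= _.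
  by left; rewrite /inst /= !cE; apply/E8; exists i; rewrite add0n.
have st := (tE, cE, cat0s).
rewrite !inE => /orP[/eqP->|]; first by
  apply/holdsE => /=; rewrite /inst /= !st => -[/consume_node En _]; left; apply: En.
case/orP=> [/eqP->|]; first by
  apply/holdsE => /=; rewrite /inst /= !st => -[/consume_node En _]; left; apply: En.
case/orP=> [/eqP->|].
  apply/holdsE => /= _; rewrite /inst /= !st; left; apply/E12.
  by exists 0; rewrite subn0.
case/orP=> [/eqP->|].
  apply/holdsE => /=; rewrite /inst /= !st => -[/E12[j [je dE vE]] _]; left.
  rewrite /inst_term /= cats0; apply/E12; exists j.+1.
  case ej: (e - j) dE => [|m] //= [->]; split.
  - by lia.
  - by congr nseq; lia.
  - by rewrite vE -nseqD addnn -mul2n -expnS.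
case/orP=> [/eqP->|].
  apply/holdsE => /=; rewrite /inst /= !st => -[/E8[j [dE ur od]] [/E12[i [ie eE vE]] _]]; left.
  have j0 : j = 0 by case: j dE {ur od}.
  have {}ie : i = e by move: (congr1 size eE); rewrite size_nseq /=; lia.
  rewrite j0 addn0 in ur od; apply/E9; split.
  - by rewrite mem_listing ur od.
  - exact: suffix0s.
  - by move: vE; rewrite ie /= subn0.
case/orP=> [/eqP->|].
  apply/holdsE => /=; rewrite /inst /= !st => -[/E9[uS /suffixP[s sE] vE] _]; left.
  have := congr1 size vE; have [_] := listedP uS; rewrite sE size_cat size_nseq /= => h1 h2.
  apply/E10; split=> //; rewrite sE; case: (s) h1 => //= b s' h1; exfalso; lia.
case/orP=> [/eqP->|].
  apply/holdsE => /=; rewrite /inst /= !st => -[/E9[uS /suffixP[s sE] vE] _].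
  case/lastP: s sE => [|s b] sE; first by left; apply/E10.
  right; rewrite cat_rcons in sE.
  have vE' : as_ vR = nseq (N - size (b :: as_ vL)) false.
    by case nE : (N - size (as_ vL)) vE => [|m] //= [->]; congr nseq; lia.
  have E9b : E ([:: 9], [:: as_ vY; b :: as_ vL; as_ vR]).
    by apply/E9; split=> //; apply/suffixP; exists s.
  by case: (b) E9b => E9b; [right; left | left].
case/orP=> [/eqP->|].
  apply/holdsE => /=; rewrite /inst /= !st => -[/E10[uS wE] _]; left.
  by apply/ES1; rewrite wE; apply: listedP.
case/orP=> [/eqP->|].
  apply/holdsE => /=; rewrite /inst /= !st => -[/E10[uS wE] [/E10[uS' wE'] _]]; left.
  apply/E11; rewrite wE in wE'; split; first exact: listed_unique wE'.
  by move: uS; rewrite mem_listing => /andP[].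
do 2 (case/orP=> [/eqP->|]; first by apply/holdsE => /=; rewrite /inst /= !st => -[/E11[[uE] ur] _];
   left; apply/E11; split=> //; apply: ltnW).
do 6 (case/orP=> [/eqP->|]; first by apply/holdsE => /=; rewrite /inst /= !st => -[/E11[]]).
move=> /eqP->; apply/holdsE => /=; rewrite /inst /= !st => -[/ES1[Ay _] [/ES2[_ nA] _]].
exact: nA Ay.
Qed.

Lemma image_clauses_model : models E (image_clauses M V e e').
Proof.
have st := (tE, cE, cat0s).
have copy b as_ : E ([:: 13], [:: b :: as_ vY; as_ vR]) ->
    E ([:: 13], [:: as_ vY; rev (code (Bit b)) ++ as_ vR]).
  move=> /E13[p [xE vE]]; apply/E13; exists (rcons p b); split; first by rewrite xE cat_rcons.
  by rewrite vE map_rcons -cats1 encode_cat rev_cat -catA; congr (_ ++ _).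
move=> c as_; rewrite /image_clauses !inE => /orP[/eqP->|].
  apply/holdsE => /=; rewrite /inst /= !st => -[/EX[yE] _]; left.
  by apply/E13; exists [::]; split=> //=; rewrite -yE.
do 2 (case/orP=> [/eqP->|]; first by
  apply/holdsE => /=; rewrite /inst /= !st => -[/copy H _]; left).
case/orP=> [/eqP->|/eqP->].
  apply/holdsE => /=; rewrite /inst /= !st => -[/E13[p [xE vE]] _]; left.
  by apply/E14; rewrite cats0 in xE; rewrite /list_model /= xE vE.
apply/holdsE => /=; rewrite /inst /= !st.
move=> [/E14 LE [/E12[j [je dE RE]] _]]; left; rewrite /inst_term /= cats0.
have jE : j = e' by move: (congr1 size dE); rewrite !size_nseq; lia.
have rev_cat4 (b c' d g : word) : rev (b ++ c' ++ d ++ g) = rev g ++ (rev d ++ (rev c' ++ rev b)).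
  by rewrite !rev_cat !catA.
apply/ES0; rewrite /aY0 reject_codeE rev_cat4 rev_nseq RE jE; congr (_ ++ _).
exact: LE.
Qed.

End Clauses.

Lemma aRM0 : run_model query aY0 (conf_of osuccs) alive0.
Proof.
apply: (run_model_ex (@oracle_succsE M A)) => y ->; apply: accepting_pathP.
by rewrite oracle_succ_rel revK.
Qed.

Lemma aRM1 : run_model none aY1 (conf_of (@successors V)) alive1.
Proof. by apply: run_model_ex => // y [/VA Ay _]; apply: accepting_pathP. Qed.

Lemma accept_model_models E : (forall g, g.1 <> [::] -> (E g <-> accept_model g)) ->
  (forall args, E ([::], args) <-> args = [:: rev x]) -> models E (accept_theory M V r a e e').
Proof.
move=> EP EX.
have EM0 k h args : 0 < k < 6 -> E (k :: 0 :: h, args) <->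
    sim_model aY0 (conf_of osuccs) alive0 (k :: 0 :: h, args).
  by move=> k6; rewrite EP // /accept_model /full_model /=; case: ifP => //; rewrite k6.
have EM1 k h args : 0 < k < 6 -> E (k :: 1 :: h, args) <->
    sim_model aY1 (conf_of (@successors V)) alive1 (k :: 1 :: h, args).
  by move=> k6; rewrite EP // /accept_model /full_model /=; case: ifP => //; rewrite k6.
have EO k args : 6 <= k <= 7 -> E ([:: k], args) <-> oracle_model M A alive0 ([:: k], args).
  by move=> /andP[_ k7]; rewrite EP // /accept_model /full_model /other_model /= k7.
have EL k args : 8 <= k -> E ([:: k], args) <-> list_model ([:: k], args).
  by move=> k8; rewrite EP // /accept_model /full_model /other_model /= leqNgt k8.
have ES0 y : E (fStart 0 y) <-> aY0 y by apply: EM0.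
have ES1 y : E (fStart 1 y) <-> aY1 y by apply: EM1.
have ES2 y : E (fStart 2 y) <-> aY2 y by rewrite EP.
have next y p C : alive0 y p -> conf_of osuccs y p = Some C -> ~~ accepting C.1 ->
    exists n, alive0 y (n :: p).
  move=> Lp cp na; apply: (live_ex_next _ Lp cp na) => y' ->; apply: accepting_pathP.
  by rewrite oracle_succ_rel revK.
rewrite /accept_theory.
apply/models_cat; split; first exact: (sim_theory_model aRM0 EM0).
apply/models_cat; split.
  by apply: (exists_model aRM0 EM0) => y p C Lp cp _ na; apply: next Lp cp na.
apply/models_cat; split.
  apply: (oracle_clauses_model (Y1 := aY1) (Y2 := aY2) _ _ _ EM0 EO ES1 ES2).
  - by move=> w [+ _]; rewrite revK.
  - by move=> w [_]; rewrite revK.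
  - move=> y p C Lp cp Cq; have yE := live_start aRM0 Lp; rewrite yE in Lp cp.
    split=> Aw; split; rewrite ?revK //; last by exists p, C.
    rewrite size_rev; apply: leq_trans (tape_word_size cp) _; rewrite size_rev.
    apply: leq_trans nB; rewrite leq_add2r leq_add2l.
    by apply: conf_of_time cp; rewrite revK oracle_succ_rel; apply: Mtime.
apply/models_cat; split.
  case: ifP => // /negbT na; apply: (oracle_live_model EM0) => y p C Lp cp Cq.
  have naC : ~~ accepting C.1 by rewrite (eqP Cq).
  (* The query state has a single successor, so the accepting run continues with choice 0, as
     [oracle_live] demands. *)
  have [n Ln] := next y p C Lp cp naC; suff n0 : n = 0 by rewrite n0 in Ln.
  have [C' ] := live_conf aRM0 Ln; rewrite /= cp /= /oracle_succs.
  by rewrite /is_query in Cq; rewrite Cq; case: (n) => [|[|?]].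
rewrite /certify_yes; apply/models_cat; split.
  apply/models_cat; split; first exact: (sim_theory_model aRM1 EM1).
  apply: (exists_model aRM1 EM1) => y p C Lp cp _ na.
  by apply: (live_ex_next _ Lp cp na) => y' [/VA Ay _]; apply: accepting_pathP.
apply/models_cat; split; first exact: list_clauses_model EL ES1 ES2.
exact: image_clauses_model EL ES0 EX.
Qed.

Definition aPs0 (y : word) : seq (seq nat) :=
  [seq drop j (accepting_path osuccs y) | j <- iota 0 T0.+1].
Definition aPs1 (y : word) : seq (seq nat) :=
  [seq drop j (accepting_path (@successors V) y) | j <- iota 0 T1.+1].
Definition aYs1 : seq word := map rev (words A N).

Lemma suffix_drops (s p : seq nat) T : size s <= T -> suffix p s ->
  p \in [seq drop j s | j <- iota 0 T.+1] /\ size p <= T.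
Proof.
move=> sT /suffixP[q qE]; split; last by apply: leq_trans sT; rewrite qE size_cat leq_addl.
apply/mapP; exists (size q); last by rewrite qE drop_size_cat.
by rewrite mem_iota ltnS; apply: leq_trans sT; rewrite qE size_cat leq_addr.
Qed.

Lemma alive0_size y p : alive0 y p -> p \in aPs0 y /\ size p <= T0.
Proof.
case=> -> sp; apply: suffix_drops sp.
have [|C cE _] := @accepting_pathP _ osuccs (rev f); first by rewrite oracle_succ_rel revK.
by apply: conf_of_time cE; rewrite revK oracle_succ_rel; apply: Mtime.
Qed.

Lemma alive1_size y p : alive1 y p -> p \in aPs1 y /\ size p <= T1.
Proof.
case=> -[Ay yN] sp; apply: suffix_drops sp.
have [C cE _] := accepting_pathP ((VA (rev y)).1 Ay).
apply: leq_trans (tV_mono yN); apply: conf_of_time cE.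
by have := @Vtime (rev y); rewrite size_rev; exact: id.
Qed.

Let W := words predT r.

Definition list_cover : seq (fact word) :=
  flatten [seq [seq fNode (nseq j true) u | j <- iota 0 r.+1] | u <- W] ++
  flatten [seq [seq fSearch u (drop j (listed u)) (nseq (N - size (drop j (listed u))) false)
                  | j <- iota 0 N.+1] | u <- W] ++
  [seq fListed u (listed u) | u <- W] ++ [seq fEqual u u | u <- W].

Definition image_cover : seq (fact word) :=
  [seq fPower (nseq (e - j) true) (nseq (2 ^ j) false) | j <- iota 0 e.+1] ++
  [seq fCopy (drop j (rev x)) (rev (encode (map Bit (take j (rev x)))) ++ rev (code_pre M V))
     | j <- iota 0 (size x).+1] ++
  [:: fImage (rev code_post ++ rev (encode (map Bit (rev x))) ++ rev (code_pre M V))] ++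
  [seq fStart 2 (if conf_of osuccs (rev f) p is Some C then rev (query_word C) else [::])
     | p <- aPs0 (rev f)].

Lemma size_list_cover : size list_cover <= 2 ^ r.+1 * (r + N + 4).
Proof.
rewrite /list_cover size_cat4 !size_map.
have h1 : size (flatten [seq [seq fNode (nseq j true) u | j <- iota 0 r.+1] | u <- W])
    <= size W * r.+1 by apply: size_flatten_le => u _; rewrite size_map size_iota.
have h2 : size (flatten [seq [seq fSearch u (drop j (listed u)) (nseq (N - size (drop j (listed u))) false)
     | j <- iota 0 N.+1] | u <- W]) <= size W * N.+1.
  by apply: size_flatten_le => u _; rewrite size_map size_iota.
apply: (@leq_trans (size W * (r + N + 4))); last by rewrite leq_mul2r size_words_le orbT.
by move: h1 h2; move: (size W) (size (flatten _)) (size (flatten _)) N => w u v N'; nia.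
Qed.

Lemma size_image_cover : size image_cover <= e + size x + T0 + 4.
Proof. by rewrite /image_cover size_cat4 !size_map !size_iota /=; lia. Qed.

Lemma size_code_pre : size (code_pre M V) + 4 * size x + size code_post <= size f.
Proof.
rewrite reject_codeE.
have -> : size (code_pre M V ++ encode (map Bit (rev x)) ++ code_post ++ nseq (2 ^ e') false) =
  size (code_pre M V) + 4 * size x + size code_post + 2 ^ e'.
  by rewrite size_cat4 size_encode size_map size_rev size_nseq.
exact: leq_addr.
Qed.

Lemma mem_cover4 (g : fact word) a1 a2 a3 a4 i : 
  g \in nth [::] [:: a1; a2; a3; a4] i -> g \in a1 ++ a2 ++ a3 ++ a4.
Proof.
by case: i => [|[|[|[|i]]]] /=; rewrite mem_cat4 ?nth_nil // => ->; rewrite ?orbT.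
Qed.

Lemma list_model_cover k args : list_model ([:: k], args) ->
  ([:: k], args) \in list_cover ++ image_cover /\ fits (r + N + 15) ([:: k], args).
Proof.
have bits (g : fact word) : g \in list_cover -> g \in list_cover ++ image_cover.
  by move=> gl; rewrite (mem_cat g list_cover) gl.
have imgs (g : fact word) : g \in image_cover -> g \in list_cover ++ image_cover.
  by move=> gl; rewrite (mem_cat g list_cover) gl orbT.
have kf j (l : seq word) : j <= 14 -> size l <= 4 -> (forall u : word, u \in l -> size u <= r + N + 15) ->
    fits (r + N + 15) ([:: j], l).
  move=> j14 l4 lP; rewrite /fits l4 andbT; apply/allP => u; rewrite inE => /orP[/eqP->|/lP//].
  by rewrite [key _]/= size_key_cons /=; lia.
have Wm (u : word) : size u <= r -> u \in W by rewrite mem_words andbT.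
have Sr (u : word) : u \in S -> size u <= r by rewrite mem_listing => /andP[].
have cp := size_code_pre.
rewrite /list_model; case: k => [|[|[|[|[|[|[|[|[|[|[|[|[|[|[|k]]]]]]]]]]]]]]] //;
  case: args => [|u [|v [|w [|? ?]]]] //.
- case=> j [-> ur _]; split.
    apply: bits; apply: (@mem_cover4 _ _ _ _ _ 0); apply/flatten_mapP; exists v; first (apply: Wm; exact: leq_trans (leq_addr _ _) ur).
    by apply/mapP; exists j => //; rewrite mem_iota; lia.
  by apply: kf => // q; rewrite !inE => /orP[] /eqP->; rewrite ?size_nseq; lia.
- case=> uS /suffixP[s sE] ->; have [_ lN] := listedP uS; rewrite sE size_cat in lN; split.
    apply: bits; apply: (@mem_cover4 _ _ _ _ _ 1); apply/flatten_mapP; exists u; first exact/Wm/Sr.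
    apply/mapP; exists (size s).
      by rewrite mem_iota ltnS; exact: leq_trans (leq_addr _ _) lN.
    by rewrite sE drop_size_cat.
  have ur := Sr _ uS; have vN : size v <= N := leq_trans (leq_addl _ _) lN.
  by apply: kf => // q; rewrite !inE => /or3P[] /eqP->; rewrite ?size_nseq; lia.
- case=> uS ->; have [_ lN] := listedP uS; have ur := Sr _ uS; split.
    apply: bits; apply: (@mem_cover4 _ _ _ _ _ 2); apply/mapP; exists u => //; exact: Wm.
  by apply: kf => // q; rewrite !inE => /orP[] /eqP->; lia.
- case=> <- ur; split.
    apply: bits; apply: (@mem_cover4 _ _ _ _ _ 3); apply/mapP; exists u => //; exact: Wm.
  by apply: kf => // q; rewrite !inE => /orP[] /eqP->; lia.
- case=> j [je -> ->]; split.
    by apply: imgs; apply: (@mem_cover4 _ _ _ _ _ 0); apply/mapP; exists j; rewrite ?mem_iota.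
  have jN : 2 ^ j <= N by rewrite leq_exp2l.
  have eN : e < N by apply: ltn_expl.
  by apply: kf => // q; rewrite !inE => /orP[] /eqP->; rewrite size_nseq; lia.
- case=> p [xE ->]; have := congr1 size xE; rewrite size_rev size_cat => sx; split.
    apply: imgs; apply: (@mem_cover4 _ _ _ _ _ 1); apply/mapP; exists (size p).
      by rewrite mem_iota; lia.
    by rewrite xE drop_size_cat // take_size_cat.
  apply: kf => // q; rewrite !inE => /orP[] /eqP->; first by lia.
  rewrite size_cat !size_rev size_encode size_map; lia.
- move=> h; have {h}-> : u = rev code_post ++ rev (encode (map Bit (rev x))) ++ rev (code_pre M V) := h.
  split; first by apply: imgs; apply: (@mem_cover4 _ _ _ _ _ 2); rewrite inE.
  apply: kf => // q; rewrite !inE => /eqP->.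
  by rewrite size_cat [size (rev _ ++ rev _)]size_cat !size_rev size_encode size_map size_rev; lia.
Qed.

Definition accept_cover : seq (fact word) :=
  sim_cover 0 osuccs [:: rev f] aPs0 (size f) ++
  sim_cover 1 (@successors V) aYs1 aPs1 N ++
  oracle_cover M A [:: rev f] aPs0 (size f) T0 ++
  (list_cover ++ image_cover).

Definition accept_size : nat := sim_const M V + N + T1 + r + 15.
Local Notation F := accept_size.

Lemma accept_model_cover g : accept_model g ->
  [/\ g \in accept_cover, fits (F * F) g & g.1 <> [::]].
Proof.
have FE : F = sim_const M V + N + T1 + r + 15 by [].
have fW w m g' : w <= sim_const M V -> m <= F -> fits (w * m) g' -> fits (F * F) g'.
  by move=> wF mF; apply: fitsW; apply: leq_mul => //; apply: leq_trans wF _; rewrite FE; lia.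
have YP0 y : aY0 y -> y \in [:: rev f] /\ size y <= size f.
  by move=> ->; rewrite inE eqxx size_rev.
have YP1 y : aY1 y -> y \in aYs1 /\ size y <= N.
  move=> [Ay yN]; split=> //; rewrite -[y]revK mem_map; last exact: (can_inj revK).
  by rewrite mem_words size_rev yN Ay.
case: g => -[|k [|t h]] args; rewrite /accept_model /full_model //=.
  rewrite /other_model /=; case: ifP => _ om.
    have [fin ff] := oracle_model_cover aRM0 YP0 alive0_size om; split=> //.
      by rewrite /accept_cover mem_cat4 fin !orbT.
    apply: fW ff; first by rewrite /sim_const; lia.
    by apply: (leq_trans nB); rewrite FE; lia.
  have [fin ff] := list_model_cover om; split=> //.
    by rewrite /accept_cover mem_cat4 fin !orbT.
  apply: fitsW ff; apply: (@leq_trans F); first by rewrite FE; lia.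
  by rewrite leq_pmull // FE addnC.
case: ifP => // k6.
case: t => [|[|[|t]]] // sm.
- have [fin ff] := sim_model_cover (oracle_succs_branch A (M := M))
      (oracle_succs_size (A := A) (M := M)) aRM0 YP0 alive0_size sm; split=> //.
    by rewrite /accept_cover mem_cat4 fin.
  apply: fW ff; first by rewrite /sim_const; lia.
  by apply: (leq_trans nB); rewrite FE; lia.
- have [fin ff] := sim_model_cover (@successors_branch V) (@successors_size V) aRM1
    YP1 alive1_size sm; split=> //.
    by rewrite /accept_cover mem_cat4 fin !orbT.
  apply: fW ff; first by rewrite /sim_const; lia.
  by rewrite FE; lia.
- move: sm; rewrite /negative_model /=; case: k k6 => [|[|k]] // _; case: h => [|? ?] //.
  case: args => [|y [|? ?]] // -[[p [C [Lp cp Cq yE]]] _].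
  have [pP _] := alive0_size Lp; split=> //.
    rewrite /accept_cover mem_cat4; apply/orP; right; apply/orP; right; apply/orP; right.
    rewrite (mem_cat _ list_cover); apply/orP; right; apply: (@mem_cover4 _ _ _ _ _ 3).
    by apply/mapP; exists p; rewrite // cp yE.
  have T0B : size p <= T0 by have [] := alive0_size Lp.
  have F15 : F <= F * F by rewrite leq_pmull // FE addnC.
  rewrite /fits andbT; apply/allP => z; rewrite !inE => /orP[] /eqP->.
    by apply: leq_trans F15; rewrite FE size_key_cons /=; lia.
  rewrite yE size_rev; apply: leq_trans F15; apply: leq_trans (tape_word_size cp) _.
  by rewrite size_rev; move: nB T0B; rewrite FE; lia.
Qed.

(** The bounds [c1] to [c5] count the run of M, the positive certificates, the reading of queries,
    the list, and the image with the remaining facts. Only the certificates and the list carry the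
    factor [X], here the bound [2 ^ r.+1] on the number of listed words. *)
Lemma accept_count X K nf T n1 t1 c1 c2 c3 c4 c5 : 0 < X -> 10 <= K -> nf + T + 1 <= K ->
    n1 <= K -> t1 <= K ->
    c1 <= nf + T.+1 * K + 2 -> c2 <= X * (n1 + t1 * K + 2) -> c3 <= T.+1 * (2 * (nf + T + 2)) ->
    c4 <= X * K -> c5 <= 3 * K ->
  (c1 + c2 + c3 + (c4 + c5)) * (6 * (K * K).+1) <= X * K ^ 6.
Proof.
move=> X0 K10 nK n1K t1K h1 h2 h3 h4 h5.
have TK : T.+1 * K <= K * K by rewrite leq_mul2r; apply/orP; right; lia.
have tK : t1 * K <= K * K by rewrite leq_mul2r; apply/orP; right.
have T2 : T.+1 * (2 * (nf + T + 2)) <= 2 * (K * K) + 2 * K.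
  apply: (@leq_trans (K * (2 * K.+1))); [by apply: leq_mul; lia | by lia].
have K2 : 10 * K <= K * K by rewrite leq_mul2r K10 orbT.
have h2' : c2 <= X * (K * K + K * K).
  by apply: leq_trans h2 _; rewrite leq_mul2l; apply/orP; right; lia.
have XKK : K * K <= X * (K * K) by rewrite leq_pmull.
have XK : X * K <= X * (K * K) by rewrite leq_mul2l; apply/orP; right; lia.
have tot : c1 + c2 + c3 + (c4 + c5) <= 10 * (X * (K * K)).
  rewrite mulnDr in h2'; have h3' := leq_trans h3 T2; clear h3 T2.
  move: (X * (K * K)) (X * K) (K * K) (T.+1 * K) h2' XKK XK TK h1 h3' K2 h4 => P Q R S'; lia.
have LB : 6 * (K * K).+1 <= 7 * (K * K) by lia.
apply: leq_trans (leq_mul tot LB) _.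
have -> : 10 * (X * (K * K)) * (7 * (K * K)) = X * (K * K) * (K * K) * 70 by lia.
have -> : X * K ^ 6 = X * (K * K) * (K * K) * (K * K).
  by rewrite !expnS expn0 muln1; lia.
by rewrite leq_mul2l; apply/orP; right; nia.
Qed.

Lemma accept_complete k : x = encode (tok_theory (accept_theory M V r a e e')) ++ nseq k false ->
  2 ^ r * F ^ 6 <= 2 ^ size x -> satisfiable x.
Proof.
move=> xE szB; apply: (model_satisfiable (L := F * F) accept_model_cover accept_model_models xE).
have FE : F = sim_const M V + N + T1 + r + 15 by [].
have C0 : 2 * extra_tapes M + 4 <= F by rewrite FE /sim_const; lia.
have C1 : 2 * extra_tapes V + 4 <= F by rewrite FE /sim_const; lia.
have eN : e < N by apply: ltn_expl.
have xf : size x <= size f by move: size_code_pre; lia.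
apply: (@leq_trans (2 ^ r.+1 * F ^ 6)); last by rewrite [2 ^ r.+1]expnS [2 ^ (size x).+1]expnS -mulnA leq_mul2l szB.
rewrite /accept_cover size_cat4 [size (list_cover ++ _)]size_cat.
apply: (accept_count (nf := size f) (T := T0) (n1 := N) (t1 := T1.+1)).
- by rewrite expn_gt0.
- by rewrite FE; lia.
- by rewrite FE; lia.
- by rewrite FE; lia.
- by rewrite FE; lia.
- have := @size_sim_cover M 0 osuccs [:: rev f] aPs0 (size f) T0.+1; rewrite mul1n.
  move=> h; apply: (leq_trans (h _)); first by move=> y _; rewrite size_map size_iota.
  by rewrite leq_add2r leq_add2l leq_mul2l C0 orbT.
- have aX : size aYs1 <= 2 ^ r.+1 by rewrite size_map size_words dA; apply: ltnW.
  apply: leq_trans (size_sim_cover 1 _ N (b := T1.+1) _) _.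
    by move=> y _; rewrite size_map size_iota.
  by apply: leq_mul => //; rewrite leq_add2r leq_add2l leq_mul2l C1 orbT.
- have := @size_oracle_cover M A [:: rev f] aPs0 (size f) T0 T0.+1; rewrite mul1n.
  by apply=> y _; rewrite size_map size_iota.
- apply: (leq_trans size_list_cover); rewrite leq_mul2l; apply/orP; right.
  by rewrite FE; lia.
- by apply: (leq_trans size_image_cover); move: nB; rewrite FE; lia.
Qed.

End Model.

(** * Choice of the parameters *)

(** One number serves as shift and as exponent; it may be increased at will, so two bounds can be
    brought to a common one. *)
Definition poly_bounded (P : nat -> nat) : Prop := exists c, forall n, P n <= (n + c) ^ c.

Lemma poly_bound_mono n c d : c <= d -> (n + c) ^ c <= (n + d) ^ d.
Proof.
move=> cd; case: d cd => [|d] cd; first by case: c cd.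
apply: (@leq_trans ((n + d.+1) ^ c)); first by apply: exp_mono; rewrite leq_add2l.
by rewrite leq_pexp2l // addnS.
Qed.

Lemma poly_bounded_const k : poly_bounded (fun=> k).
Proof.
exists k.+1 => n; apply: (@leq_trans (k.+1 ^ 1)); first by rewrite expn1.
apply: (@leq_trans ((n + k.+1) ^ 1)); first by rewrite !expn1 leq_addl.
by rewrite leq_pexp2l // addnS.
Qed.

Lemma poly_bounded_id : poly_bounded id.
Proof. by exists 1 => n; rewrite expn1 leq_addr. Qed.

Lemma poly_boundedM P Q : poly_bounded P -> poly_bounded Q -> poly_bounded (fun n => P n * Q n).
Proof.
move=> [c cP] [d dQ]; exists (c + d) => n; rewrite expnD; apply: leq_mul.
  by apply: leq_trans (cP n) _; apply: exp_mono; lia.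
by apply: leq_trans (dQ n) _; apply: exp_mono; lia.
Qed.

Lemma poly_boundedD P Q : poly_bounded P -> poly_bounded Q -> poly_bounded (fun n => P n + Q n).
Proof.
move=> [c cP] [d dQ]; exists (c + d).+2 => n.
have h1 : P n <= (n + (c + d).+1) ^ (c + d).+1.
  by apply: leq_trans (cP n) _; apply: poly_bound_mono; lia.
have h2 : Q n <= (n + (c + d).+1) ^ (c + d).+1.
  by apply: leq_trans (dQ n) _; apply: poly_bound_mono; lia.
apply: leq_trans (leq_add h1 h2) _; rewrite addnn -mul2n [leqRHS]expnS; apply: leq_mul; first by lia.
by apply: exp_mono; lia.
Qed.

Lemma poly_boundedX P k : poly_bounded P -> poly_bounded (fun n => P n ^ k).
Proof.
move=> PP; elim: k => [|k IH]; first exact: poly_bounded_const.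
by case: (poly_boundedM PP IH) => c cP; exists c => n; rewrite expnS.
Qed.

Lemma poly_bounded_comp P Q : poly_bounded P -> poly_bounded Q -> poly_bounded (fun n => P (Q n)).
Proof.
move=> [c cP] PQ; have [d dQ] := poly_boundedX c (poly_boundedD PQ (poly_bounded_const c)).
by exists d => n; apply: leq_trans (cP _) (dQ n).
Qed.

Lemma poly_bounded_exp P : poly_bounded P ->
  exists d N, forall n, N <= n -> P n <= n ^ d.
Proof.
move=> [c cP]; exists (2 * c), (c + 2) => n nN; apply: leq_trans (cP n) _.
by rewrite expnM; apply: exp_mono; nia.
Qed.

Section Core.
Variables (M : ontm) (V : ntm) (A : language) (tM tV : nat -> nat).
Hypothesis VA : forall w, A w <-> accepts (@step V) w.
Hypothesis Mtime : forall x, halts_within (oracle_step A (M := M)) (tM (size x)) x.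
Hypothesis Vtime : forall x, halts_within (@step V) (tV (size x)) x.
Hypothesis tV_mono : forall m n, m <= n -> tV m <= tV n.
Hypothesis MS : forall x, satisfiable x <-> accepts (oracle_step A (M := M)) x.

Definition code_size (k n : nat) : nat := size (code_pre M V) + 4 * n + size code_post + k.

Lemma size_reject_code k x : size (reject_code M V k x) = code_size k (size x).
Proof.
rewrite reject_codeE /code_size; move: (code_pre _ _) code_post => p q.
by rewrite size_cat4 size_encode size_map size_rev size_nseq.
Qed.

(** The diagonal argument for parameters that fit together. The clauses depend on the length [n]
    through the parameters but not on the code itself, which they read from the distinguished fact;
    so no fixed point has to be constructed. *)
Lemma no_parameters r e e' n : let k := 2 ^ e' in
  density A (2 ^ e) < 2 ^ r.+1 -> e' <= e ->
  4 * size (tok_theory (accept_theory M V r (density A (2 ^ e)) e e')) <= n ->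
  4 * (reject_size M V tM tV n * reject_size M V tM tV n) <= k ->
  code_size k n + tM (code_size k n) + 1 <= 2 ^ e ->
  2 ^ r * accept_size M V tV r e ^ 6 <= 2 ^ n -> False.
Proof.
move=> k ar ee szT kZ nB nF.
set th := accept_theory _ _ _ _ _ _ in szT.
(* Padding gives the code exactly the length for which the parameters were chosen. *)
pose x := encode (tok_theory th) ++ nseq (n - 4 * size (tok_theory th)) false.
have sx : size x = n by rewrite size_cat size_nseq size_encode; lia.
have Bx : size (reject_code M V k x) + tM (size (reject_code M V k x)) + 1 <= 2 ^ e.
  by rewrite size_reject_code sx.
have [Sx|nSx] := pselect (satisfiable x).
  have /MS/(reject_sound VA) nA := accept_sound VA Mtime ar erefl ee erefl Bx Sx.
  by apply: nA; apply/MS.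
apply: (nSx); apply: (accept_complete VA Mtime Vtime tV_mono ar erefl ee _ Bx erefl).
  apply/MS; apply: (reject_complete VA Mtime Vtime tV_mono); first by move/MS; apply: nSx.
  by rewrite sx.
by rewrite sx.
Qed.

Lemma tok_theory_cat th th' : tok_theory (th ++ th') = tok_theory th ++ tok_theory th'.
Proof. by rewrite /tok_theory map_cat flatten_cat. Qed.

Lemma size_tok_theory_cat th th' :
  size (tok_theory (th ++ th')) = size (tok_theory th) + size (tok_theory th').
Proof. by rewrite tok_theory_cat size_cat. Qed.

Definition theory_const : nat :=
  size (tok_theory (sim_theory (@is_query M) 0)) +
  size (tok_theory (exists_clauses (@is_query M) 0)) + size (tok_theory (oracle_clauses M)) +
  size (tok_theory (oracle_live M)) + size (tok_theory (certify_yes V)) +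
  size (tok_theory (list_clauses 0 0 0)) + size (tok_theory (image_clauses M V 0 0)) + 100.

Lemma size_tok_term t : size (tok_term t) = size t.1 + size t.2 + 1.
Proof. by rewrite /tok_term size_cat size_cat !size_map /= addnA. Qed.

Lemma size_node_clause i :
  size (tok_clause ([::], [:: fNode (cst (nseq i true)) (cst [::])])) = i + 16.
Proof.
rewrite /tok_clause /=; have := size_tok_term (cst (nseq i true)).
by move: (tok_term (cst (nseq i true))) => t; rewrite /= size_nseq !size_cat /=; lia.
Qed.

Lemma size_list_theory r a e :
  size (tok_theory (list_clauses r a e)) <=
  size (tok_theory (list_clauses 0 0 0)) + r.+1 * (r + 16) + e.
Proof.
(* With [a = 0] there are no clauses for digits, and the third of the other clauses is the only one
   that mentions [e]. *)
set P := take 2 (list_clauses 0 0 0); set Q := drop 3 (list_clauses 0 0 0).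
pose pw i : clause := ([::], [:: fPower (cst (nseq i true)) (cst [:: false])]).
have spw i : size (tok_clause (pw i)) = i + size (tok_clause (pw 0)).
  have := size_tok_term (cst (nseq i true)); rewrite /tok_clause /=.
  by move: (tok_term (cst (nseq i true))) => u; rewrite /= size_nseq !size_cat /=; rewrite ?size_cat /=; lia.
have -> : list_clauses 0 0 0 = P ++ [:: pw 0] ++ Q by [].
have -> : list_clauses r a e = [seq ([::], [:: fNode (cst (nseq i true)) (cst [::])])
    | i <- iota 0 r.+1 & odd (a %/ 2 ^ i)] ++ (P ++ [:: pw e] ++ Q) by [].
rewrite !size_tok_theory_cat.
have one_clause c : tok_theory [:: c] = tok_clause c by rewrite /tok_theory /= cats0.
rewrite !one_clause [size (tok_clause (pw e))]spw.
set b := size (tok_theory [seq _ | i <- _]).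
suff : b <= r.+1 * (r + 16).
  by move: (size (tok_theory P)) (size (tok_theory Q)) (size (tok_clause _)) => p q s; lia.
rewrite /b /tok_theory -map_comp.
apply: (@leq_trans (size [seq i <- iota 0 r.+1 | odd (a %/ 2 ^ i)] * (r + 16))).
  apply: size_flatten_le => i; rewrite mem_filter mem_iota => /andP[_ /andP[_ ir]].
  by rewrite [_ i]/= size_node_clause leq_add2r.
by rewrite leq_mul2r size_filter; apply/orP; right; rewrite -[r.+1 in leqRHS](size_iota 0) count_size.
Qed.

Lemma size_image_theory e e' :
  size (tok_theory (image_clauses M V e e')) <= size (tok_theory (image_clauses M V 0 0)) + e.
Proof.
pose im i : clause := ([:: fImage tL; fPower (cst (nseq i true)) tR], [:: fStart 0 ([::], [:: vR; vL])]).
have sim i : size (tok_clause (im i)) = i + size (tok_clause (im 0)).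
  have := size_tok_term (cst (nseq i true)); rewrite /tok_clause /=.
  by move: (tok_term (cst (nseq i true))) => u; rewrite /= size_nseq !size_cat /=; rewrite ?size_cat /=; lia.
set P := take 4 (image_clauses M V 0 0).
have -> : image_clauses M V 0 0 = P ++ [:: im 0] by [].
have -> : image_clauses M V e e' = P ++ [:: im (e - e')] by [].
have one_clause c : tok_theory [:: c] = tok_clause c by rewrite /tok_theory /= cats0.
rewrite !size_tok_theory_cat !one_clause sim.
by move: (size (tok_theory P)) (size (tok_clause _)) => p s; lia.
Qed.

Lemma size_accept_theory r a e e' :
  size (tok_theory (accept_theory M V r a e e')) <= theory_const + r.+1 * (r + 16) + 2 * e.
Proof.
have h1 := size_list_theory r a e; have h2 := size_image_theory e e'.
have h3 : size (tok_theory (if accepting (query_state M) then [::] else oracle_live M)) <=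
    size (tok_theory (oracle_live M)) by case: ifP.
rewrite /accept_theory 6!size_tok_theory_cat /theory_const; move: h1 h2 h3.
by move: (size (tok_theory (if _ then _ else _))) (size (tok_theory (list_clauses _ _ _)))
  (size (tok_theory (image_clauses _ _ _ _))) => u v w; lia.
Qed.

End Core.

Lemma density_mono A m n : m <= n -> density A m <= density A n.
Proof.
move=> mn; rewrite -!size_words; apply: uniq_leq_size; first exact: uniq_words.
by move=> w; rewrite !mem_words => /andP[wm ->]; rewrite (leq_trans wm mn).
Qed.

Lemma poly_time c k : poly_bounded (fun n => c * n ^ k + c).
Proof.
apply: poly_boundedD; last exact: poly_bounded_const.
apply: poly_boundedM; first exact: poly_bounded_const.
exact: poly_boundedX poly_bounded_id.
Qed.

(** With r = 2^h the length n = r^3 beats the clauses, of order r^2, and also the exponent of the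
    model size, r plus a multiple of e, because e is at most linear in h. *)
Lemma parameter_bounds C L q h e : 4 * C + 8 * L + 6 * q * L + 200 <= h -> e <= L * h ->
  4 * (C + (2 ^ h).+1 * (2 ^ h + 16) + 2 * e) <= 2 ^ (3 * h) /\
  2 ^ h + 6 * q * e <= 2 ^ (3 * h).
Proof.
have -> : 2 ^ (3 * h) = 2 ^ h * 2 ^ h * 2 ^ h by rewrite mulnC expnM !expnS expn0 muln1 mulnA.
have hr : h < 2 ^ h by apply: ltn_expl.
move: (2 ^ h) hr => r hr hK eL.
have eLr : e <= L * r by apply: leq_trans eL _; rewrite leq_mul2l ltnW ?orbT.
have qe : 6 * q * e <= 6 * q * L * r by rewrite -[6 * q * L * r]mulnA leq_mul2l eLr orbT.
have rK : (4 * C + 8 * L + 6 * q * L + 200) * r <= r * r by rewrite leq_mul2r; apply/orP; right; lia.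
have rr : 200 * (r * r) <= r * r * r by rewrite mulnC leq_mul2l; apply/orP; right; lia.
have Cr : C <= C * r by rewrite leq_pmulr //; lia.
by rewrite !mulnDl in rK; split; nia.
Qed.

Section Contradiction.
Variables (M : ontm) (V : ntm) (A : language) (tM tV : nat -> nat).
Hypothesis VA : forall w, A w <-> accepts (@step V) w.
Hypothesis Mtime : forall x, halts_within (oracle_step A (M := M)) (tM (size x)) x.
Hypothesis Vtime : forall x, halts_within (@step V) (tV (size x)) x.
Hypothesis tV_mono : forall m n, m <= n -> tV m <= tV n.
Hypothesis tM_poly : poly_bounded tM.
Hypothesis tV_poly : poly_bounded tV.
Hypothesis MS : forall x, satisfiable x <-> accepts (oracle_step A (M := M)) x.
Hypothesis sparse : forall L N, 0 < L ->
  exists2 m, N <= m & forall h, m <= 2 ^ (L * h) -> density A m < 2 ^ (2 ^ h).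

Lemma sparse_oracle_contradiction : False.
Proof.
have pC k := poly_bounded_const k; have pI := poly_bounded_id.
have [d1 [N1 B1]] : exists d N, forall n, N <= n ->
    4 * (reject_size M V tM tV n * reject_size M V tM tV n) <= n ^ d.
  apply: poly_bounded_exp.
  have pq : poly_bounded (fun n => n + tM n + 1).
    exact: poly_boundedD (poly_boundedD pI tM_poly) (pC 1).
  have pZ : poly_bounded (reject_size M V tM tV).
    apply: (poly_boundedD _ (poly_bounded_comp tV_poly pq)).
    exact: poly_boundedD (poly_boundedD (pC (sim_const M V)) pq) tM_poly.
  exact: poly_boundedM (pC 4) (poly_boundedM pZ pZ).
have [d2 [N2 B2]] : exists d N, forall n, N <= n ->
    code_size M V (n ^ d1) n + tM (code_size M V (n ^ d1) n) + 1 <= n ^ d.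
  apply: poly_bounded_exp.
  have pS : poly_bounded (fun n => code_size M V (n ^ d1) n).
    apply: (poly_boundedD _ (poly_boundedX d1 pI)).
    exact: poly_boundedD (poly_boundedD (pC _) (poly_boundedM (pC 4) pI)) (pC _).
  exact: poly_boundedD (poly_boundedD pS (poly_bounded_comp tM_poly pS)) (pC 1).
have [q [N3 B3]] : exists d N, forall n, N <= n ->
    sim_const M V + n + tV n + n + 15 <= n ^ d.
  apply: poly_bounded_exp.
  apply: (poly_boundedD _ (pC 15)); apply: (poly_boundedD _ pI).
  exact: poly_boundedD (poly_boundedD (pC _) pI) tV_poly.
(* The factor 6 is made for [n ^ D <= 2 ^ e] with n = 2^(3h): there 3hD = Lh / 2, while Lh is at
   most e + L and L is at most e. *)
set D := d2.+1; set L := 6 * D; set C := theory_const M V.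
set K := 4 * C + 8 * L + 6 * q * L + 200.
(* Large enough for [h], about [e / L], to exceed [K], [N1] and [N2], and for [2 ^ e] to exceed
   [N3]. *)
set e0 := L * (K + N1 + N2 + 1) + N3.
have [m mB mS] := sparse (L := L) (2 ^ e0) isT.
have m0 : 0 < m by apply: leq_trans mB; rewrite expn_gt0.
(* The density is controlled at [m] only, while the clauses can express powers of two; rounding down
   is harmless as the density is monotone. *)
set e := trunc_log 2 m.
have me : 2 ^ e <= m by apply: trunc_logP.
have em : m < 2 ^ e.+1 by apply: trunc_log_ltn.
have ee0 : e0 <= e by apply: trunc_log_max.
(* Rounded so that e < Lh <= e + L. The left inequality gives [m <= 2 ^ (L * h)], the condition for
   the density bound. *)
set h := (e + L) %/ L.
have hL : L * h <= e + L by rewrite mulnC leq_trunc_div.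
have eh : e < L * h.
  by rewrite mulnC -(ltn_add2r L) -mulSnr; apply: ltn_ceil.
have hK : K + N1 + N2 + 1 <= h.
  rewrite -(leq_pmul2l (isT : 0 < L)); apply: leq_trans (ltnW eh).
  by apply: leq_trans ee0; rewrite leq_addr.
have dA : density A (2 ^ e) < 2 ^ (2 ^ h).
  apply: leq_ltn_trans (density_mono A me) _; apply: mS.
  by apply: leq_trans (ltnW em) _; rewrite leq_exp2l.
have LE : L <= e by apply: leq_trans ee0; rewrite /e0 addn1 mulnS; lia.
have hD : 3 * h * D <= e by move: hL LE; rewrite /L; clearbody D; nia.
set n := 2 ^ (3 * h).
have hn : h < n by apply: leq_trans (ltn_expl h (isT : 1 < 2)) _; rewrite leq_exp2l //; lia.
have nD : n ^ D <= 2 ^ e by rewrite -expnM leq_exp2l.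
have nd : n ^ d2 <= n ^ D by rewrite leq_pexp2l // expn_gt0.
have B2n : code_size M V (n ^ d1) n + tM (code_size M V (n ^ d1) n) + 1 <= 2 ^ e.
  by apply: leq_trans nD; apply: leq_trans nd; apply: B2; lia.
(* As [n] is a power of two, the polynomial padding of the reject code is one too, as doubling
   requires. *)
have kE : 2 ^ (3 * h * d1) = n ^ d1 by rewrite expnM.
have [P4 P3] : 4 * (C + (2 ^ h).+1 * (2 ^ h + 16) + 2 * e) <= n /\ 2 ^ h + 6 * q * e <= n.
  by apply: (@parameter_bounds C L); [rewrite -/K; lia | exact: ltnW].
apply: (@no_parameters M V A tM tV VA Mtime Vtime tV_mono MS (2 ^ h) e (3 * h * d1) n).
- by apply: ltn_trans dA _; rewrite ltn_exp2l.
- rewrite -(@leq_exp2l 2) // kE; apply: leq_trans B2n.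
  by rewrite /code_size; lia.
- apply: leq_trans P4; rewrite leq_mul2l; exact: size_accept_theory.
- by rewrite kE; apply: B1; lia.
- by rewrite kE.
have he : 2 ^ h <= 2 ^ e by rewrite leq_exp2l //; apply: leq_trans hD; rewrite mulnAC leq_pmull.
have eN3 : N3 <= 2 ^ e by apply: leq_trans (ltnW (ltn_expl e (isT : 1 < 2))); lia.
have FB : accept_size M V tV (2 ^ h) e <= 2 ^ (e * q).
  by rewrite expnM; apply: (leq_trans _ (B3 _ eN3)); rewrite /accept_size; lia.
apply: (@leq_trans (2 ^ (2 ^ h) * (2 ^ (e * q)) ^ 6)).
  by rewrite leq_mul2l; apply/orP; right; apply: exp_mono.
by rewrite -expnM -expnD leq_exp2l //; apply: leq_trans P3; rewrite leq_add2l; lia.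
Qed.
End Contradiction.

Section Real.
Import Order.TTheory GRing.Theory Num.Theory.

(** With the exponent c = 1 / L, the bound m <= 2^(Lh) gives m^c <= 2^h. Real powers appear nowhere
    else in the proof. *)
Lemma nonexponential_bound (R : realType) d L N : nonexponential R d -> 0 < L ->
  exists2 m, N <= m & forall h, m <= 2 ^ (L * h) -> d m < 2 ^ (2 ^ h).
Proof.
move=> nd L0; have L0' : (0 < L%:R :> R)%R by rewrite ltr0n.
have c0 : (0 < L%:R^-1 :> R)%R by rewrite invr_gt0.
have [m Nm dm] := nd _ c0 N; exists m => // h mh.
rewrite -(ltr_nat R); apply: (lt_le_trans dm).
have -> : ((2 ^ 2 ^ h)%:R = 2 `^ ((2 ^ (L * h))%:R `^ L%:R^-1) :> R)%R.
  rewrite [in RHS]natrX mulnC -(powR_mulrn (h * L)) ?ler0n //.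
  rewrite natrM -powRrM mulfK ?gt_eqF // powR_mulrn ?ler0n //.
  by rewrite -natrX powR_mulrn ?ler0n // natrX.
apply: ler_powR; first by rewrite ler1n.
by apply: ge0_ler_powR; rewrite ?nnegrE ?ler0n ?ler_nat // ltW.
Qed.
End Real.

Theorem theorem1 (R : realType) :
  ~ (NEXP `<=` NP_T (NP `&` NEXPD R)).
Proof.
move=> /(_ _ satisfiable_NEXP)[A [[k1 _ [V [[cV Vh] VA]]] Asparse] [M [k [[cM Mh] MS]]]].
apply: (@sparse_oracle_contradiction M V A (fun n => cM * n ^ k + cM) (fun n => cV * n ^ k1 + cV)).
- exact: VA.
- exact: Mh.
- exact: Vh.
- by move=> m n mn; rewrite leq_add2r leq_mul2l exp_mono ?orbT.
- exact: poly_time.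
- exact: poly_time.
- exact: MS.
- by move=> L N L0; apply: nonexponential_bound Asparse L0.
Qed.
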